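(* Throughout, the indices $j_1,j_2,h,\ell$ satisfy $0\le j_1+j_2\le4$ and $1\le h,\ell\le3$. Fix $R$, $r^1,r^2,r^3\in R$ and $\iota_1,\iota_2,\iota_3$ as in the context. There exist - continuous maps $\Omega_1\times\Omega_2\ni(H,Q)=p\mapsto\Psi(p)^{h,j_1,j_2}_\ell=\Psi^{h,j_1,j_2}_\ell(z,t)\in\mathbb{C}\{z,t\}$ and $\Omega_1\times\Omega_2\ni p\mapsto K(p)^{h,j_1,j_2}_\ell=K^{h,j_1,j_2}_\ell(z,w)\in\mathbb{C}\{z,w\}$; - continuous maps $\Omega_2\ni Q\mapsto B_Q=B(z)\in\mathbb{C}\{z\}$ and $\Omega_1\times\Omega_2\ni p\mapsto(d_n(p)^{h,j_1,j_2}_\ell,e_n(p)^{h,j_1,j_2}_\ell,f_n(p)^{h,j_1,j_2}_\ell,g_n(p)^{h,j_1,j_2}_\ell)\in\mathbb{C}^4$, $n\in\mathbb{N}$, such that for any given $(H,Q)\in\Omega_1\times\Omega_2$ there exists a solution $\alpha=(\alpha_1,\alpha_2,\alpha_3)\in(\mathbb{C}\{z,w\})^3$, $\alpha(0)=0$, of $$\sum_{j=1}^{3}r_j(H(z,w),\overline H(\chi,\tau))\,\alpha_j(z,w)+\overline r_j(\overline H(\chi,\tau),H(z,w))\,\overline\alpha_j(\chi,\tau)=0\quad\text{for }w=Q(z,\chi,\tau),\ \ \text{all }r=(r_1,r_2,r_3)\in R,\qquad( * )$$ whose $4$-jet at $0$ is $\Lambda_0=(\Lambda_{0,h}^{j_1,j_2})\in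 J_0^4$ if and only if the following conditions hold: (i) the maps $(z,w)\mapsto\sum_{j_1,j_2,h}\Psi^{h,j_1,j_2}_\ell\big(z,\tfrac{w}{B(z)}\big)\Lambda_{0,h}^{j_1,j_2}$, $1\le\ell\le3$, extend holomorphically to a neighborhood of $0$ in $\mathbb{C}^2$. This happens if and only if $\sum_{j_1,j_2,h}d_{n,\ell}^{h,j_1,j_2}\Lambda_{0,h}^{j_1,j_2}=0$ for all $n\in\mathbb{N}$, $1\le\ell\le3$, and if and only if $$\sum_{j_1,j_2,h}\Psi^{h,j_1,j_2}_\ell\Big(z,\frac{w}{B(z)}\Big)\Lambda_{0,h}^{j_1,j_2}=\sum_{j_1,j_2,h}K^{h,j_1,j_2}_\ell(z,w)\Lambda_{0,h}^{j_1,j_2}=:K_\ell(z,w,\Lambda_0)$$ for $1\le\ell\le3$; (ii) the $4$-jet at $0$ of the map $(z,w)\mapsto(K_1(z,w,\Lambda_0),K_2(z,w,\Lambda_0),K_3(z,w,\Lambda_0))$ coincides with $\Lambda_0$. If (i) is satisfied, this holds if and only if $\sum_{j_1,j_2,h}e_{n,\ell}^{h,j_1,j_2}\Lambda_{0,h}^{j_1,j_2}=0$ for all $n\in\mathbb{N}$, $1\le\ell\le3$; (iii) the triple $(K_1(z,w,\Lambda_0),K_2(z,w,\Lambda_0),K_3(z,w,\Lambda_0))$ solves $( * )$. If (i) is satisfied, this holds if and only if $\sum_{j_1,j_2,h}\big(f_{n,\ell}^{h,j_1,j_2}\Lambda_{0,h}^{j_1,j_2}+g_{n,\ell}^{h,j_1,j_2}\overline\Lambda{}_{0,h}^{j_1,j_2}\big)=0$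 for all $n\in\mathbb{N}$, $1\le\ell\le3$.
   Context: Variables: $z,\chi,w,\tau\in\mathbb{C}$. A bar over a power series means that its coefficients are conjugated. All rings of convergent power series carry their direct limit (DFS) topology (inductive limit over $R>0$ of the Banach spaces of functions holomorphic on the ball of radius $R$ and continuous up to its closure). $J_0^4=\mathfrak{m}\,\mathbb{C}\{z,w\}^3/\mathfrak{m}^5$, $\mathfrak{m}=(z,w)$, is the space of $4$-jets at $0$ of germs of holomorphic maps $\mathbb{C}^2\to\mathbb{C}^3$ vanishing at $0$, with coordinates $\Lambda=(\Lambda_h^{j_1,j_2})$ given by the derivatives (Taylor coefficients) $\partial_z^{j_1}\partial_w^{j_2}$ of the $h$-th component at $0$. $Q$ denotes a germ in $\mathbb{C}\{z,\chi,\tau\}$ defining a real-analytic hypersurface $M\subset\mathbb{C}^2$ through $0$ in normal coordinates, i.e. the complexification of $M$ is $\{w=Q(z,\chi,\tau)\}$ (equivalently $\tau=\overline Q(\chi,z,w)$) with $Q(z,0,\tau)\equiv Q(0,\chi,\tau)\equiv\tau$ and $Q(z,\chi,\overline Q(\chi,z,w))\equiv w$. $\Omega_2$ is the set of those $Q$ with $Q_{z\chi}(0,0,0)\ne0$ (i.e. $M$ strongly pseudoconvex at $0$). $L=\partial_\chi+\overline Q_\chi(\chi,z,w)\,\partial_\tau$ is the CR vector field tangent to $\{w=Q(z,\chi,\tau)\}$. $R\subset\mathbb{C}\{Z',\zeta'\}^3$ is a fixed real subspace ($Z',\zeta'\in\mathbb{C}^3$), $r^k=(r^k_1,r^k_2,r^k_3)\in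 R$ ($k=1,2,3$) are fixed elements and $\iota_k\in\{0,1,2\}$ fixed integers. $\Omega_1$ is the open set of $H\in(\mathbb{C}\{z,w\})^3$ with $H(0)=0$ for which $\det\big(L^{\iota_k}r^k_j(H(z,w),\overline H(\chi,\tau))\big)_{k,j=1,2,3}\neq0$ at $0$ (in normal coordinates this condition does not depend on $Q$). The expressions $\Psi(z,w/B(z))$ are considered where $B(z)\ne0$ and $|w/B(z)|$ is small. *)

(* Defs.v *)
From HB Require Import structures.
From mathcomp Require Import all_boot all_order all_algebra.
From mathcomp Require Import complex.
From mathcomp Require Import all_classical all_reals all_analysis.
Set Implicit Arguments.
Unset Strict Implicit.
Unset Printing Implicit Defensive.
Import Order.TTheory GRing.Theory Num.Theory.
Import numFieldNormedType.Exports.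
Local Open Scope classical_set_scope.
Local Open Scope ring_scope.

(* Stated at type [numClosedFieldType] so that the topology and the normed
   module structure of [numFieldNormedType] apply. The order of [Cplx R] is the
   partial one: [0 < r] says that [r] is real and positive, and norms are
   elements of [Cplx R]. *)
Definition Cplx (R : realType) : numClosedFieldType := R[i].

Section PowerSeries.
Context {R : realType}.
Notation C := (Cplx R).

Definition ps n : Type := ('I_n -> nat) -> C.

Definition bar n (f : ps n) : ps n := fun a => (f a)^*.

Definition midx n (s : seq nat) : 'I_n -> nat := fun i => nth 0%N s i.

Definition pt n (s : seq C) : 'rV[C]_n := \row_i s`_i.

Definition monom n (x : 'rV[C]_n) (a : 'I_n -> nat) : C := \prod_i x 0 i ^+ a i.

(* Partial sum over the multi-indices all of whose entries are < N. *)
Definition psum n (f : ps n) (x : 'rV[C]_n) (N : nat) : C :=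
  \sum_(a : {ffun 'I_n -> 'I_N})
    f (fun i => val (a i)) * monom x (fun i => val (a i)).

Definition abs_summable n (f : ps n) (x : 'rV[C]_n) : Prop :=
  exists M : C, forall N : nat,
    \sum_(a : {ffun 'I_n -> 'I_N})
      `|f (fun i => val (a i)) * monom x (fun i => val (a i))| <= M.

(* Meaningful where the series is absolutely summable. *)
Definition eval n (f : ps n) (x : 'rV[C]_n) : C := lim (psum f x @ \oo).

(* The derivative of f at 0 of multi-order a, read off the coefficients. *)
Definition partial0 n (f : ps n) (a : 'I_n -> nat) : C :=
  (\prod_i (a i)`!)%:R * f a.

Definition convergent n (f : ps n) : Prop :=
  exists r M : C, 0 < r /\ forall a, `|f a| * r ^+ (\sum_i a i)%N <= M.

Definition convergent_pred n : {pred ps n} := fun f => `[< convergent f >].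

Lemma convergent_submod n : submod_closed (@convergent_pred n).
Proof.
split.
  apply/asboolP; exists 1, 0; split; first exact: ltr01.
  by move=> a; rewrite /= normr0 mul0r.
move=> c f g /asboolP[r [M [r0 fM]]] /asboolP[s [N [s0 gN]]].
apply/asboolP.
have rs : r \is Num.real by exact: gtr0_real.
have ss : s \is Num.real by exact: gtr0_real.
have [t [t0 tr ts]] : exists t : C, [/\ 0 < t, t <= r & t <= s].
  case/orP: (real_leVge rs ss) => le_rs; first by exists r.
  by exists s.
exists t, (`|c| * M + N); split=> // a.
rewrite (le_trans (ler_wpM2r _ (ler_normD _ _)))//; first exact/exprn_ge0/ltW.
rewrite normrM mulrDl -mulrA lerD//.
  rewrite ler_wpM2l// (le_trans _ (fM a))// ler_wpM2l//.
  by apply: lerXn2r => //; rewrite nnegrE ltW.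
rewrite (le_trans _ (gN a))// ler_wpM2l//.
by apply: lerXn2r => //; rewrite nnegrE ltW.
Qed.

Record germ n := Germ {
  germ_ps :> ps n;
  _ : germ_ps \in @convergent_pred n }.

HB.instance Definition _ n := [isSub for @germ_ps n].
HB.instance Definition _ n := [Choice of germ n by <:].
HB.instance Definition _ n :=
  GRing.isSubmodClosed.Build C (ps n) (@convergent_pred n) (@convergent_submod n).
HB.instance Definition _ n := [SubChoice_isSubLmodule of germ n by <:].

Definition oball n (r : C) : set 'rV[C]_n :=
  [set x | \sum_i `|x 0 i| ^+ 2 < r ^+ 2].

Definition cball n (r : C) : set 'rV[C]_n :=
  [set x | \sum_i `|x 0 i| ^+ 2 <= r ^+ 2].

(* The germs belonging to the Banach space of functions holomorphic on the open
   ball of radius r and continuous up to its closure. A holomorphic function on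
   a ball is the absolutely convergent sum of its Taylor series at the centre. *)
Definition banach n (r : C) : set (germ n) := [set f |
  (forall x, oball r x -> abs_summable f x) /\
  exists2 F : 'rV[C]_n -> C,
    {within cball r, continuous F} & forall x, oball r x -> F x = eval f x].

Definition abs_convex n (V : set (germ n)) : Prop :=
  forall (a b : C) (f g : germ n), `|a| + `|b| <= 1 -> V f -> V g ->
    V (a *: f + b *: g).

(* Basic neighbourhoods of 0 of the locally convex inductive limit: absolutely
   convex sets whose trace on each Banach space is a neighbourhood of 0 there
   (the sup norm may be computed on the open ball). *)
Definition ind_nbhs0 n (V : set (germ n)) : Prop :=
  abs_convex V /\
  forall r : C, 0 < r -> exists2 e : C, 0 < e &
    forall f, banach r f -> (forall x, oball r x -> `|eval f x| <= e) -> V f.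

Definition ind_open n (U : set (germ n)) : Prop :=
  forall f, U f -> exists2 V, ind_nbhs0 V & forall g, V g -> U (f + g).

Lemma ind_openT n : @ind_open n setT.
Proof. by move=> f _; exists setT => //; split=> // r r0; exists 1. Qed.

Lemma ind_openI n : setI_closed (@ind_open n).
Proof.
move=> A B oA oB f [/oA[V [cV nV] VA] /oB[W [cW nW] WB]].
exists (V `&` W); last by move=> g [/VA ? /WB ?].
split=> [a b g h ab [Vg Wg] [Vh Wh]|r r0].
  by split; [exact: cV|exact: cW].
have [[e e0 eV] [d d0 dW]] := (nV r r0, nW r r0).
have [t [t0 te td]] : exists t : C, [/\ 0 < t, t <= e & t <= d].
  case/orP: (real_leVge (gtr0_real e0) (gtr0_real d0)) => le_ed.
    by exists e.
  by exists d.
exists t => // g Ag gt; split; [apply: eV => // x rx|apply: dW => // x rx].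
  exact: le_trans (gt x rx) te.
exact: le_trans (gt x rx) td.
Qed.

Lemma ind_open_bigU n (I : Type) (U : I -> set (germ n)) :
  (forall i, ind_open (U i)) -> ind_open (\bigcup_i U i).
Proof.
by move=> oU f [i _ /oU[V nV VU]]; exists V => // g /VU Ug; exists i.
Qed.

HB.instance Definition _ n := isOpenTopological.Build (germ n)
  (@ind_openT n) (@ind_openI n) (@ind_open_bigU n).

End PowerSeries.
Arguments ps : clear implicits.
Arguments germ : clear implicits.

Section Setting.
Context {R : realType}.
Notation C := (Cplx R).

(* C{z,w}^3 with the product topology. *)
Definition germ3 : topologicalType := {ptws 'I_3 -> germ R 2}.

Definition evalv (H : 'I_3 -> germ R 2) (x : 'rV[C]_2) : 'rV[C]_3 :=
  \row_k eval (H k) x.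

Definition evalv_bar (H : 'I_3 -> germ R 2) (x : 'rV[C]_2) : 'rV[C]_3 :=
  \row_k eval (bar (H k)) x.

(* The first three of the six variables are Z', the last three zeta'. *)
Definition real_subspace (S : set ('I_3 -> germ R (3 + 3))) : Prop :=
  [/\ S (fun=> 0),
      forall r s, S r -> S s -> S (fun j => r j + s j) &
      forall (c : C) r, c \is Num.real -> S r -> S (fun j => c *: r j)].

Definition normal_coord (Q : germ R 3) : Prop :=
  \forall p \near (0 : C * C * C),
    [/\ let: (z, chi, tau) := p in eval Q (pt 3 [:: z; 0; tau]) = tau,
        let: (z, chi, tau) := p in eval Q (pt 3 [:: 0; chi; tau]) = tau &
        let: (z, chi, w) := p in
          eval Q (pt 3 [:: z; chi; eval (bar Q) (pt 3 [:: chi; z; w])]) = w].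

Definition Omega2 : set (germ R 3) := [set Q |
  normal_coord Q /\ partial0 Q (midx [:: 1; 1; 0]%N) != 0].

(* The vector field L acting on functions of (z, w, chi, tau). *)
Definition Lfield (Q : germ R 3) (G : C -> C -> C -> C -> C) :
    C -> C -> C -> C -> C := fun z w chi tau =>
  derive1 (fun x => G z w x tau) chi +
  derive1 (fun x => eval (bar Q) (pt 3 [:: x; z; w])) chi *
  derive1 (fun t => G z w chi t) tau.

(* rho (H(z,w), conj H (chi,tau)) *)
Definition along (rho : germ R (3 + 3)) (H : 'I_3 -> germ R 2)
    (z w chi tau : C) : C :=
  eval rho (row_mx (evalv H (pt 2 [:: z; w]))
                   (evalv_bar H (pt 2 [:: chi; tau]))).

(* rbar (conj H (chi,tau), H(z,w)) *)
Definition along_bar (rho : germ R (3 + 3)) (H : 'I_3 -> germ R 2)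
    (z w chi tau : C) : C :=
  eval (bar rho) (row_mx (evalv_bar H (pt 2 [:: chi; tau]))
                         (evalv H (pt 2 [:: z; w]))).

Definition Lmx (r : 'I_3 -> 'I_3 -> germ R (3 + 3)) (iota : 'I_3 -> nat)
    (H : 'I_3 -> germ R 2) (Q : germ R 3) : 'M[C]_3 :=
  \matrix_(k, j) iter (iota k) (Lfield Q) (along (r k j) H) 0 0 0 0.

(* In normal coordinates the condition is the same for all Q: where z = w = 0
   the coefficient of d/dtau in L vanishes. *)
Definition Omega1 (r : 'I_3 -> 'I_3 -> germ R (3 + 3)) (iota : 'I_3 -> nat) :
    set germ3 := [set H : germ3 |
  evalv H 0 = 0 /\ forall Q, normal_coord Q -> \det (Lmx r iota H Q) != 0].

Definition solves (S : set ('I_3 -> germ R (3 + 3))) (H : 'I_3 -> germ R 2)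
    (Q : germ R 3) (alpha : 'I_3 -> germ R 2) : Prop :=
  forall r, S r -> \forall p \near (0 : C * C * C),
    let: (z, chi, tau) := p in
    let w := eval Q (pt 3 [:: z; chi; tau]) in
    \sum_(j < 3) (along (r j) H z w chi tau * eval (alpha j) (pt 2 [:: z; w])
      + along_bar (r j) H z w chi tau *
        eval (bar (alpha j)) (pt 2 [:: chi; tau])) = 0.

(* Triples (h, j1, j2) with j1 + j2 <= 4. A 4-jet is given by its derivatives at
   0; the jets in J04 have no constant term. *)
Definition jidx := {j : 'I_3 * 'I_5 * 'I_5 | (j.1.2 + j.2 <= 4)%N}.

Definition J04 : set (jidx -> C) := [set Lam |
  forall j : jidx, ((val j).1.2 + (val j).2 = 0)%N -> Lam j = 0].

Definition jet4 (alpha : 'I_3 -> germ R 2) : jidx -> C := fun j =>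
  partial0 (alpha (val j).1.1) (midx [:: val (val j).1.2; val (val j).2]).

(* Phi(z, w / B(z)) = F(z,w) wherever B(z) != 0 and z, w, w / B(z) are small. *)
Definition agree (Phi : germ R 2) (B : germ R 1) (F : germ R 2) : Prop :=
  \forall p \near (0 : C * C * C), let: (z, w, t) := p in
    eval B (pt 1 [:: z]) != 0 -> t = w / eval B (pt 1 [:: z]) ->
    eval Phi (pt 2 [:: z; t]) = eval F (pt 2 [:: z; w]).

Definition extends (Phi : germ R 2) (B : germ R 1) : Prop :=
  exists F : germ R 2, agree Phi B F.

End Setting.
Arguments germ3 : clear implicits.

(* Main.v *)
(* Let (H, Q) be given. Taking iota_k derivatives in s of (star) for the elements r^k,
   along a Segre curve with parameter s, and solving a 3 x 3 linear system expresses
   conj(alpha) through alpha; doing it again yields alpha(z, Q(z, chi, 0)) = Phi(alpha)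
   with Phi linear. In normal coordinates each step loses at most two orders of
   vanishing in one of the variables, so Phi kills what vanishes to order 5 and
   alpha(z, Q(z, chi, 0)) is a linear function of the 4-jet alone. As Q_{z chi} is not 0,
   Q(z, chi, 0) = z chi u(z, chi) with a unit u, and Lagrange inversion of chi u in chi
   gives alpha(z, z t) = Psi(z, t), so B(z) = z works. A series Psi(z, t) comes from a
   germ F by Psi(z, t) = F(z, z t) iff its coefficients of z^m t^n with m < n are 0 (the
   d_n); then F has the coefficients Psi_(a+b, b), which are those of K. The remaining
   conditions are coefficientwise equations for the jet of K and for (star).

   For the inductive limit topology, a map of power series is continuous as soon as
   each of its coefficients depends continuously on finitely many coefficients of the
   argument and the map is bounded on bounded sets; these properties pass through sums,
   products, compositions and inverses. *)
From HB Require Import structures.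
From mathcomp Require Import all_boot all_order all_algebra.
From mathcomp Require Import complex.
From mathcomp Require Import all_classical all_reals all_analysis.
From mathcomp Require Import ring lra zify.
Require Import Defs.
Set Implicit Arguments.
Unset Strict Implicit.
Unset Printing Implicit Defensive.
Import Order.TTheory GRing.Theory Num.Theory.
Import numFieldNormedType.Exports.
Local Open Scope classical_set_scope.
Local Open Scope ring_scope.

(** * Formal power series *)

(** The order 4 of the jets is 2 + 2. As Q(0, chi, tau) = tau, the germ [W0] vanishes for s = tau =
    0. So if alpha has order 5, its substitution has order 5 in (tau, s), and a Taylor coefficient
    of degree at most 2 in s keeps order 3 in tau. As [T0] vanishes for s = 0, the second step turns
    this into order 3 in s, and again a coefficient of degree at most 2 in s is read off: it is 0.

    Consequently a solution is determined by its jet and must be the K built from that jet; the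
    conditions test this single candidate.

    The obstacle to continuity is division: inverses are not bounded on bounded sets of parameters,
    because the determinants may come close to 0. Hence the estimates are made on sets
    [admissible d], where the determinants stay away from 0; membership depends on finitely many
    degrees of the parameters only, so tails can be exchanged freely. The same calculus, applied to
    constant families, yields the convergence of all the series involved. *)

Section RealNorm.
Context {R : realType}.
Notation C := (Cplx R).
Implicit Types x y : C.

(* The norm of C has values in C, whose order is partial; estimates are made in R. *)
Definition nr (x : C) : R := complex.Re (`|x| : R[i]).

Lemma nrE x : `|x| = ((nr x)%:C)%C :> C.
Proof. by rewrite /nr; have := RRe_real (normr_real (x : R[i])) => ->. Qed.

Lemma nr_ge0 x : 0 <= nr x.
Proof. by have := normr_ge0 x; rewrite nrE; have := @lecR R 0 (nr x) => ->. Qed.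

Lemma nrI x (r : R) : `|x| = (r%:C)%C :> C -> nr x = r.
Proof. by rewrite nrE => -[]. Qed.

Lemma nr0 : nr 0 = 0. Proof. by apply: nrI; rewrite normr0. Qed.
Lemma nr1 : nr 1 = 1. Proof. by apply: nrI; rewrite normr1. Qed.
Lemma nrM x y : nr (x * y) = nr x * nr y.
Proof. by apply: nrI; rewrite normrM !nrE; exact/esym/(rmorphM (real_complex R)). Qed.
Lemma nrN x : nr (- x) = nr x.
Proof. by apply: nrI; rewrite normrN nrE. Qed.
Lemma nrB x y : nr (x - y) = nr (y - x).
Proof. by rewrite -nrN opprB. Qed.
Lemma nrD x y : nr (x + y) <= nr x + nr y.
Proof.
have := ler_normD x y; rewrite !nrE.
have -> : (nr x)%:C%C + (nr y)%:C%C = (nr x + nr y)%:C%C :> C.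
  exact/esym/(rmorphD (real_complex R)).
by have := @lecR R (nr (x + y)) (nr x + nr y) => ->.
Qed.
Lemma nrX x n : nr (x ^+ n) = nr x ^+ n.
Proof. by elim: n => [|n IH]; rewrite ?expr0 ?nr1// !exprS nrM IH. Qed.
Lemma nr_real (r : R) : nr (r%:C)%C = `|r|.
Proof. by apply: nrI; rewrite normc_def /= expr0n /= addr0 sqrtr_sqr. Qed.
Lemma nr_conj x : nr x^* = nr x.
Proof. by apply: nrI; rewrite norm_conjC nrE. Qed.
Lemma nr_eq0 x : (nr x == 0) = (x == 0).
Proof.
rewrite -(normr_eq0 x) nrE; apply/eqP/eqP => [->//|].
by move/(congr1 (@complex.Re R)).
Qed.
Lemma nrV x : nr x^-1 = (nr x)^-1.
Proof.
have [->|x0] := eqVneq x 0; first by rewrite invr0 nr0 invr0.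
apply: (mulfI (x := nr x)); first by rewrite nr_eq0.
by rewrite -nrM !divff// ?nr_eq0// nr1.
Qed.
Lemma nr_sum (I : Type) (s : seq I) (P : pred I) (F : I -> C) :
  nr (\sum_(i <- s | P i) F i) <= \sum_(i <- s | P i) nr (F i).
Proof.
elim/big_ind2: _ => [|x r y s' xr ys|//]; first by rewrite nr0.
by rewrite (le_trans (nrD _ _))// lerD.
Qed.
Lemma nr_prod (I : Type) (s : seq I) (P : pred I) (F : I -> C) :
  nr (\prod_(i <- s | P i) F i) = \prod_(i <- s | P i) nr (F i).
Proof. by rewrite (big_morph nr nrM nr1). Qed.

Lemma lec_nr x (r : R) : (`|x| <= (r%:C)%C :> C) = (nr x <= r).
Proof. by rewrite nrE; exact: lecR. Qed.
Lemma ltc_nr x (r : R) : (`|x| < (r%:C)%C :> C) = (nr x < r).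
Proof. by rewrite nrE; exact: ltcR. Qed.

Lemma gt0_realP (e : C) : 0 < e -> exists2 r : R, 0 < r & e = (r%:C)%C.
Proof.
move=> e0; have er : e = ((nr e)%:C)%C by rewrite -nrE gtr0_norm.
by exists (nr e) => //; rewrite lt0r nr_ge0 nr_eq0 gt_eqF.
Qed.
End RealNorm.

Section MultiIndex.
Variable n : nat.
Notation mi := ('I_n -> nat).
Implicit Types a b c : mi.

Definition mdeg a := (\sum_i a i)%N.
Definition madd a b : mi := fun i => (a i + b i)%N.
Definition mi0 : mi := fun=> 0%N.

Lemma maddC a b : madd a b = madd b a.
Proof. by apply/funext => i; rewrite /madd addnC. Qed.
Lemma maddA a b c : madd a (madd b c) = madd (madd a b) c.
Proof. by apply/funext => i; rewrite /madd addnA. Qed.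
Lemma madd0 a : madd mi0 a = a. Proof. by apply/funext. Qed.
Lemma maddI a b c : madd a b = madd a c -> b = c.
Proof. by move=> /funeqP abc; apply/funext => i; have /addnI := abc i. Qed.
Lemma mdegD a b : mdeg (madd a b) = (mdeg a + mdeg b)%N.
Proof. by rewrite /mdeg -big_split. Qed.
Lemma mdeg0 : mdeg mi0 = 0%N. Proof. by rewrite /mdeg big1. Qed.
Lemma leq_mdeg a i : (a i <= mdeg a)%N.
Proof. by rewrite /mdeg (bigD1 i)//= leq_addr. Qed.
Lemma mdeg_eq0 a : mdeg a = 0%N -> a = mi0.
Proof.
by move=> a0; apply/funext => i; apply/eqP; rewrite -leqn0 -a0 leq_mdeg.
Qed.

(** A sequence of functions rather than a finite type of tables: cubes of different sizes then share
    one index type, and sums over them are compared by inclusion. *)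
Definition box N : seq mi :=
  [seq (fun i => val (a i)) : mi | a : {ffun _ -> _} <- enum {ffun 'I_n -> 'I_N}].

Lemma mem_box N a : (a \in box N) = [forall i, a i < N]%N.
Proof.
apply/mapP/forallP => [[b _ -> i]|aN]; first exact: ltn_ord.
exists [ffun i => Ordinal (aN i)]; first by rewrite mem_enum.
by apply/funext => i; rewrite ffunE.
Qed.

Lemma boxP N a : reflect (forall i, a i < N)%N (a \in box N).
Proof. by rewrite mem_box; exact: forallP. Qed.

Lemma box_uniq N : uniq (box N).
Proof.
rewrite map_inj_uniq ?enum_uniq// => a b /funeqP ab.
by apply/ffunP => i; apply/val_inj/ab.
Qed.

Lemma mdeg_box a N : (mdeg a < N)%N -> a \in box N.
Proof. by move=> aN; apply/boxP => i; apply: leq_ltn_trans aN; exact: leq_mdeg. Qed.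

Lemma box_mdeg a N : a \in box N -> (mdeg a <= n * N)%N.
Proof.
move=> /boxP aN; apply: (@leq_trans (\sum_(i < n) N)).
  by apply: leq_sum => i _; exact/ltnW.
by rewrite sum_nat_const card_ord.
Qed.

Lemma notin_box a N : a \notin box N -> (N <= mdeg a)%N.
Proof. by apply: contraR; rewrite -ltnNge; exact: mdeg_box. Qed.

Lemma box_le N N' a : (N <= N')%N -> a \in box N -> a \in box N'.
Proof. by move=> NN /boxP aN; apply/boxP => i; apply: leq_trans (aN i) NN. Qed.

Lemma box_addl N a b : madd a b \in box N -> a \in box N.
Proof.
by move=> /boxP aN; apply/boxP => i; apply: leq_ltn_trans (aN i); exact: leq_addr.
Qed.
Lemma box_addr N a b : madd a b \in box N -> b \in box N.
Proof. by rewrite maddC; exact: box_addl. Qed.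

Lemma big_box (V : nmodType) N (F : mi -> V) :
  \sum_(a : {ffun 'I_n -> 'I_N}) F (fun i => val (a i)) = \sum_(a <- box N) F a.
Proof. by rewrite /box big_map big_enum. Qed.

Lemma sum_uniq_sub (V : nmodType) (s t : seq mi) (F : mi -> V) :
  uniq s -> uniq t -> {subset s <= t} ->
  (forall a, a \in t -> a \notin s -> F a = 0) ->
  \sum_(a <- t) F a = \sum_(a <- s) F a.
Proof.
move=> us ut st F0; rewrite (bigID (mem s))/= [X in _ + X]big_seq_cond.
rewrite [X in _ + X]big1 ?addr0; last by move=> a /andP[/F0]; exact.
rewrite -big_filter; apply/perm_big/uniq_perm; rewrite ?filter_uniq// => a.
by rewrite mem_filter; case: (boolP (a \in s)) => //= /st.
Qed.

Lemma sum_box_widen (V : nmodType) N N' (F : mi -> V) : (N <= N')%N ->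
  (forall a, a \in box N' -> a \notin box N -> F a = 0) ->
  \sum_(a <- box N') F a = \sum_(a <- box N) F a.
Proof.
move=> NN; apply: sum_uniq_sub; rewrite ?box_uniq// => a; exact: box_le.
Qed.

Lemma sum_box1 (V : nmodType) N c (F : mi -> V) : c \in box N ->
  \sum_(a <- box N | a == c) F a = F c.
Proof.
move=> cN; rewrite -big_filter.
have -> : [seq a <- box N | a == c] = [:: c].
  apply: perm_small_eq => //; apply: uniq_perm; rewrite ?filter_uniq ?box_uniq//.
  by move=> a; rewrite mem_filter inE; case: eqP => //= ->.
by rewrite big_seq1.
Qed.

End MultiIndex.
Arguments mi0 : clear implicits.
Arguments box : clear implicits.

(* On ps the product would be the pointwise one of functions; the copy fps carries
   the Cauchy product instead. *)
Definition fps (R : realType) n : Type := ps R n.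

Section FpsRing.
Context {R : realType}.
Variable n : nat.
Notation C := (Cplx R).
Notation mi := ('I_n -> nat).
Notation F := (ps R n).
Implicit Types f g h : F.

(** All a, b with a + b = c lie in the cube of side |c| + 1; [fmulE] allows any cube that contains
    c. *)
Definition fmul f g : F := fun c =>
  \sum_(a <- box n (mdeg c).+1)
    \sum_(b <- box n (mdeg c).+1 | madd a b == c) f a * g b.

Definition fone : F := fun a => (a == mi0 n)%:R.

Lemma fmulE N f g c : c \in box n N -> fmul f g c =
  \sum_(a <- box n N) \sum_(b <- box n N | madd a b == c) f a * g b.
Proof.
move=> cN.
suff E K : c \in box n K -> (K <= maxn N (mdeg c).+1)%N ->
    \sum_(a <- box n (maxn N (mdeg c).+1))
      \sum_(b <- box n (maxn N (mdeg c).+1) | madd a b == c) f a * g b =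
    \sum_(a <- box n K) \sum_(b <- box n K | madd a b == c) f a * g b.
  by rewrite /fmul -!E ?leq_maxl ?leq_maxr// mdeg_box.
(* A cube is closed under passing to summands, so a pair that leaves the cube of side K cannot add
   up to c. *)
move=> cK KM; rewrite (sum_box_widen KM) => [|a aM aK].
  apply: eq_bigr => a _; rewrite big_mkcond (sum_box_widen KM) -?big_mkcond//.
  by move=> b bM bK; case: eqP => // ac; rewrite -ac in cK; rewrite (box_addr cK) in bK.
by rewrite big1// => b /eqP ac; rewrite -ac in cK; rewrite (box_addl cK) in aK.
Qed.

Lemma fmulC f g : fmul f g = fmul g f.
Proof.
apply/funext => c; rewrite /fmul.
under eq_bigr do rewrite big_mkcond.
rewrite exchange_big; apply: eq_bigr => a _ /=; rewrite [RHS]big_mkcond.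
by apply: eq_bigr => b _; rewrite maddC mulrC.
Qed.

(** The condition a + b + e = c is symmetric, so associativity becomes a renaming of summation
    indices. *)
Lemma fmul3 f g h c N : c \in box n N -> fmul f (fmul g h) c =
  \sum_(a <- box n N) \sum_(b <- box n N) \sum_(e <- box n N)
     if madd a (madd b e) == c then f a * g b * h e else 0.
Proof.
move=> cN; rewrite (fmulE _ _ cN); apply: eq_bigr => a _.
transitivity (\sum_(d <- box n N | madd a d == c) \sum_(b <- box n N)
   \sum_(e <- box n N) if madd b e == d then f a * g b * h e else 0).
  rewrite big_seq_cond [RHS]big_seq_cond; apply: eq_bigr => d /andP[dN _].
  rewrite (fmulE _ _ dN) mulr_sumr; apply: eq_bigr => b _.
  by rewrite mulr_sumr big_mkcond; apply: eq_bigr => e _; case: ifP; rewrite ?mulrA.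
rewrite exchange_big; apply: eq_bigr => b _ /=.
rewrite exchange_big; apply: eq_bigr => e _ /=.
case: ifPn => [/eqP abc|abc]; last first.
  by apply: big1_seq => d /andP[/eqP adc _]; case: eqP => // bed;
    rewrite bed adc eqxx in abc.
have beN : madd b e \in box n N by apply: (@box_addr _ _ a); rewrite abc.
rewrite -[RHS](sum_box1 (fun=> f a * g b * h e) beN) big_mkcond [RHS]big_mkcond.
apply: eq_bigr => d _; case: (d =P madd b e) => [->|/eqP dbe].
  by rewrite abc !eqxx.
by rewrite [madd b e == d]eq_sym (negPf dbe) if_same.
Qed.

Lemma fmulA f g h : fmul f (fmul g h) = fmul (fmul f g) h.
Proof.
apply/funext => c; have cN := mdeg_box (ltnSn (mdeg c)).
rewrite [in RHS]fmulC !(fmul3 _ _ _ cN) [RHS]exchange_big.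
apply: eq_bigr => a _; rewrite [RHS]exchange_big; apply: eq_bigr => b _.
apply: eq_bigr => e _; rewrite [in RHS]maddC -[in RHS]maddA; case: eqP => // _.
by ring.
Qed.

Lemma fmul1 f : fmul fone f = f.
Proof.
apply/funext => c; have cN := mdeg_box (ltnSn (mdeg c)); rewrite /fmul.
rewrite (bigD1_seq (mi0 n)) ?box_uniq//=; last by rewrite mdeg_box ?mdeg0.
rewrite [X in _ + X]big1 ?addr0 => [|a a0]; last first.
  by rewrite big1// => b _; rewrite /fone (negPf a0) mul0r.
rewrite (eq_bigl (fun b => b == c)) => [|b]; last by rewrite madd0.
by rewrite sum_box1// /fone eqxx mul1r.
Qed.

Lemma fmulDl f g h : fmul (f + g) h = fmul f h + fmul g h.
Proof.
apply/funext => c; 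
have -> : (fmul f h + fmul g h) c = fmul f h c + fmul g h c by [].
rewrite /fmul -big_split.
apply: eq_bigr => a _ /=; rewrite -big_split; apply: eq_bigr => b _ /=.
by rewrite -mulrDl.
Qed.

Lemma fone_neq0 : fone != 0.
Proof.
apply/eqP => /funeqP /(_ (mi0 n)); rewrite /fone eqxx; exact/eqP/oner_neq0.
Qed.

HB.instance Definition _ := GRing.Lmodule.copy (fps R n) (ps R n).
HB.instance Definition _ :=
  GRing.Zmodule_isComNzRing.Build (fps R n) fmulA fmulC fmul1 fmulDl fone_neq0.

End FpsRing.

Section FpsAlgebra.
Context {R : realType}.
Variable n : nat.
Notation C := (Cplx R).
Notation mi := ('I_n -> nat).
Implicit Types f g h : fps R n.

Lemma fpsM N f g c : c \in box n N -> (f * g) c =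
  \sum_(a <- box n N) \sum_(b <- box n N | madd a b == c) f a * g b.
Proof. exact: fmulE. Qed.

Lemma fps_scaleAl (k : C) f g : k *: (f * g) = (k *: f) * g.
Proof.
apply/funext => c; have cN := mdeg_box (ltnSn (mdeg c)).
have -> : (k *: (f * g)) c = k * (f * g) c by [].
rewrite !(fpsM _ _ cN) mulr_sumr; apply: eq_bigr => a _.
by rewrite mulr_sumr; apply: eq_bigr => b _; rewrite mulrA.
Qed.
HB.instance Definition _ :=
  GRing.Lmodule_isLalgebra.Build C (fps R n) fps_scaleAl.
Lemma fps_scaleAr (k : C) f g : k *: (f * g) = f * (k *: g).
Proof. by rewrite mulrC fps_scaleAl mulrC. Qed.
HB.instance Definition _ :=
  GRing.Lalgebra_isAlgebra.Build C (fps R n) fps_scaleAr.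

Lemma coefD f g a : (f + g) a = f a + g a. Proof. by []. Qed.
Lemma coefN f a : (- f) a = - f a. Proof. by []. Qed.
Lemma coefZ k f a : (k *: f) a = k * f a. Proof. by []. Qed.
Lemma coef_0 a : (0 : fps R n) a = 0. Proof. by []. Qed.
Lemma coef1 a : (1 : fps R n) a = (a == mi0 n)%:R. Proof. by []. Qed.
Lemma coef_sum I (s : seq I) (P : pred I) (F : I -> fps R n) a :
  (\sum_(i <- s | P i) F i) a = \sum_(i <- s | P i) F i a.
Proof. by elim/big_rec2: _ => // i x y _ <-. Qed.

Definition mono (a : mi) : fps R n := fun b => (b == a)%:R.
Definition fX (i : 'I_n) : fps R n := mono (fun j => (j == i)).

Lemma mono0 : mono (mi0 n) = 1. Proof. by []. Qed.

Lemma coef_monoM a f b : (mono a * f) (madd a b) = f b.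
Proof.
have abN := mdeg_box (ltnSn (mdeg (madd a b))); rewrite (fpsM _ _ abN).
rewrite (bigD1_seq a) ?box_uniq ?(box_addl abN)//=.
rewrite [X in _ + X]big1 ?addr0 => [|c /negPf ca]; last first.
  by rewrite big1// => d _; rewrite /mono ca mul0r.
rewrite (eq_bigl (fun c => c == b)) => [|c]; last first.
  by apply/eqP/eqP => [/maddI//|->].
by rewrite (sum_box1 _ (box_addr abN)) /mono eqxx mul1r.
Qed.

Lemma coef_monoM0 a f b i : (b i < a i)%N -> (mono a * f) b = 0.
Proof.
move=> ba; have bN := mdeg_box (ltnSn (mdeg b)); rewrite (fpsM _ _ bN).
rewrite big1// => c _; rewrite big1// => d /eqP cdb; rewrite /mono.
case: eqP => [ca|]; rewrite ?mul0r//.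
by move: ba; rewrite -cdb ca ltnNge leq_addr.
Qed.

Lemma monoM a b : mono a * mono b = mono (madd a b).
Proof.
apply/funext => c; have [/forallP ac|] := boolP [forall i, a i <= c i]%N.
  have -> : c = madd a (fun i => c i - a i)%N.
    by apply/funext => i; rewrite /madd subnKC.
  rewrite coef_monoM /mono; congr (_%:R); apply/congr1.
  by apply/eqP/eqP => [->//|/maddI].
rewrite negb_forall; case/fintype.existsP => i; rewrite -ltnNge => ca.
rewrite (coef_monoM0 _ ca) /mono; case: eqP => // cab.
by move: ca; rewrite cab ltnNge leq_addr.
Qed.

Lemma monoX a k : mono a ^+ k = mono (fun i => k * a i)%N.
Proof.
elim: k => [|k IH]; first by rewrite expr0.
by rewrite exprS IH monoM; congr mono; apply/funext => i; rewrite /madd mulSn.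
Qed.

Lemma mono_prod (I : Type) (s : seq I) (F : I -> mi) :
  \prod_(i <- s) mono (F i) = mono (fun j => \sum_(i <- s) F i j)%N.
Proof.
elim: s => [|i s IH]; first by rewrite big_nil; congr mono;
  apply/funext => j; rewrite big_nil.
by rewrite big_cons IH monoM; congr mono; apply/funext => j; rewrite big_cons.
Qed.

Lemma prod_fX a : \prod_i fX i ^+ a i = mono a.
Proof.
under eq_bigr do rewrite monoX; rewrite mono_prod; congr mono; apply/funext => j.
rewrite (bigD1 j)//= eqxx muln1 big1 ?addn0// => i /negPf ij.
by rewrite eq_sym ij muln0.
Qed.

(** Weights may be 0: [ordw] then measures vanishing in a chosen group of variables, for example
    divisibility by a power of the third variable for [m3 0 0 1]. The loss of order in the
    reflection steps is counted this way. *)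
Definition wdeg (w a : mi) := (\sum_i w i * a i)%N.
Definition ordw (w : mi) k f := forall a, (wdeg w a < k)%N -> f a = 0.

Lemma wdegD w a b : wdeg w (madd a b) = (wdeg w a + wdeg w b)%N.
Proof. by rewrite /wdeg -big_split; apply: eq_bigr => i _; rewrite mulnDr. Qed.
Lemma wdeg1 a : wdeg (fun=> 1%N) a = mdeg a.
Proof. by apply: eq_bigr => i _; rewrite mul1n. Qed.

Lemma ordw0 w f : ordw w 0 f. Proof. by move=> a; rewrite ltn0. Qed.
Lemma ordw_le w k l f : (k <= l)%N -> ordw w l f -> ordw w k f.
Proof. by move=> kl ff a /leq_trans/(_ kl); exact: ff. Qed.
Lemma ordwD w k f g : ordw w k f -> ordw w k g -> ordw w k (f + g).
Proof. by move=> fk gk a ak; rewrite coefD fk ?gk ?addr0. Qed.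
Lemma ordwN w k f : ordw w k f -> ordw w k (- f).
Proof. by move=> fk a ak; rewrite coefN fk ?oppr0. Qed.
Lemma ordw_sum w k I (s : seq I) (P : pred I) (F : I -> fps R n) :
  (forall i, P i -> ordw w k (F i)) -> ordw w k (\sum_(i <- s | P i) F i).
Proof. by move=> Fk; elim/big_ind: _ => // x y; exact: ordwD. Qed.

Lemma ordwM w k l f g : ordw w k f -> ordw w l g -> ordw w (k + l) (f * g).
Proof.
move=> fk gl c ck; rewrite (fpsM _ _ (mdeg_box (ltnSn (mdeg c)))).
rewrite big1// => a _; rewrite big1// => b /eqP abc.
have [ak|ka] := ltnP (wdeg w a) k; first by rewrite fk ?mul0r.
have [bl|lb] := ltnP (wdeg w b) l; first by rewrite gl ?mulr0.
by move: ck; rewrite -abc wdegD ltnNge leq_add.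
Qed.
Lemma ordwMl w k f g : ordw w k g -> ordw w k (f * g).
Proof. by move=> gk; rewrite -[k]add0n; apply: ordwM gk; exact: ordw0. Qed.
Lemma ordwMr w k f g : ordw w k f -> ordw w k (f * g).
Proof. by move=> gk; rewrite mulrC; apply: ordwMl. Qed.
Lemma ordwX w k f j : ordw w k f -> ordw w (j * k) (f ^+ j).
Proof.
move=> fk; elim: j => [|j IH]; first exact: ordw0.
by rewrite exprS mulSn; apply: ordwM.
Qed.
End FpsAlgebra.

(** * Composition of formal power series *)

Section Composition.
Context {R : realType}.
Variables (m n : nat).
Notation C := (Cplx R).
Implicit Types (f : fps R m) (g : 'I_m -> fps R n).

Definition gpow g (a : 'I_m -> nat) : fps R n := \prod_i g i ^+ a i.
(** If no g_i has a constant term, then g^a has order at least |a|, so only |a| <= |b| contributes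
    to the coefficient of index b. Without [g0] the truncated sum is still linear in f, but it is
    not a substitution. *)
Definition comp f g : fps R n := fun b =>
  \sum_(a <- box m (mdeg b).+1) f a * gpow g a b.

Lemma gpowD g a b : gpow g (madd a b) = gpow g a * gpow g b.
Proof. by rewrite /gpow -big_split; apply: eq_bigr => i _; rewrite exprD. Qed.

Lemma gpow0 g : gpow g (mi0 m) = 1.
Proof. by rewrite /gpow big1// => i _; rewrite expr0. Qed.

Lemma ordw_gpow w v g a : (forall i, ordw w (v i) (g i)) ->
  ordw w (wdeg v a) (gpow g a).
Proof.
move=> gv; rewrite /gpow /wdeg.
elim/big_ind2: _ => [|x k y l kx ly|i _]; [exact: ordw0|exact: ordwM|].
by rewrite mulnC; exact: ordwX.
Qed.

Definition g0 g := forall i, g i (mi0 n) = 0.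

Lemma gpow_eq0 g a b : g0 g -> (mdeg b < mdeg a)%N -> gpow g a b = 0.
Proof.
move=> gz; have := @ordw_gpow (fun=> 1%N) (fun=> 1%N) g a.
rewrite wdeg1 => H; rewrite -(wdeg1 b) => ab; apply: H ab => i c.
by rewrite wdeg1 ltnS leqn0 => /eqP/mdeg_eq0 ->; exact: gz.
Qed.

Lemma compE f g b N : g0 g -> (mdeg b < N)%N ->
  comp f g b = \sum_(a <- box m N) f a * gpow g a b.
Proof.
move=> gz bN; rewrite /comp (sum_box_widen bN)// => a _ /notin_box ab.
by rewrite gpow_eq0 ?mulr0.
Qed.

Lemma comp_coef0 f g : g0 g -> comp f g (mi0 n) = f (mi0 m).
Proof.
move=> gz; rewrite /comp mdeg0 (bigD1_seq (mi0 m)) ?box_uniq//=; last first.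
  by rewrite mdeg_box ?mdeg0.
rewrite big1_seq ?addr0 => [|a /andP[a0]].
  by rewrite gpow0 coef1 eqxx mulr1.
move=> /boxP a1; suff: a = mi0 m by move=> E; rewrite E eqxx in a0.
by apply/funext => i; have := a1 i; rewrite ltnS leqn0 => /eqP.
Qed.

Lemma compD f f' g : comp (f + f') g = comp f g + comp f' g.
Proof.
apply/funext => b; rewrite coefD /comp -big_split; apply: eq_bigr => a _ /=.
by rewrite coefD mulrDl.
Qed.
Lemma compZ k f g : comp (k *: f) g = k *: comp f g.
Proof.
apply/funext => b; rewrite coefZ /comp mulr_sumr; apply: eq_bigr => a _ /=.
by rewrite coefZ mulrA.
Qed.
Lemma comp0 g : comp 0 g = 0.
Proof. by apply/funext => b; rewrite /comp big1// => a _; rewrite mul0r. Qed.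
Lemma compN f g : comp (- f) g = - comp f g.
Proof. by rewrite -scaleN1r compZ scaleN1r. Qed.
Lemma comp_sum I (s : seq I) (P : pred I) (F : I -> fps R m) g :
  comp (\sum_(i <- s | P i) F i) g = \sum_(i <- s | P i) comp (F i) g.
Proof. by rewrite (big_morph (comp^~ g) (fun x y => compD x y g) (comp0 g)). Qed.

Lemma comp_mono a g : g0 g -> comp (mono a) g = gpow g a.
Proof.
move=> gz; apply/funext => b.
pose N := maxn (mdeg b).+1 (mdeg a).+1.
rewrite (@compE _ _ _ N gz) ?leq_maxl//.
rewrite (bigD1_seq a) ?box_uniq ?mdeg_box ?leq_maxr//=.
rewrite /mono eqxx mul1r big1 ?addr0// => c /negPf ->; exact: mul0r.
Qed.
Lemma comp1 g : g0 g -> comp 1 g = 1.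
Proof. by move=> gz; rewrite -mono0 comp_mono// gpow0. Qed.
Lemma compX i g : g0 g -> comp (fX i) g = g i.
Proof.
move=> gz; rewrite comp_mono// /gpow (bigD1 i)//= eqxx expr1 big1 ?mulr1//.
by move=> j /negPf ->; rewrite expr0.
Qed.

Lemma compM f f' g : g0 g -> comp (f * f') g = comp f g * comp f' g.
Proof.
move=> gz; apply/funext => b; pose N := (mdeg b).+1.
have bN : b \in box n N by rewrite mdeg_box.
(* Both sides are brought to this double sum. Pairs whose sum leaves the cube contribute 0, by the
   order of g^(a + a'). *)
transitivity (\sum_(a <- box m N) \sum_(a' <- box m N)
    f a * f' a' * gpow g (madd a a') b).
  rewrite (compE _ gz (ltnSn _)) -/N.
  transitivity (\sum_(c <- box m N) \sum_(a <- box m N) \sum_(a' <- box m N)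
     if madd a a' == c then f a * f' a' * gpow g (madd a a') b else 0).
    rewrite big_seq_cond [RHS]big_seq_cond; apply: eq_bigr => c /andP[cN _].
    rewrite (fpsM _ _ cN) mulr_suml; apply: eq_bigr => a _.
    rewrite mulr_suml big_mkcond; apply: eq_bigr => a' _.
    by case: eqP => // ->.
  rewrite exchange_big; apply: eq_bigr => a _ /=.
  rewrite exchange_big; apply: eq_bigr => a' _ /=.
  rewrite -big_mkcond (eq_bigl (fun c => c == madd a a')) => [|c]; last first.
    by rewrite eq_sym.
  have [aN|aN] := boolP (madd a a' \in box m N).
    exact: (sum_box1 (fun=> _)).
  rewrite big1_seq => [|c /andP[/eqP-> cN]]; last by rewrite cN in aN.
  by rewrite gpow_eq0 ?mulr0// notin_box.
rewrite (fpsM _ _ bN).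
transitivity (\sum_(b1 <- box n N) \sum_(b2 <- box n N)
   \sum_(a <- box m N) \sum_(a' <- box m N)
   if madd b1 b2 == b then f a * f' a' * (gpow g a b1 * gpow g a' b2) else 0).
  under [RHS]eq_bigr do rewrite exchange_big /=.
  rewrite [RHS]exchange_big /=; apply: eq_bigr => a _.
  under [RHS]eq_bigr do rewrite exchange_big /=.
  rewrite [RHS]exchange_big /=; apply: eq_bigr => a' _.
  rewrite gpowD (fpsM _ _ bN) mulr_sumr; apply: eq_bigr => b1 _.
  by rewrite mulr_sumr big_mkcond.
apply: eq_bigr => b1 _; rewrite [RHS]big_mkcond; apply: eq_bigr => b2 _.
case: eqP => [b12|_]; last by rewrite big1// => a _; rewrite big1.
have lt1 : (mdeg b1 < N)%N by rewrite /N -b12 mdegD ltnS leq_addr.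
have lt2 : (mdeg b2 < N)%N by rewrite /N -b12 mdegD ltnS leq_addl.
rewrite (compE _ gz lt1) (compE _ gz lt2) mulr_suml; apply: eq_bigr => a _.
by rewrite mulr_sumr; apply: eq_bigr => a' _; rewrite mulrACA.
Qed.

Lemma compXn f k g : g0 g -> comp (f ^+ k) g = comp f g ^+ k.
Proof.
by move=> gz; elim: k => [|k IH]; rewrite ?expr0 ?comp1// !exprS compM// IH.
Qed.
Lemma comp_prod I (s : seq I) (P : pred I) (F : I -> fps R m) g : g0 g ->
  comp (\prod_(i <- s | P i) F i) g = \prod_(i <- s | P i) comp (F i) g.
Proof.
move=> gz; elim/big_rec2: _ => [|i x y _ <-]; [exact: comp1|exact: compM].
Qed.

Lemma ordw_comp w v k f g : (forall i, ordw w (v i) (g i)) -> ordw v k f ->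
  ordw w k (comp f g).
Proof.
move=> gv fk b bk; rewrite /comp big1// => a _.
have [ak|ka] := ltnP (wdeg v a) k; first by rewrite fk ?mul0r.
by rewrite (ordw_gpow gv) ?mulr0// (leq_trans bk).
Qed.

Lemma bar_gpow g a : bar (gpow g a) = gpow (fun i => bar (g i)) a.
Proof.
have bM (x y : fps R n) : bar (x * y) = (bar x : fps R n) * bar y.
  apply/funext => c; have cN := mdeg_box (ltnSn (mdeg c)).
  rewrite (fpsM _ _ cN) /bar (fpsM _ _ cN) rmorph_sum; apply: eq_bigr => b _.
  by rewrite rmorph_sum; apply: eq_bigr => d _; exact: rmorphM.
have b1 : bar (1 : fps R n) = 1 :> fps R n.
  by apply/funext => c; rewrite /bar coef1; case: (c == _); rewrite ?rmorph1 ?rmorph0.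
rewrite /gpow (big_morph (@bar R n : fps R n -> fps R n) bM b1).
apply: eq_bigr => i _; elim: (a i) => [|k IH]; first by rewrite !expr0 b1.
by rewrite !exprS bM IH.
Qed.

Lemma bar_comp f g : bar (comp f g) = comp (bar f) (fun i => bar (g i)).
Proof.
apply/funext => b; rewrite /comp {1}/bar rmorph_sum; apply: eq_bigr => a _.
by rewrite -bar_gpow [LHS]rmorphM.
Qed.
End Composition.

Section BarComp.
Context {R : realType}.

Lemma bar0 n : bar (0 : fps R n) = 0.
Proof. by apply/funext => c; rewrite /bar rmorph0. Qed.
Lemma barD n (f g : fps R n) : bar (f + g) = (bar f : fps R n) + bar g.
Proof. by apply/funext => c; rewrite /bar coefD rmorphD. Qed.
Lemma bar_sum n I (s : seq I) (P : pred I) (F : I -> fps R n) :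
  bar (\sum_(i <- s | P i) F i) = \sum_(i <- s | P i) (bar (F i) : fps R n).
Proof. exact: (big_morph (@bar R n : fps R n -> fps R n) (@barD n) (bar0 n)). Qed.
Lemma barK n (f : fps R n) : bar (bar f) = f.
Proof. by apply/funext => c; rewrite /bar conjCK. Qed.
Lemma bar_mono n a : bar (mono a : fps R n) = mono a.
Proof. by apply/funext => c; rewrite /bar /mono conjC_nat. Qed.

Lemma compA l m n (f : fps R l) (g : 'I_l -> fps R m) (h : 'I_m -> fps R n) :
  g0 g -> g0 h -> comp (comp f g) h = comp f (fun i => comp (g i) h).
Proof.
move=> gz hz; have ghz : g0 (fun i => comp (g i) h).
  by move=> i; rewrite comp_coef0.
apply/funext => b; pose N := (mdeg b).+1.
rewrite (compE _ hz (ltnSn _)) -/N.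
(* N' exceeds the degree of every index in the cube of side N, so one cube of side N' computes all
   the inner coefficients that occur. *)
have [N' NN'] : exists N', (N <= N')%N /\ forall c, c \in box m N -> (mdeg c < N')%N.
  exists (maxn N (m * N).+1); split=> [|c /box_mdeg cN]; first exact: leq_maxl.
  by rewrite leq_max orbC ltnS cN.
have [NN N'P] := NN'; rewrite (compE _ ghz (leq_trans (ltnSn _) NN)).
transitivity (\sum_(c <- box m N) \sum_(a <- box l N') f a * gpow g a c * gpow h c b).
  rewrite big_seq_cond [RHS]big_seq_cond; apply: eq_bigr => c /andP[/N'P cN _].
  by rewrite (compE _ gz cN) mulr_suml.
rewrite exchange_big /=; apply: eq_bigr => a _.
have -> : gpow (fun i => comp (g i) h) a = comp (gpow g a) h.
  by rewrite /gpow comp_prod//; apply: eq_bigr => i _; rewrite compXn.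
rewrite (compE _ hz (ltnSn _)) mulr_sumr; apply: eq_bigr => c _.
by rewrite mulrA.
Qed.

Lemma comp_id n (f : fps R n) : comp f (@fX R n) = f.
Proof.
apply/funext => b; rewrite /comp (bigD1_seq b) ?box_uniq ?mdeg_box//=.
rewrite /gpow prod_fX /mono eqxx mulr1 big1 ?addr0// => a ab.
by rewrite prod_fX /mono eq_sym (negPf ab) mulr0.
Qed.

Lemma eq_comp m n (f : fps R m) (g h : 'I_m -> fps R n) :
  g =1 h -> comp f g = comp f h.
Proof. by move=> /funext ->. Qed.
End BarComp.

(** * Weighted norms and evaluation *)

Section Majorants.
Context {R : realType}.
Notation C := (Cplx R).

(* The weighted l1 norm sum |f_a| r^|a| is at most M; for fixed r it is
   submultiplicative. *)
Definition nle n (r M : R) (f : fps R n) := forall N,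
  \sum_(a <- box n N) nr (f a) * r ^+ mdeg a <= M.

Section OneDim.
Variable n : nat.
Implicit Types (f g : fps R n) (r s M K t : R).

Lemma nle_sumge0 (s : seq ('I_n -> nat)) (P : pred _) r f : 0 <= r ->
  0 <= \sum_(a <- s | P a) nr (f a) * r ^+ mdeg a.
Proof.
by move=> r0; apply: sumr_ge0 => a _; rewrite mulr_ge0 ?nr_ge0 ?exprn_ge0.
Qed.

Lemma nle_ge0 r M f : 0 <= r -> nle r M f -> 0 <= M.
Proof. by move=> r0 fM; apply: le_trans (fM 0%N); exact: nle_sumge0. Qed.

Lemma nle_fin r M f (s : seq ('I_n -> nat)) : 0 <= r -> uniq s -> nle r M f ->
  \sum_(a <- s) nr (f a) * r ^+ mdeg a <= M.
Proof.
move=> r0 us fM; pose N := (\max_(a <- s) mdeg a).+1.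
apply: le_trans (fM N).
rewrite [leRHS](bigID (mem s)) /=.
have -> : \sum_(a <- box n N | a \in s) nr (f a) * r ^+ mdeg a =
    \sum_(a <- s) nr (f a) * r ^+ mdeg a.
  rewrite -big_filter; apply/perm_big/uniq_perm; rewrite ?filter_uniq ?box_uniq//.
  move=> a; rewrite mem_filter; case: (boolP (a \in s)) => //= sa.
  rewrite mdeg_box// /N ltnS; exact: (@leq_bigmax_seq _ s xpredT (@mdeg n) a sa isT).
by rewrite lerDl nle_sumge0.
Qed.

Lemma nle_coef r M f a : 0 <= r -> nle r M f -> nr (f a) * r ^+ mdeg a <= M.
Proof. by move=> r0 /(@nle_fin _ _ _ [:: a] r0 isT); rewrite big_seq1. Qed.

Lemma nle_le r s M K f : 0 <= s -> s <= r -> M <= K -> nle r M f -> nle s K f.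
Proof.
move=> s0 sr MK fM N; apply: le_trans (le_trans (fM N) MK).
apply: ler_sum => a _; rewrite ler_wpM2l ?nr_ge0// lerXn2r// nnegrE//.
exact: le_trans sr.
Qed.

Lemma nleD r M K f g : 0 <= r -> nle r M f -> nle r K g -> nle r (M + K) (f + g).
Proof.
move=> r0 fM gK N; apply: le_trans (lerD (fM N) (gK N)); rewrite -big_split/=.
apply: ler_sum => a _; rewrite -mulrDl ler_wpM2r ?exprn_ge0// coefD; exact: nrD.
Qed.

Lemma nleZ r M f (k : C) : nle r M f -> nle r (nr k * M) (k *: f).
Proof.
move=> fM N; apply: le_trans (ler_wpM2l (nr_ge0 k) (fM N)); rewrite mulr_sumr.
by apply: ler_sum => a _; rewrite coefZ nrM mulrA.
Qed.

Lemma nleN r M f : nle r M f -> nle r M (- f).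
Proof. by move=> /(@nleZ _ _ _ (-1)); rewrite scaleN1r nrN nr1 mul1r. Qed.

Lemma nle_bar r M f : nle r M f -> nle r M (bar f).
Proof. by move=> fM N; under eq_bigr do rewrite /bar nr_conj; exact: fM. Qed.

Lemma nle0 r : 0 <= r -> nle r 0 (0 : fps R n).
Proof. by move=> r0 N; rewrite big1// => a _; rewrite coef_0 nr0 mul0r. Qed.

Lemma nle_mono r (a : 'I_n -> nat) : 0 <= r -> nle r (r ^+ mdeg a) (mono a).
Proof.
move=> r0 N; rewrite (bigID (pred1 a))/= [X in _ + X]big1 ?addr0; last first.
  by move=> b /negPf ba; rewrite /mono ba nr0 mul0r.
have [aN|aN] := boolP (a \in box n N).
  by rewrite sum_box1// /mono eqxx nr1 mul1r.
by rewrite big1_seq ?exprn_ge0// => b /andP[/eqP-> bN]; rewrite bN in aN.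
Qed.

Lemma nle1 r : 0 <= r -> nle r 1 (1 : fps R n).
Proof. by move=> /nle_mono-/(_ (mi0 n)); rewrite mdeg0. Qed.

Lemma nleM r M K f g : 0 <= r -> nle r M f -> nle r K g -> nle r (M * K) (f * g).
Proof.
move=> r0 fM gK N; have M0 := nle_ge0 r0 fM.
apply: (@le_trans _ _ (\sum_(a <- box n N) \sum_(b <- box n N)
   (nr (f a) * r ^+ mdeg a) * (nr (g b) * r ^+ mdeg b))); last first.
  rewrite -(eq_bigr _ (fun _ _ => mulr_sumr _ _ _ _)) -mulr_suml.
  by apply: ler_pM; rewrite ?nle_sumge0.
apply: (@le_trans _ _ (\sum_(c <- box n N) \sum_(a <- box n N) \sum_(b <- box n N)
  if madd a b == c then
   (nr (f a) * r ^+ mdeg a) * (nr (g b) * r ^+ mdeg b) else 0)).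
  rewrite big_seq_cond [leRHS]big_seq_cond; apply: ler_sum => c /andP[cN _].
  rewrite (fpsM _ _ cN).
  apply: le_trans (ler_wpM2r (exprn_ge0 _ r0) (nr_sum _ _ _)) _.
  rewrite mulr_suml; apply: ler_sum => a _.
  apply: le_trans (ler_wpM2r (exprn_ge0 _ r0) (nr_sum _ _ _)) _.
  rewrite mulr_suml big_mkcond; apply: ler_sum => b _; case: eqP => // <-.
  by rewrite mdegD exprD nrM mulrACA.
rewrite exchange_big; apply: ler_sum => a _ /=.
rewrite exchange_big; apply: ler_sum => b _ /=.
have X0 : 0 <= nr (f a) * r ^+ mdeg a * (nr (g b) * r ^+ mdeg b).
  by rewrite !mulr_ge0 ?nr_ge0 ?exprn_ge0.
rewrite -big_mkcond (eq_bigl (fun c => c == madd a b)) => [|c]; last exact: eq_sym.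
have [abN|abN] := boolP (madd a b \in box n N).
  by rewrite (sum_box1 (fun=> _) abN).
by rewrite big1_seq// => c /andP[/eqP -> cN]; rewrite cN in abN.
Qed.

Lemma nleX r M f k : 0 <= r -> nle r M f -> nle r (M ^+ k) (f ^+ k).
Proof.
move=> r0 fM; elim: k => [|k IH]; rewrite ?expr0 ?exprS; first exact: nle1.
exact: nleM.
Qed.

Lemma nle_prod I (s : seq I) (P : pred I) (F : I -> fps R n) (M : I -> R) r :
  0 <= r -> (forall i, P i -> nle r (M i) (F i)) ->
  nle r (\prod_(i <- s | P i) M i) (\prod_(i <- s | P i) F i).
Proof.
move=> r0 FM; elim/big_rec2: _ => [|i x y Pi]; first exact: nle1.
by move=> yx; apply: nleM => //; exact: FM.
Qed.

(** A Schwarz lemma: each term of a series without constant term gains at least one factor t. It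
    makes inner series small enough to be substituted. *)
Lemma nle_shrink r t M f : f (mi0 n) = 0 -> 0 <= r -> 0 <= t <= 1 ->
  nle r M f -> nle (t * r) (t * M) f.
Proof.
move=> f0 r0 /andP[t0 t1] fM N; apply: le_trans (ler_wpM2l t0 (fM N)).
rewrite mulr_sumr; apply: ler_sum => a _.
have [->|a0] := eqVneq a (mi0 n); first by rewrite f0 nr0 !mul0r mulr0.
have : (0 < mdeg a)%N.
  by rewrite lt0n; apply: contra a0 => /eqP/mdeg_eq0 ->.
case: (mdeg a) => // k _; rewrite exprMn mulrCA ler_wpM2r//; last first.
  by rewrite exprS ler_piMr// exprn_ile1.
by rewrite mulr_ge0 ?nr_ge0 ?exprn_ge0.
Qed.

Lemma sum_half N : \sum_(a <- box n N) (2^-1 : R) ^+ mdeg a <= 2 ^+ n.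
Proof.
have half (K : nat) : \sum_(j < K) (2^-1 : R) ^+ j <= 2.
  suff -> : \sum_(j < K) (2^-1 : R) ^+ j = 2 - 2 * 2^-1 ^+ K.
    by rewrite gerBl mulr_ge0 ?exprn_ge0// invr_ge0.
  elim: K => [|K IH]; first by rewrite big_ord0 expr0 mulr1 subrr.
  by rewrite big_ord_recr/= IH exprS; field.
rewrite -big_box (eq_bigr (fun a : {ffun 'I_n -> 'I_N} =>
  \prod_(i < n) (2^-1 : R) ^+ a i)) => [|a _]; last by rewrite /mdeg -expr_sum.
rewrite -(bigA_distr_bigA (fun _ (j : 'I_N) => (2^-1 : R) ^+ j)).
rewrite -[leRHS](_ : \prod_(i < n) 2 = _); last by rewrite prodr_const card_ord.
apply: ler_prod => i _; rewrite half andbT sumr_ge0// => j _; rewrite exprn_ge0// invr_ge0.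
Qed.

(** Halving the radius turns a bound on single terms into a bound on their sum; the geometric series
    contributes at most 2 for each variable. *)
Lemma nle_of_coef r M f : 0 <= r -> 0 <= M ->
  (forall a, nr (f a) * r ^+ mdeg a <= M) -> nle (r / 2) (2 ^+ n * M) f.
Proof.
move=> r0 M0 fM N; apply: le_trans (ler_wpM2r M0 (sum_half N)).
rewrite mulr_suml; apply: ler_sum => a _; rewrite exprMn mulrA mulrC.
by rewrite ler_wpM2l// exprn_ge0// invr_ge0.
Qed.

Lemma convergentP f : convergent f <-> exists r M : R, 0 < r /\ nle r M f.
Proof.
split=> [[r [M [r0 fM]]]|[r [M [r0 fM]]]].
  have [s s0 rs] := gt0_realP r0.
  exists (s / 2), (2 ^+ n * complex.Re (M : R[i])); split; first exact: divr_gt0.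
  have H a : nr (f a) * s ^+ mdeg a <= complex.Re (M : R[i]).
    have := fM a; rewrite nrE rs -(rmorphXn (real_complex R)).
    rewrite -[X in (X <= _)%R](rmorphM (real_complex R)).
    by have := lecE ((nr (f a) * s ^+ mdeg a)%:C)%C (M : R[i]) => -> /andP[].
  apply: (nle_of_coef (ltW s0) _ H).
  by apply: le_trans (H (mi0 n)); rewrite mulr_ge0 ?nr_ge0 ?exprn_ge0 ?ltW.
exists (r%:C)%C, (M%:C)%C; split; first by have := @ltcR R 0 r => ->.
move=> a; rewrite nrE -(rmorphXn (real_complex R)).
rewrite -[X in (X <= _)%R](rmorphM (real_complex R)).
have := @lecR R (nr (f a) * r ^+ mdeg a) M => ->.
exact: nle_coef (ltW r0) fM.
Qed.
End OneDim.

Lemma nle_gpow m n r (s : R) (g : 'I_m -> fps R n) a : 0 <= r ->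
  (forall i, nle r s (g i)) -> nle r (s ^+ mdeg a) (gpow g a).
Proof.
move=> r0 gs; rewrite /gpow /mdeg expr_sum.
by apply: nle_prod => // i _; apply: nleX.
Qed.

Lemma nle_comp m n r s M (f : fps R m) (g : 'I_m -> fps R n) : 0 <= r ->
  0 <= s -> g0 g -> (forall i, nle r s (g i)) -> nle s M f -> nle r M (comp f g).
Proof.
move=> r0 s0 gz gs fM N; pose N' := (n * N).+1.
apply: le_trans (fM N').
apply: (@le_trans _ _ (\sum_(b <- box n N) \sum_(a <- box m N')
   nr (f a) * (nr (gpow g a b) * r ^+ mdeg b))).
  rewrite big_seq_cond [leRHS]big_seq_cond; apply: ler_sum => b /andP[bN _].
  rewrite (compE _ gz (_ : mdeg b < N')%N); last by rewrite ltnS box_mdeg.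
  apply: le_trans (ler_wpM2r (exprn_ge0 _ r0) (nr_sum _ _ _)) _.
  by rewrite mulr_suml; apply: ler_sum => a _; rewrite nrM mulrA.
rewrite exchange_big; apply: ler_sum => a _ /=.
by rewrite -mulr_sumr ler_wpM2l ?nr_ge0//; exact: nle_gpow.
Qed.

End Majorants.

(** * Values of convergent series *)

Section Evaluation.
Context {R : realType}.
Notation C := (Cplx R).

Lemma half_small (M : R) (e : R) : 0 < e ->
  exists N0 : nat, forall N, (N0 <= N)%N -> M * (2^-1) ^+ N <= e.
Proof.
move=> e0; have [M0|M0] := leP M 0.
  by exists 0%N => N _; rewrite (le_trans _ (ltW e0))// mulr_le0_ge0.
have /cvgrPdist_le /(_ (e / M) (divr_gt0 e0 M0)) [N0 _ HN] :=
  @cvg_expr R (2^-1) ltac:(by rewrite ger0_norm// invf_lt1// ltr1n).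
exists N0 => N /HN; rewrite sub0r normrN ger0_norm ?exprn_ge0//.
by rewrite ler_pdivlMr// mulrC.
Qed.

Lemma half_le0 (a M : R) : (forall N, a <= M * (2^-1) ^+ N) -> a <= 0.
Proof.
move=> aM; apply/ler_addgt0Pr => e /half_small-/(_ M)[N /(_ N (leqnn _)) MN].
by rewrite add0r (le_trans (aM N)).
Qed.

Lemma nr_le0 (x : C) : nr x <= 0 -> x = 0.
Proof. by move=> x0; apply/eqP; rewrite -nr_eq0 eq_le x0 nr_ge0. Qed.

Lemma nr_Re (x : C) : `|complex.Re (x : R[i])| <= nr x.
Proof.
by have := normc_ge_Re (x : R[i]); rewrite -[`|x : R[i]|](nrE x) lecR.
Qed.
Lemma nr_Im (x : C) : `|complex.Im (x : R[i])| <= nr x.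
Proof.
have := nr_Re (x * 'i%C); rewrite ReiNIm normrN nrM.
have -> : nr ('i%C : C) = 1; last by rewrite mulr1.
by apply: nrI; rewrite complexiE normCi.
Qed.
Lemma nr_ReIm (x : C) :
  nr x <= `|complex.Re (x : R[i])| + `|complex.Im (x : R[i])|.
Proof.
rewrite {1}(complexE (x : R[i])) (le_trans (nrD _ _))// lerD ?nr_real//.
rewrite nrM nr_real; have -> : nr ('i%C : C) = 1; last by rewrite mul1r.
by apply: nrI; rewrite complexiE normCi.
Qed.

Lemma cvg_nrP (u : nat -> C) (l : C) : (u @ \oo --> l) <->
  forall e : R, 0 < e -> exists N0, forall N, (N0 <= N)%N -> nr (l - u N) <= e.
Proof.
split=> [/cvgrPdist_le ul e e0|ul].
  have e0' : 0 < (e%:C)%C :> C by have := @ltcR R 0 e => ->.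
  have [N0 _ HN] := ul _ e0'.
  by exists N0 => N /HN; rewrite lec_nr.
apply/cvgrPdist_le => e /gt0_realP[r r0 ->].
have [N0 HN] := ul _ r0; exists N0 => // N /HN /=; by rewrite lec_nr.
Qed.

Lemma real_geom_cauchy (v : nat -> R) (M : R) :
  (forall N K, (N <= K)%N -> `|v K - v N| <= M * (2^-1) ^+ N) -> cvg (v @ \oo).
Proof.
move=> vM; apply/cauchy_cvgP/cauchy_exP => e e0.
have [N0 HN] := half_small M (divr_gt0 e0 (ltr0n _ 2)).
exists (v N0), N0 => // K /= NK; rewrite -ball_normE /= distrC.
apply: le_lt_trans (vM _ _ NK) (le_lt_trans (HN _ (leqnn _)) _).
by rewrite ltr_pdivrMr// ltr_pMr// ltr1n.
Qed.

(** Completeness of the reals is applied to real and imaginary parts, and the rate is then passed to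
    the limit. *)
Lemma geom_cauchy (u : nat -> C) (M : R) :
  (forall N K, (N <= K)%N -> nr (u K - u N) <= M * (2^-1) ^+ N) ->
  (u @ \oo --> lim (u @ \oo)) /\
  forall N, nr (lim (u @ \oo) - u N) <= M * (2^-1) ^+ N.
Proof.
move=> uM.
have rv : cvg ((fun N => complex.Re (u N : R[i])) @ \oo).
  apply: (@real_geom_cauchy _ M) => N K NK.
  rewrite -(raddfB (@complex.Re R : Rcomplex R -> R)).
  exact: le_trans (nr_Re _) (uM _ _ NK).
have iv : cvg ((fun N => complex.Im (u N : R[i])) @ \oo).
  apply: (@real_geom_cauchy _ M) => N K NK.
  rewrite -(raddfB (@complex.Im R : Rcomplex R -> R)).
  exact: le_trans (nr_Im _) (uM _ _ NK).
pose l : C := Complex (lim ((fun N => complex.Re (u N : R[i])) @ \oo))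
                  (lim ((fun N => complex.Im (u N : R[i])) @ \oo)).
have ul : u @ \oo --> l.
  apply/cvg_nrP => e e0; have e2 := divr_gt0 e0 (ltr0n R 2).
  have /cvgrPdist_le/(_ _ e2)[N1 _ H1] := rv.
  have /cvgrPdist_le/(_ _ e2)[N2 _ H2] := iv.
  exists (maxn N1 N2) => N; rewrite geq_max => /andP[/H1/= h1 /H2/= h2].
  rewrite (le_trans (nr_ReIm _))// (splitr e) lerD//.
    by move: h1; case: (u N).
  by move: h2; case: (u N).
have -> : lim (u @ \oo) = l by apply: cvg_lim => //; exact: norm_hausdorff.
split=> // N; apply/ler_addgt0Pr => e e0.
have /cvg_nrP/(_ _ e0)[N0 H0] := ul.
have -> : l - u N = (l - u (maxn N N0)) + (u (maxn N N0) - u N) by ring.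
rewrite (le_trans (nrD _ _))// addrC lerD ?uM ?leq_maxl//.
by rewrite H0// leq_maxr.
Qed.

Section Point.
Variable n : nat.
Implicit Types (f g : fps R n) (x : 'rV[C]_n) (r M : R).

(** Half the radius of the norm: terms outside the cube of side N gain a factor 2^-N. All partial
    sums converge at this rate, and identities between values are reduced by [eval_eq] to such
    estimates. *)
Definition small r x := forall i, nr (x 0 i) <= r / 2.

Lemma psumE f x N : psum f x N = \sum_(a <- box n N) f a * monom x a.
Proof. exact: (@big_box n C N (fun a => f a * monom x a)). Qed.

Lemma monomD x a b : monom x (madd a b) = monom x a * monom x b.
Proof. by rewrite /monom -big_split; apply: eq_bigr => i _; rewrite exprD. Qed.

Lemma nr_monom_le r x a : (forall i, nr (x 0 i) <= r) -> nr (monom x a) <= r ^+ mdeg a.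
Proof.
move=> xr; rewrite /monom nr_prod /mdeg expr_sum; apply: ler_prod => i _.
rewrite nr_ge0/= nrX lerXn2r ?nnegrE ?nr_ge0//.
exact: le_trans (nr_ge0 _) (xr i).
Qed.

Lemma nr_monom r x a : small r x -> nr (monom x a) <= r ^+ mdeg a * 2^-1 ^+ mdeg a.
Proof. by move=> xr; rewrite -exprMn nr_monom_le. Qed.

Lemma psum_tail r M f x : 0 <= r -> nle r M f -> small r x -> forall N K,
  (N <= K)%N -> nr (psum f x K - psum f x N) <= M * 2^-1 ^+ N.
Proof.
move=> r0 fM xr N K NK; rewrite !psumE (bigID (mem (box n N)))/=.
rewrite -[X in X + _ - _]big_filter (perm_big (box n N)); last first.
  apply: uniq_perm; rewrite ?filter_uniq ?box_uniq// => a.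
  by rewrite mem_filter; case: (boolP (a \in box n N)) => //= /(box_le NK).
rewrite addrAC subrr add0r (le_trans (nr_sum _ _ _))//.
apply: le_trans (ler_wpM2r (exprn_ge0 N _) (fM K)); last by rewrite invr_ge0.
rewrite mulr_suml [leRHS](bigID (mem (box n N)))/=.
rewrite -[leLHS]add0r lerD//.
  by apply: sumr_ge0 => a _; rewrite !mulr_ge0 ?nr_ge0 ?exprn_ge0 ?invr_ge0.
apply: ler_sum => a /notin_box aN; rewrite nrM -mulrA ler_wpM2l ?nr_ge0//.
rewrite (le_trans (nr_monom a xr))// ler_wpM2l ?exprn_ge0//.
by apply: ler_wiXn2l => //; rewrite ?invr_ge0// invf_le1// ler1n.
Qed.

Lemma eval_approx r M f x : 0 <= r -> nle r M f -> small r x ->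
  forall N, nr (eval f x - psum f x N) <= M * 2^-1 ^+ N.
Proof. by move=> r0 fM xr; have [_] := geom_cauchy (psum_tail r0 fM xr). Qed.

Lemma eval_eq r M (K : R) f x l : 0 <= r -> nle r M f -> small r x ->
  (forall N, nr (l - psum f x N) <= K * 2^-1 ^+ N) -> eval f x = l.
Proof.
move=> r0 fM xr lK; apply/eqP; rewrite -subr_eq0; apply/eqP/nr_le0.
apply: (@half_le0 _ (M + K)) => N.
have -> : eval f x - l = (eval f x - psum f x N) - (l - psum f x N) by ring.
rewrite (le_trans (nrD _ _))// nrN mulrDl lerD//.
exact: (eval_approx r0 fM).
Qed.

Lemma psum_bound r M f x N : 0 <= r -> nle r M f -> small r x ->
  nr (psum f x N) <= M.
Proof.
move=> r0 fM xr; rewrite psumE (le_trans (nr_sum _ _ _))//.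
apply: le_trans (fM N); apply: ler_sum => a _; rewrite nrM ler_wpM2l ?nr_ge0//.
apply: nr_monom_le => i; rewrite (le_trans (xr i))// ler_pdivrMr// ler_peMr//.
by rewrite ler1n.
Qed.

Lemma eval_bound r M f x : 0 <= r -> nle r M f -> small r x -> nr (eval f x) <= M.
Proof.
move=> r0 fM xr; rewrite -subr_le0; apply: (@half_le0 _ M) => N.
rewrite lerBlDr (le_trans _ (lerD (eval_approx r0 fM xr N) (psum_bound N r0 fM xr)))//.
by rewrite (le_trans _ (nrD _ _))// subrK.
Qed.

Lemma eval0 f : eval f 0 = f (mi0 n).
Proof.
rewrite /eval; have : psum f 0 @ \oo --> f (mi0 n); last first.
  by apply: cvg_lim; exact: norm_hausdorff.
apply/cvg_nrP => e e0; exists 1%N => N N0.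
rewrite psumE (bigD1_seq (mi0 n)) ?box_uniq ?mdeg_box ?mdeg0//=.
rewrite [X in _ - (_ + X)]big1 => [|a a0].
  have -> : monom 0 (mi0 n) = 1 :> C by rewrite /monom big1.
  by rewrite addr0 mulr1 subrr nr0 ltW.
have [i ai] : exists i, a i != 0%N.
  apply: contrapT => na; move/negP: a0; apply; apply/eqP/funext => i.
  by apply/eqP; apply: contrapT => ai; apply: na; exists i; exact/negP.
by rewrite /monom (bigD1 i)//= mxE expr0n (negPf ai) mul0r mulr0.
Qed.

Lemma evalD r M (K : R) f g x : 0 <= r -> nle r M f -> nle r K g -> small r x ->
  eval (f + g : fps R n) x = eval f x + eval g x.
Proof.
move=> r0 fM gK xr; apply: (eval_eq (K := M + K) r0 (nleD r0 fM gK) xr) => N.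
have -> : psum (f + g) x N = psum f x N + psum g x N.
  by rewrite !psumE -big_split; apply: eq_bigr => a _; rewrite coefD mulrDl.
rewrite opprD addrACA (le_trans (nrD _ _))// mulrDl.
by rewrite lerD// (eval_approx r0).
Qed.

Lemma evalZ r M f k x : 0 <= r -> nle r M f -> small r x ->
  eval (k *: f : fps R n) x = k * eval f x.
Proof.
move=> r0 fM xr; apply: (eval_eq (K := nr k * M) r0 (nleZ k fM) xr) => N.
have -> : psum (k *: f) x N = k * psum f x N.
  by rewrite !psumE mulr_sumr; apply: eq_bigr => a _; rewrite coefZ mulrA.
by rewrite -mulrBr nrM -mulrA ler_wpM2l ?nr_ge0// (eval_approx r0).
Qed.

Lemma eval_mono x a : eval (mono a : fps R n) x = monom x a.
Proof.
have [r r0 xr] : exists2 r, 0 <= r & small r x.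
  exists (2 * \sum_i nr (x 0 i)).
    by rewrite mulr_ge0// sumr_ge0// => i _; exact: nr_ge0.
  move=> i; rewrite mulrC mulrA mulVf// mul1r (bigD1 i)//= lerDl sumr_ge0// => j _.
  exact: nr_ge0.
have aM := @nle_mono R n r a r0.
(* While a is outside the cube, N <= |a| and the error is the whole monomial; the factor 2^|a|
   compensates 2^-N. *)
pose K := nr (monom x a) * 2 ^+ mdeg a.
apply: (eval_eq (K := K) r0 aM xr) => N.
have -> : psum (mono a) x N = if a \in box n N then monom x a else 0.
  rewrite psumE; case: ifPn => aN.
    rewrite (bigD1_seq a) ?box_uniq//= /mono eqxx mul1r big1 ?addr0// => b /negPf ->.
    by rewrite mul0r.
  rewrite big1_seq// => b /= bN; rewrite /mono; case: eqP => [ba|]; rewrite ?mul0r//.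
  by rewrite -ba bN in aN.
case: ifPn => [aN|/notin_box aN].
  by rewrite subrr nr0 /K !mulr_ge0 ?nr_ge0 ?exprn_ge0 ?invr_ge0.
rewrite subr0 /K -mulrA ler_peMr ?nr_ge0// exprVn ler_pdivlMr ?exprn_gt0// mul1r.
by rewrite ler_weXn2l// ler1n.
Qed.

Lemma evalM r M (K : R) f g x : 0 <= r -> nle r M f -> nle r K g -> small r x ->
  eval (f * g) x = eval f x * eval g x.
Proof.
move=> r0 fM gK xr; have M0 := nle_ge0 r0 fM; have K0 := nle_ge0 r0 gK.
(* One M * K for the pairs of indices whose sum leaves the cube, which satisfy |a + b| >= N, and one
   for the tail of each factor. *)
apply: (eval_eq (K := M * K + (M * K + M * K)) r0 (nleM r0 fM gK) xr) => N.
have fa := eval_approx r0 fM xr N; have ga := eval_approx r0 gK xr N.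
have fb := psum_bound N r0 fM xr; have gb := eval_bound r0 gK xr.
have -> : eval f x * eval g x - psum (f * g) x N =
   (psum f x N * psum g x N - psum (f * g) x N) +
   ((eval f x - psum f x N) * eval g x + psum f x N * (eval g x - psum g x N)) by ring.
rewrite (le_trans (nrD _ _))// [leRHS]mulrDl lerD//; last first.
  rewrite (le_trans (nrD _ _))// [leRHS]mulrDl lerD// nrM.
    by rewrite mulrAC ler_pM ?nr_ge0.
  by rewrite -mulrA ler_pM ?nr_ge0.
pose D a b := f a * g b * monom x (madd a b).
have -> : psum f x N * psum g x N - psum (f * g) x N =
    \sum_(a <- box n N) \sum_(b <- box n N | madd a b \notin box n N) D a b.
  have -> : psum f x N * psum g x N = \sum_(a <- box n N) \sum_(b <- box n N) D a b.
    rewrite !psumE mulr_suml; apply: eq_bigr => a _.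
    by rewrite mulr_sumr; apply: eq_bigr => b _; rewrite /D monomD mulrACA.
  have -> : psum (f * g) x N =
    \sum_(a <- box n N) \sum_(b <- box n N | madd a b \in box n N) D a b.
    rewrite psumE.
    transitivity (\sum_(c <- box n N) \sum_(a <- box n N) \sum_(b <- box n N)
       if madd a b == c then D a b else 0).
      rewrite big_seq_cond [RHS]big_seq_cond; apply: eq_bigr => c /andP[cN _].
      rewrite (fpsM _ _ cN) mulr_suml; apply: eq_bigr => a _.
      rewrite mulr_suml big_mkcond; apply: eq_bigr => b _.
      by case: eqP => // <-.
    rewrite exchange_big; apply: eq_bigr => a _ /=.
    rewrite exchange_big [RHS]big_mkcond; apply: eq_bigr => b _ /=.
    rewrite -big_mkcond (eq_bigl (fun c => c == madd a b)) => [|c]; last exact: eq_sym.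
    case: ifPn => abN; first by rewrite (sum_box1 (fun=> _) abN).
    by rewrite big1_seq// => c /andP[/eqP -> cN]; rewrite cN in abN.
  rewrite -sumrB; apply: eq_bigr => a _.
  by rewrite [X in X - _](bigID (fun b => madd a b \in box n N))/= addrAC subrr add0r.
rewrite (le_trans (nr_sum _ _ _))//.
apply: (@le_trans _ _ (\sum_(a <- box n N) \sum_(b <- box n N)
   (nr (f a) * r ^+ mdeg a) * (nr (g b) * r ^+ mdeg b) * 2^-1 ^+ N)).
  apply: ler_sum => a _; rewrite (le_trans (nr_sum _ _ _))// big_mkcond.
  apply: ler_sum => b _; case: ifPn => [/notin_box abN|_]; last first.
    by rewrite !mulr_ge0 ?nr_ge0 ?exprn_ge0 ?invr_ge0.
  rewrite /D !nrM [X in _ <= X * _]mulrACA -[leRHS]mulrA.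
  rewrite ler_wpM2l ?mulr_ge0 ?nr_ge0//.
  rewrite (le_trans (nr_monom _ xr))// -exprD -mdegD ler_wpM2l ?exprn_ge0//.
  by apply: ler_wiXn2l => //; rewrite ?invr_ge0// invf_le1// ler1n.
under eq_bigr do rewrite -mulr_suml -mulr_sumr.
rewrite -!mulr_suml ler_wpM2r ?exprn_ge0 ?invr_ge0//.
by rewrite ler_pM ?nle_sumge0.
Qed.
End Point.

Lemma evalX n (x : 'rV[C]_n) i : eval (fX i : fps R n) x = x 0 i.
Proof.
rewrite eval_mono /monom (bigD1 i)//= eqxx expr1 big1 ?mulr1// => j /negPf ->.
by rewrite expr0.
Qed.

Lemma eval_prod n I (t : seq I) (F : I -> fps R n) (M : I -> R) r x : 0 <= r ->
  (forall i, nle r (M i) (F i)) -> small r x ->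
  eval (\prod_(i <- t) F i) x = \prod_(i <- t) eval (F i) x.
Proof.
move=> r0 FM xr; elim: t => [|i t IH].
  by rewrite !big_nil -mono0 eval_mono /monom big1.
by rewrite !big_cons -IH (evalM r0 (FM i) (nle_prod t (P := xpredT) r0 (fun i _ => FM i)) xr).
Qed.

Lemma evalXn n (f : fps R n) M r x k : 0 <= r -> nle r M f -> small r x ->
  eval (f ^+ k) x = eval f x ^+ k.
Proof.
move=> r0 FM xr; elim: k => [|k IH].
  by rewrite !expr0 -mono0 eval_mono /monom big1.
by rewrite !exprS -IH (evalM r0 FM (nleX k r0 FM) xr).
Qed.

Lemma eval_gpow m n (g : 'I_m -> fps R n) s r x a : 0 <= r ->
  (forall i, nle r s (g i)) -> small r x ->
  eval (gpow g a) x = monom (\row_i eval (g i) x) a.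
Proof.
move=> r0 gs xr; rewrite /gpow (eval_prod _ r0 (M := fun i => s ^+ a i))//; last first.
  by move=> i; apply: nleX.
by apply: eq_bigr => i _; rewrite (evalXn _ r0 (gs i) xr) mxE.
Qed.

Lemma eval_comp m n r s M (f : fps R m) (g : 'I_m -> fps R n) x : 0 <= r ->
  0 <= s -> g0 g -> (forall i, nle r (s / 2) (g i)) -> nle s M f -> small r x ->
  eval (comp f g) x = eval f (\row_i eval (g i) x).
Proof.
move=> r0 s0 gz gs fM xr.
have s2 : 0 <= s / 2 by rewrite divr_ge0.
have ss : s / 2 <= s by rewrite ler_pdivrMr// ler_peMr// ler1n.
have gs' i : nle r s (g i) by apply: nle_le (gs i).
have M0 := nle_ge0 s0 fM.
have gx : small s (\row_i eval (g i) x).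
  by move=> i; rewrite mxE; exact: eval_bound r0 (gs i) xr.
have fN := eval_approx s0 fM gx.
apply: (eval_eq (K := M + M) r0 (nle_comp r0 s0 gz gs' fM) xr) => N.
(* n N bounds the degrees in the cube of side N, so powers of g outside the cube of side N' do not
   reach it. The two errors are the tail of f and the tails of the powers g^a. *)
pose N' := maxn N (n * N).+1.
have -> : eval f (\row_i eval (g i) x) - psum (comp f g) x N =
  (eval f (\row_i eval (g i) x) - psum f (\row_i eval (g i) x) N') +
  (psum f (\row_i eval (g i) x) N' - psum (comp f g) x N) by ring.
rewrite (le_trans (nrD _ _))// mulrDl lerD//.
  rewrite (le_trans (fN N'))// ler_wpM2l//.
  by apply: ler_wiXn2l; rewrite ?invr_ge0// ?invf_le1// ?ler1n// leq_maxl.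
have -> : psum (comp f g) x N = \sum_(a <- box m N') f a * psum (gpow g a) x N.
  transitivity (\sum_(b <- box n N) \sum_(a <- box m N')
      f a * (gpow g a b * monom x b)).
    rewrite psumE big_seq_cond [RHS]big_seq_cond; apply: eq_bigr => b /andP[bN _].
    rewrite (compE _ gz (_ : mdeg b < N')%N); last first.
      by rewrite leq_max orbC ltnS box_mdeg.
    by rewrite mulr_suml; apply: eq_bigr => a _; rewrite mulrA.
  by rewrite exchange_big; apply: eq_bigr => a _; rewrite /= -mulr_sumr psumE.
rewrite psumE -sumrB (le_trans (nr_sum _ _ _))//.
apply: (@le_trans _ _ (\sum_(a <- box m N') nr (f a) * s ^+ mdeg a * 2^-1 ^+ N)).
  apply: ler_sum => a _; rewrite -mulrBr nrM -mulrA ler_wpM2l ?nr_ge0//.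
  rewrite -(eval_gpow _ r0 gs xr).
  by rewrite (eval_approx r0 (nle_gpow _ r0 gs') xr).
by rewrite -mulr_suml ler_wpM2r ?exprn_ge0// ?invr_ge0.
Qed.
End Evaluation.

(** * Cauchy estimates and the Banach spaces of the limit *)

Section CauchyEstimates.
Context {R : realType}.
Notation C := (Cplx R).

(* Cauchy estimates come from averaging over the 2^m-th roots of unity: no contour
   integral is needed. *)
Fixpoint root2 (m : nat) : C := if m is k.+1 then sqrtC (root2 k) else -1.

Lemma root2E m : root2 m ^+ (2 ^ m) = -1.
Proof.
by elim: m => [|m IH] /=; rewrite ?expn0 ?expr1// expnS exprM sqrtCK.
Qed.

Lemma nr_root2 m : nr (root2 m) = 1.
Proof.
have := congr1 (@nr R) (root2E m); rewrite nrX nrN nr1 => /eqP.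
by rewrite pexpr_eq1 ?expn_gt0 ?nr_ge0// => /eqP.
Qed.

Lemma root2_neq1 m j : (~~ (2 ^ m.+1 %| j))%N -> root2 m ^+ j != 1.
Proof.
move=> jm; apply/eqP => j1.
have j0 : (0 < j)%N by case: j jm {j1}; rewrite ?dvdn0.
have [k k2 jE] := pfactor_coprime (isT : prime 2) j0.
have im : (logn 2 j <= m)%N.
  rewrite leqNgt; apply: contra jm => im; rewrite jE dvdn_mull//.
  exact: dvdn_exp2l.
(* With j = k 2^i, k odd and i <= m, this power of the j-th power of [root2 m] is (-1)^k = -1,
   whereas the assumption makes it 1. *)
have := congr1 (fun z => z ^+ (2 ^ (m - logn 2 j))) j1.
rewrite expr1n -exprM {1}jE -mulnA -expnD subnKC// mulnC exprM root2E.
rewrite -signr_odd -[odd k]negbK -dvdn2 -prime_coprime// k2/= expr1.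
move=> /eqP; rewrite eq_sym -subr_eq0 opprK -[X in X + X]/(1%:R) -natrD.
by rewrite pnatr_eq0.
Qed.

Lemma sum_root2 m j : \sum_(k < 2 ^ m.+1) (root2 m ^+ j) ^+ k =
  if (2 ^ m.+1 %| j)%N then (2 ^ m.+1)%:R else 0.
Proof.
case: ifPn => [/dvdnP[q ->]|jm].
  rewrite (eq_bigr (fun=> 1)) ?sumr_const ?card_ord// => k _.
  have -> : root2 m ^+ (q * 2 ^ m.+1) = 1.
    by rewrite mulnC exprM expnS mulnC exprM root2E sqrrN !expr1n.
  exact: expr1n.
have w1 := root2_neq1 jm.
apply: (mulfI (x := root2 m ^+ j - 1)); first by rewrite subr_eq0.
rewrite mulr0 -subrX1 -exprM mulnC exprM expnS mulnC exprM root2E sqrrN.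
by rewrite expr1n expr1n subrr.
Qed.

Variable n : nat.
Implicit Types (f : fps R n) (x : 'rV[C]_n).

Lemma cauchy_psum (s e : R) f (m : nat) a : 0 <= s -> a \in box n (2 ^ m.+1) ->
  (forall x, (forall i, nr (x 0 i) = s) -> nr (psum f x (2 ^ m.+1)) <= e) ->
  nr (f a) * s ^+ mdeg a <= e.
Proof.
move=> s0 /boxP aN fe; set N := (2 ^ m.+1)%N in aN fe *.
pose w := root2 m.
pose X (k : {ffun 'I_n -> 'I_N}) : 'rV[C]_n := \row_i ((s%:C)%C * w ^+ k i).
(* Discrete Fourier inversion: N - a_i stands for the exponent -a_i modulo N. *)
pose ch (k : {ffun 'I_n -> 'I_N}) : C := \prod_i w ^+ (k i * (N - a i)).
have N0 : (0 < N)%N by rewrite expn_gt0.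
have XE : \sum_k ch k * psum f (X k) N = (N ^ n)%:R * (f a * (s%:C)%C ^+ mdeg a).
  transitivity (\sum_(b <- box n N) f b * (s%:C)%C ^+ mdeg b *
      \prod_(i < n) \sum_(k < N) (w ^+ (N - a i + b i)) ^+ k).
    transitivity (\sum_k \sum_(b <- box n N) ch k * (f b * monom (X k) b)).
      by apply: eq_bigr => k _; rewrite psumE mulr_sumr.
    rewrite exchange_big; apply: eq_bigr => b _ /=.
    rewrite (bigA_distr_bigA (fun i (k : 'I_N) => (w ^+ (N - a i + b i)) ^+ k)).
    rewrite mulr_sumr; apply: eq_bigr => k _.
    have -> : monom (X k) b = (s%:C)%C ^+ mdeg b * \prod_i w ^+ (k i * b i).
      rewrite /monom /mdeg expr_sum -big_split; apply: eq_bigr => i _.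
      by rewrite mxE exprMn -exprM.
    rewrite mulrCA -!mulrA; congr (_ * _); rewrite mulrCA; congr (_ * _).
    rewrite /ch -big_split; apply: eq_bigr => i _ /=.
    by rewrite -exprD -mulnDr mulnC exprM.
  have aB : a \in box n N by apply/boxP.
  rewrite (bigD1_seq a) ?box_uniq//= [X in _ + X]big1_seq ?addr0 => [|b].
    rewrite mulrC; congr (_ * _); rewrite (eq_bigr (fun=> N%:R)) => [|i _].
      by rewrite prodr_const card_ord natrX.
    by rewrite sum_root2 subnK ?dvdnn//; exact: ltnW.
  move=> /andP[ba /boxP bN].
  have [i ai] : exists i, b i != a i.
    apply: contrapT => na; move/negP: ba; apply; apply/eqP/funext => i.
    by apply/eqP; apply: contrapT => ai; apply: na; exists i; exact/negP.
  rewrite (bigD1 i)//= sum_root2 ifN ?mul0r ?mulr0//.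
  (* As 0 < N - a_i + b_i < 2 N, divisibility by N forces a_i = b_i. *)
  apply/negP => /dvdnP[q qE]; move/eqP: ai; apply.
  have ai' := aN i; have bi' := bN i.
  have q1 : q = 1%N.
    case: q qE => [|[|q]] //; first by rewrite mul0n; lia.
    by rewrite !mulSn; move: (q * N)%N => z; lia.
  by move: qE; rewrite q1 mul1n; lia.
have Nn : 0 < (N ^ n)%:R :> R by rewrite ltr0n expn_gt0 N0.
rewrite -(ler_pM2l Nn).
have -> : (N ^ n)%:R * (nr (f a) * s ^+ mdeg a) =
    nr (\sum_k ch k * psum f (X k) N).
  have nrn (k : nat) : nr (k%:R : C) = k%:R.
    by apply: nrI; rewrite normr_nat (rmorph_nat (real_complex R)).
  by rewrite XE !nrM nrX nr_real ger0_norm// nrn.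
rewrite (le_trans (nr_sum _ _ _))//.
apply: le_trans (_ : \sum_(k : {ffun 'I_n -> 'I_N}) e <= _).
  apply: ler_sum => k _; rewrite nrM.
  have -> : nr (ch k) = 1.
    by rewrite /ch nr_prod big1// => i _; rewrite nrX nr_root2 expr1n.
  rewrite mul1r fe// => i; rewrite mxE nrM nr_real ger0_norm// nrX nr_root2.
  by rewrite expr1n mulr1.
by rewrite sumr_const card_ffun !card_ord -[leLHS]mulr_natl lexx.
Qed.

Lemma cauchy_est (r M e : R) f : 0 <= r -> nle r M f ->
  (forall x, (forall i, nr (x 0 i) = r / 2) -> nr (eval f x) <= e) ->
  forall a, nr (f a) * (r / 2) ^+ mdeg a <= e.
Proof.
move=> r0 fM fe a; have M0 := nle_ge0 r0 fM.
rewrite -subr_le0; apply: (@half_le0 _ _ M) => m.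
rewrite lerBlDl.
(* The cube has to contain a, and its side has to exceed m to make the tail at most M 2^-m. *)
pose k := maxn m (mdeg a).
have kN : (k < 2 ^ k.+1)%N by rewrite (ltn_trans (ltnSn _))// ltn_expl.
apply: (@le_trans _ _ (e + M * 2^-1 ^+ (2 ^ k.+1))); last first.
  rewrite lerD2l ler_wpM2l//; apply: ler_wiXn2l => //; rewrite ?invr_ge0//.
    by rewrite invf_le1// ler1n.
  by rewrite (leq_trans _ (ltnW kN))// leq_maxl.
apply: (cauchy_psum (m := k)); first by rewrite divr_ge0.
  by rewrite mdeg_box// (leq_ltn_trans _ kN)// leq_maxr.
move=> x xr; have sx : small r x by move=> i; rewrite xr.
have -> : psum f x (2 ^ k.+1) = eval f x - (eval f x - psum f x (2 ^ k.+1)) by ring.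
rewrite (le_trans (nrD _ _))// nrN lerD ?fe//.
exact: eval_approx r0 fM sx _.
Qed.

Lemma eval_eq0 (r M d : R) f : 0 < r -> nle r M f -> 0 < d ->
  (forall x, (forall i, nr (x 0 i) < d) -> eval f x = 0) -> f = 0.
Proof.
move=> r0 fM d0 f0.
have [s [s0 sr sd]] : exists s : R, [/\ 0 < s, s <= r & s / 2 < d].
  exists (Num.min r d); split; rewrite ?lt_min ?r0 ?ge_min ?lexx//.
  by rewrite ltr_pdivrMr// (@le_lt_trans _ _ d) ?ge_min ?lexx ?orbT// ltr_pMr// ltr1n.
have fM' := nle_le (ltW s0) sr (lexx _) fM.
apply/funext => a; rewrite coef_0; apply: nr_le0.
have sa : 0 < (s / 2) ^+ mdeg a by rewrite exprn_gt0// divr_gt0.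
rewrite -(pmulr_lle0 _ sa); apply: (cauchy_est (ltW s0) fM') => x xs.
by rewrite f0 ?nr0// => i; rewrite xs.
Qed.

Lemma abs_summable_nle (s : R) f : 0 <= s ->
  abs_summable f (\row_i (s%:C)%C : 'rV[C]_n) -> exists M, nle s M f.
Proof.
move=> s0 [M fM]; exists (complex.Re (M : R[i])) => N.
have := fM N.
rewrite (@big_box n C N (fun a => `|f a * monom (\row_i (s%:C)%C : 'rV[C]_n) a|)).
have -> : \sum_(a <- box n N) `|f a * monom (\row_i (s%:C)%C : 'rV[C]_n) a| =
    ((\sum_(a <- box n N) nr (f a) * s ^+ mdeg a)%:C)%C :> C.
  rewrite (rmorph_sum (real_complex R)); apply: eq_bigr => a _ /=.
  rewrite nrE nrM; congr (_ * _)%:C%C.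
  rewrite /monom nr_prod /mdeg expr_sum; apply: eq_bigr => i _.
  by rewrite mxE nrX nr_real ger0_norm.
by have := lecE ((\sum_(a <- box n N) nr (f a) * s ^+ mdeg a)%:C)%C (M : R[i]) => -> /andP[].
Qed.

(** Indeed n (r / (n + 1))^2 < r^2; the denominator n + 1 covers n = 0 as well. *)
Lemma oball_polydisc (r : R) x : 0 < r ->
  (forall i, nr (x 0 i) <= r / n.+1%:R) -> oball (r%:C)%C x.
Proof.
move=> r0 xr; rewrite /oball /=.
have -> : \sum_i `|x 0 i| ^+ 2 = ((\sum_i nr (x 0 i) ^+ 2)%:C)%C :> C.
  rewrite (rmorph_sum (real_complex R)); apply: eq_bigr => i _.
  by rewrite nrE (rmorphXn (real_complex R)).
rewrite -(rmorphXn (real_complex R)).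
have := @ltcR R (\sum_i nr (x 0 i) ^+ 2) (r ^+ 2) => ->.
apply: (@le_lt_trans _ _ (\sum_(i < n) (r / n.+1%:R) ^+ 2)).
  apply: ler_sum => i _; rewrite lerXn2r ?nnegrE ?nr_ge0//.
  by rewrite divr_ge0// ltW.
rewrite sumr_const card_ord -[X in X < _]mulr_natl expr_div_n mulrCA.
rewrite gtr_pMr ?exprn_gt0//.
rewrite -natrX ltr_pdivrMr ?ltr0n// mul1r ltr_nat.
by rewrite expnS expn1; nia.
Qed.

Lemma oball_coord (r : R) x i : 0 < r -> oball (r%:C)%C x -> nr (x 0 i) < r.
Proof.
move=> r0; rewrite /oball /=.
have -> : \sum_i `|x 0 i| ^+ 2 = ((\sum_i nr (x 0 i) ^+ 2)%:C)%C :> C.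
  rewrite (rmorph_sum (real_complex R)); apply: eq_bigr => j _.
  by rewrite nrE (rmorphXn (real_complex R)).
rewrite -(rmorphXn (real_complex R)).
have := @ltcR R (\sum_i nr (x 0 i) ^+ 2) (r ^+ 2) => -> xr.
rewrite -ltr_sqr ?nnegrE ?nr_ge0 ?ltW//.
apply: le_lt_trans xr; rewrite (bigD1 i)//= lerDl sumr_ge0// => j _.
by rewrite exprn_ge0 ?nr_ge0.
Qed.

(** Cauchy estimates on a polydisc inside the ball: a sup norm bound in one Banach space becomes an
    exponential bound on coefficients. *)
Lemma banach_coef (r e : R) (f : germ R n) : 0 < r -> banach (r%:C)%C f ->
  (forall x, oball (r%:C)%C x -> nr (eval f x) <= e) ->
  forall a, nr (germ_ps f a) * (r / n.+1%:R / 2) ^+ mdeg a <= e.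
Proof.
move=> r0 [fs _] fe; have n0 : 0 < r / n.+1%:R by rewrite divr_gt0.
have [M fM] : exists M, nle (r / n.+1%:R) M (germ_ps f).
  apply: abs_summable_nle (ltW n0) _; apply/fs/(oball_polydisc r0) => i.
  by rewrite mxE nr_real ger0_norm// ltW.
apply: (cauchy_est (ltW n0) fM) => x xr; apply/fe/(oball_polydisc r0) => i.
by rewrite xr ler_pdivrMr// ler_peMr ?ler1n// ltW.
Qed.

Lemma nle_abs_summable (r M : R) f x : 0 <= r -> nle r M f ->
  (forall i, nr (x 0 i) <= r) -> abs_summable f x.
Proof.
move=> r0 fM xr; exists (M%:C)%C => N.
rewrite (@big_box n C N (fun a => `|f a * monom x a|)).
have -> : \sum_(a <- box n N) `|f a * monom x a| =
    ((\sum_(a <- box n N) nr (f a * monom x a))%:C)%C :> C.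
  by rewrite (rmorph_sum (real_complex R)); apply: eq_bigr => a _; rewrite nrE.
have := @lecR R (\sum_(a <- box n N) nr (f a * monom x a)) M => ->.
apply: le_trans (fM N); apply: ler_sum => a _; rewrite nrM ler_wpM2l ?nr_ge0//.
exact: nr_monom_le.
Qed.

End CauchyEstimates.

(** * The inductive limit topology *)

Section SuperSequences.
Context {R : realType}.
Implicit Types (mu m : nat -> R).

(* The polydiscs |f_a| <= mu_|a| with mu of superexponential growth form a base of
   neighbourhoods of 0 in the inductive limit (nbhs_superexpP). *)
Definition superexp mu := (forall l, 0 < mu l) /\
  forall rho : R, 0 <= rho -> exists N, forall l, (N <= l)%N -> rho ^+ l <= mu l.

Lemma superexp_low mu (rho : R) : superexp mu -> 0 <= rho ->
  exists2 e, 0 < e & forall l, e * rho ^+ l <= mu l.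
Proof.
move=> [mu0 muP] rho0; have [N HN] := muP _ rho0.
have [e [e0 e1 eP]] : exists e, [/\ 0 < e, e <= 1 &
    forall l, (l < N)%N -> e * rho ^+ l <= mu l].
  elim: N {HN} => [|N [e [e0 e1 eP]]]; first by exists 1.
  pose d := Num.min e (mu N / (1 + rho ^+ N)).
  have p0 : 0 < 1 + rho ^+ N by rewrite ltr_wpDr ?exprn_ge0.
  have d0 : 0 < d by rewrite lt_min e0 divr_gt0.
  exists d; split=> //; first by rewrite ge_min e1.
  move=> l; rewrite ltnS leq_eqVlt => /predU1P[->|/eP le].
    apply: (@le_trans _ _ (d * (1 + rho ^+ N))).
      by rewrite ler_wpM2l ?ltW// ltrDr.
    by rewrite -ler_pdivlMr// ge_min lexx orbT.
  by rewrite (le_trans _ le)// ler_wpM2r ?exprn_ge0// ge_min lexx.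
exists e => // l; have [/eP//|Nl] := ltnP l N.
by rewrite (le_trans _ (HN _ Nl))// ler_piMl ?exprn_ge0.
Qed.

Lemma superexpZ mu (c : R) : 0 < c -> superexp mu -> superexp (fun l => c * mu l).
Proof.
move=> c0 muS; split=> [l|rho rho0]; first by rewrite mulr_gt0//; case: muS.
pose s := 2 * rho + 1.
(* A base larger than twice rho gains a factor 2^-l, which eventually falls below c * e. *)
have [e e0 eP] := superexp_low muS (addr_ge0 (mulr_ge0 (ler0n R 2) rho0) ler01).
have [N HN] := half_small 1 (mulr_gt0 c0 e0).
exists N => l /HN; rewrite mul1r => cl.
apply: le_trans (_ : c * (e * (2 * rho + 1) ^+ l) <= _); last first.
  by rewrite ler_wpM2l ?eP ?ltW.
rewrite mulrA; apply: le_trans (_ : 2^-1 ^+ l * (2 * rho + 1) ^+ l <= _); last first.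
  by rewrite ler_wpM2r// exprn_ge0// addr_ge0// mulr_ge0.
rewrite -exprMn lerXn2r ?nnegrE//.
  by rewrite mulr_ge0 ?invr_ge0// addr_ge0// mulr_ge0.
by rewrite mulrDr mulrA mulVf// mul1r lerDl mulr_ge0 ?invr_ge0.
Qed.

(* A superexponential weight is glued from weights m_j of exponential growth, each
   one extending the previous one beyond a cut k chosen afterwards: a series that is
   exponentially bounded and below mu is below some m_j. *)
Lemma superexp_seq (G : nat -> (nat -> R) -> Prop) :
  (exists2 e, 0 < e & G 0%N (fun=> e)) ->
  (forall j m, (forall l, 0 < m l) -> (exists rho, forall l, m l <= rho ^+ l.+1) ->
    G j m -> exists k0, forall k, (k0 <= k)%N ->
    G j.+1 (fun l => if (l < k)%N then m l else j.+1%:R ^+ l)) ->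
  exists mu, superexp mu /\ forall rho, 0 <= rho -> exists j m, G j m /\
    forall l x, x <= rho ^+ l.+1 -> x <= mu l -> x <= m l.
Proof.
move=> [e e0 Ge] step.
(* A state consists of the index j, the weight m_j and the last cut. The exponential bound on m_j is
   carried along because [step] asks for it. *)
pose P (s : nat * (nat -> R) * nat) := [/\ forall l, 0 < s.1.2 l,
  exists rho, forall l, s.1.2 l <= rho ^+ l.+1 & G s.1.1 s.1.2].
have /choice[F FP] s : exists s' : nat * (nat -> R) * nat, P s ->
   [/\ P s', s'.1.1 = s.1.1.+1, (s.2 < s'.2)%N & s'.1.2 =
     fun l => if (l < s'.2)%N then s.1.2 l else s.1.1.+1%:R ^+ l].
  have [Ps|nPs] := pselect (P s); last by exists s => /nPs.
  case: s Ps => -[j m] k Ps; have [m0 mb Gm] := Ps.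
  have [k0 kP] := step _ _ m0 mb Gm.
  pose k' := maxn k0 k.+1.
  exists (j.+1, (fun l => if (l < k')%N then m l else j.+1%:R ^+ l), k') => _.
  split=> //=; last by rewrite leq_maxr.
  split=> /= [l||]; last by apply: kP; rewrite leq_maxl.
    by case: ifP => // _; rewrite exprn_gt0.
  have [rho rP] := mb; exists (Num.max rho j.+1%:R) => l.
  have rho0 : 0 <= rho by have := le_trans (ltW (m0 0%N)) (rP 0%N); rewrite expr1.
  case: ifP => _.
    rewrite (le_trans (rP l))// lerXn2r ?nnegrE ?le_max ?rho0 ?lexx//.
  apply: le_trans (_ : j.+1%:R ^+ l.+1 <= _).
    by rewrite exprS ler_peMl ?exprn_ge0// ler1n.
  by rewrite lerXn2r ?nnegrE ?le_max ?ler0n ?lexx ?orbT.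
pose s i := iter i F (0%N, (fun=> e), 0%N).
have sP i : P (s i).
  elim: i => [|i IH]; last by rewrite /s iterS; have [] := FP _ IH.
  split=> //=; exists (e + 1) => l; rewrite exprS.
  apply: le_trans (_ : e + 1 <= _); first by rewrite lerDl.
  by rewrite ler_peMr ?exprn_ege1 ?addr_ge0 ?lerDr// ltW.
have sj i : (s i).1.1 = i.
  elim: i => [//|i IH]; have [_ + _ _] := FP _ (sP i).
  by rewrite -iterS -/(s i.+1) IH.
have sk i : ((s i).2 < (s i.+1).2)%N by have [] := FP _ (sP i).
have sm i l : (s i.+1).1.2 l = if (l < (s i.+1).2)%N then (s i).1.2 l else i.+1%:R ^+ l.
  by have [_ _ _] := FP _ (sP i); rewrite -iterS -/(s i.+1) => ->; rewrite sj.
have ki i : (i <= (s i).2)%N.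
  by elim: i => // i IH; rewrite (leq_trans _ (sk i)).
have kmono i j : (i <= j)%N -> ((s i).2 <= (s j).2)%N.
  move=> /subnK <-; elim: (j - i)%N => [|d IH]; first by rewrite add0n.
  by rewrite addSn (leq_trans IH)// ltnW.
have stab i j l : (i <= j)%N -> (l < (s i.+1).2)%N -> (s j).1.2 l = (s i).1.2 l.
  move=> /subnK <- li; elim: (j - i)%N => [|d IH]; first by rewrite add0n.
  rewrite addSn sm ifT; first exact: IH.
  by rewrite (leq_trans li)// kmono// ltnS leq_addl.
have low i j l : (i.+1 <= j)%N -> ((s i.+1).2 <= l)%N -> i.+1%:R ^+ l <= (s j).1.2 l.
  move=> /subnK <- li; elim: (j - i.+1)%N => [|d IH].
    by rewrite add0n sm ltnNge li.
  rewrite addSn sm; case: ifP => // _; rewrite lerXn2r ?nnegrE//.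
  by rewrite ler_nat ltnW// addnS !ltnS leq_addl.
pose mu l := (s l).1.2 l; exists mu; split.
  split=> [l|rho rho0]; first by have [+ _ _] := sP l; exact.
  pose i := Num.bound rho; exists (s i.+1).2 => l il.
  have := low i l l (leq_trans (ki _) il) il; apply: le_trans.
  rewrite lerXn2r ?nnegrE// (le_trans (ltW (archi_boundP rho0)))//.
  by rewrite ler_nat.
(* The square absorbs the exponent l + 1: rho^(l + 1) <= c^l for l >= 1. Beyond its cut the weight
   of index i + 1 is at least c^l; before the cut it agrees with mu or has not yet been replaced by
   it. *)
move=> rho rho0; pose c := (1 + rho) ^+ 2; have c0 : 0 <= c by rewrite exprn_ge0// addr_ge0.
pose i := Num.bound c.
have ci : c <= i.+1%:R.
  by rewrite (le_trans (ltW (archi_boundP c0)))// ler_nat.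
exists i.+1, (s i.+1).1.2; split; first by have [_ _] := sP i.+1; rewrite sj.
move=> l x xr xmu; have [li|il] := ltnP l (s i.+1).2; last first.
  rewrite (le_trans xr)// (le_trans _ (low i i.+1 l _ il))//.
  have l0 : (0 < l)%N by rewrite (leq_trans _ il)// (leq_trans _ (ki _)).
  apply: (@le_trans _ _ (c ^+ l)); last by rewrite lerXn2r ?nnegrE.
  have r1 : 1 <= 1 + rho by rewrite lerDl.
  rewrite /c -exprM; apply: le_trans (_ : (1 + rho) ^+ l.+1 <= _).
    by rewrite lerXn2r ?nnegrE ?addr_ge0// lerDr.
  by apply: ler_weXn2l => //; rewrite mul2n -addnn -addn1 leq_add2l.
rewrite (le_trans xmu)// /mu -(stab l (maxn l i.+1) l) ?leq_maxl//.
by rewrite (stab i.+1) ?leq_maxr// (leq_trans li)// ltnW.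
Qed.
End SuperSequences.

Section Topology.
Context {R : realType}.
Notation C := (Cplx R).
Variable n : nat.
Implicit Types (f g : germ R n) (mu : nat -> R) (V : set (germ R n)).

Lemma germP (f : germ R n) : convergent (germ_ps f).
Proof. by case: f => f /= /asboolP. Qed.

Definition mkgerm (f : ps R n) (cf : convergent f) : germ R n := Germ (asboolT cf).

Lemma germ_eq f g : (germ_ps f : ps R n) = germ_ps g -> f = g.
Proof. exact: val_inj. Qed.

Lemma germD f g : germ_ps (f + g) = (germ_ps f + germ_ps g : fps R n).
Proof. by []. Qed.
Lemma germZ (c : C) f : germ_ps (c *: f) = (c *: germ_ps f : fps R n).
Proof. by []. Qed.
Lemma germ0 : germ_ps (0 : germ R n) = (0 : fps R n).
Proof. by []. Qed.
Lemma germ_sum I (s : seq I) (P : pred I) (F : I -> germ R n) :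
  germ_ps (\sum_(i <- s | P i) F i) = \sum_(i <- s | P i) (germ_ps (F i) : fps R n).
Proof. by elim/big_rec2: _ => // i x y _ <-. Qed.

(** The exponent |a| + 1 lets one number control both the radius and the constant, including the
    constant term. *)
Lemma germ_bound (f : germ R n) :
  exists2 rho : R, 0 <= rho & forall a, nr (germ_ps f a) <= rho ^+ (mdeg a).+1.
Proof.
have /convergentP[r [M [r0 fM]]] := germP f.
have M0 := nle_ge0 (ltW r0) fM.
have ri : 0 <= r^-1 by rewrite invr_ge0 ltW.
exists (1 + r^-1 + M) => [|a]; first by rewrite !addr_ge0.
have := nle_coef a (ltW r0) fM; rewrite -ler_pdivlMr ?exprn_gt0// => fa.
rewrite (le_trans fa)// -exprVn exprS ler_pM ?exprn_ge0//.
  by rewrite lerDr addr_ge0.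
by rewrite lerXn2r ?nnegrE ?addr_ge0// addrAC lerDr addr_ge0.
Qed.

Lemma psum_continuous (f : ps R n) N : continuous (psum f ^~ N).
Proof.
have -> : psum f ^~ N = fun x => \sum_(a <- box n N) f a * monom x a.
  by apply/funext => x; rewrite psumE.
elim: (box n N) => [|a s IH] x.
  under eq_fun do rewrite big_nil.
  exact: cst_continuous.
under eq_fun do rewrite big_cons.
have FF : Filter (nbhs x) := nbhs_filter x.
have mc : (fun y : 'rV[C]_n => monom y a) @ nbhs x --> monom x a.
  rewrite /monom /=; elim: (index_enum _) => [|i t IH'].
    under eq_fun do rewrite big_nil.
    rewrite big_nil; exact: (@cst_continuous 'rV[C]_n C 1 x).
  under eq_fun do rewrite big_cons.
  rewrite big_cons.
  have pc : (fun y : 'rV[C]_n => y 0 i ^+ a i) @ nbhs x --> x 0 i ^+ a i.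
    elim: (a i) => [|k IHk].
      under eq_fun do rewrite expr0.
      rewrite expr0; exact: (@cst_continuous 'rV[C]_n C 1 x).
    under eq_fun do rewrite exprS.
    rewrite exprS; exact: (cvgM (@coord_continuous C _ _ 0 i x) IHk).
  exact: (cvgM pc IH').
exact: (cvgD (cvgM (@cst_continuous _ _ (f a) x) mc) (IH x)).
Qed.

(** On the closed ball of radius r / 2 the partial sums converge uniformly, so the value is
    continuous there as a limit of polynomials. *)
Lemma nle_banach (f : germ R n) (r M : R) : 0 < r -> nle r M (germ_ps f) ->
  banach ((r / 2)%:C)%C f.
Proof.
move=> r0 fM; have r2 : 0 < r / 2 by rewrite divr_gt0.
have r2r : r / 2 <= r by rewrite ler_pdivrMr// ler_peMr ?ler1n// ltW.
have M0 := nle_ge0 (ltW r0) fM.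
split=> [x xr|].
  apply: (nle_abs_summable (ltW r0) fM) => i; apply: le_trans r2r.
  exact/ltW/(oball_coord i r2 xr).
exists (eval f) => //.
have csmall (x : 'rV[C]_n) : cball ((r / 2)%:C)%C x -> small r x.
  move=> xr i; rewrite -ler_sqr ?nnegrE ?nr_ge0 ?(ltW r2)//; move: xr.
  rewrite /cball /=.
  have -> : \sum_i `|x 0 i| ^+ 2 = ((\sum_i nr (x 0 i) ^+ 2)%:C)%C :> C.
    rewrite (rmorph_sum (real_complex R)); apply: eq_bigr => j _.
    by rewrite nrE (rmorphXn (real_complex R)).
  rewrite -(rmorphXn (real_complex R)).
  have := @lecR R (\sum_i nr (x 0 i) ^+ 2) ((r / 2) ^+ 2) => -> xr.
  apply: le_trans xr; rewrite (bigD1 i)//= lerDl sumr_ge0// => j _.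
  by rewrite exprn_ge0 ?nr_ge0.
apply/subspace_continuousP => x xr; apply/cvgrPdist_le => e /gt0_realP[d d0 ->].
have d3 : 0 < d / 3 by rewrite divr_gt0.
have [N /(_ N (leqnn _)) HN] := half_small M d3.
have d3' : 0 < ((d / 3)%:C)%C :> C by have := @ltcR R 0 (d / 3) => ->.
have /cvgrPdist_le/(_ _ d3') := @psum_continuous f N x.
rewrite near_simpl /within /=.
apply: (@filterS _ (nbhs (x : 'rV[C]_n)) (nbhs_filter x)) => y; rewrite lec_nr => xy yr.
rewrite lec_nr.
have -> : eval f x - eval f y = (eval f x - psum f x N) +
   ((psum f x N - psum f y N) - (eval f y - psum f y N)) by ring.
have -> : d = d / 3 + (d / 3 + d / 3) by field.
rewrite (le_trans (nrD _ _))// lerD//.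
  apply: le_trans HN; exact: (eval_approx (ltW r0) fM (csmall _ xr)).
rewrite (le_trans (nrD _ _))// lerD// nrN.
apply: le_trans HN; exact: (eval_approx (ltW r0) fM (csmall _ yr)).
Qed.

(** Series with coefficients at most e rho^|a| lie in a small ball of a single Banach space, and the
    trace of V there is a neighbourhood of 0. *)
Lemma ind_nbhs0_small V : ind_nbhs0 V -> forall rho : R, 1 <= rho ->
  exists2 e : R, 0 < e &
    forall f, (forall a, nr (germ_ps f a) <= e * rho ^+ mdeg a) -> V f.
Proof.
move=> [_ VP] rho rho1; have rho0 : 0 < rho by apply: lt_le_trans rho1.
pose r := rho^-1 / 2; have r0 : 0 < r by rewrite divr_gt0 ?invr_gt0.
have r20 : 0 < ((r / 2)%:C)%C :> C by have := @ltcR R 0 (r / 2) => ->; rewrite divr_gt0.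
have [_ /gt0_realP[e e0 ->] HV] := VP _ r20.
exists (e / 2 ^+ n) => [|f fe]; first by rewrite divr_gt0 ?exprn_gt0.
have fM : nle r e (germ_ps f).
  have -> : e = 2 ^+ n * (e / 2 ^+ n) by rewrite mulrCA divff ?mulr1// expf_neq0.
  apply: nle_of_coef => [||a]; first by rewrite invr_ge0 ltW.
    by rewrite divr_ge0 ?exprn_ge0// ltW.
  by rewrite exprVn ler_pdivrMr ?exprn_gt0.
apply: HV; first exact: nle_banach r0 fM.
move=> x xr; rewrite lec_nr; apply: (eval_bound (ltW r0) fM) => i.
by apply/ltW/(oball_coord i _ xr); rewrite divr_gt0.
Qed.

(** By the Cauchy estimates, coefficients in a small ball of a Banach space are at most e t^-|a|; a
    superexponential weight dominates this for small e. *)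
Lemma superexp_nbhs mu : superexp mu ->
  ind_nbhs0 [set f : germ R n | forall a, nr (germ_ps f a) <= mu (mdeg a)].
Proof.
move=> muS; have [mu0 _] := muS; split=> [a b f g ab fm gm c|_ /gt0_realP[r r0 ->]].
  rewrite germD !germZ coefD !coefZ (le_trans (nrD _ _))// !nrM.
  apply: le_trans (_ : (nr a + nr b) * mu (mdeg c) <= _).
    by rewrite mulrDl lerD// ler_wpM2l ?nr_ge0.
  rewrite ler_piMl ?(ltW (mu0 _))//; move: ab; rewrite !nrE.
  have -> : (nr a)%:C%C + (nr b)%:C%C = ((nr a + nr b)%:C)%C :> C.
    exact/esym/(rmorphD (real_complex R)).
  by have := @lecR R (nr a + nr b) 1 => ->.
pose t := r / n.+1%:R / 2; have t0 : 0 < t by rewrite !divr_gt0.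
have ti : 0 <= t^-1 by rewrite invr_ge0 ltW.
have [e e0 eP] := superexp_low muS ti.
exists (e%:C)%C => [|f fr fe a]; first by have := @ltcR R 0 e => ->.
have fe' x : oball (r%:C)%C x -> nr (eval f x) <= e by move/fe; rewrite lec_nr.
have := banach_coef r0 fr fe' a; rewrite -/t -ler_pdivlMr ?exprn_gt0// => fa.
by rewrite (le_trans fa)// -exprVn eP.
Qed.

Lemma nbhs_superexp (f0 : germ R n) mu (A : set (germ R n)) : superexp mu ->
  (forall f, (forall a, nr (germ_ps f a - germ_ps f0 a) <= mu (mdeg a)) -> A f) ->
  nbhs f0 A.
Proof.
move=> muS muA; have [mu0 _] := muS.
(* The factor c < 1 makes this set open: from f there is room for (1 - c) / 2 times the weight. *)
rewrite nbhsE; exists [set f | exists2 c : R, c < 1 & forall a,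
    nr (germ_ps f a - germ_ps f0 a) <= c * mu (mdeg a)].
  split; last by exists 0 => // a; rewrite subrr nr0 mul0r.
  move=> f [c c1 fc].
  have d0 : 0 < (1 - c) / 2 by rewrite divr_gt0// subr_gt0.
  exists [set f : germ R n | forall a, nr (germ_ps f a) <= (1 - c) / 2 * mu (mdeg a)].
    by apply: (superexp_nbhs (mu := fun l => (1 - c) / 2 * mu l)); exact: superexpZ.
  move=> g gc; exists (c + (1 - c) / 2); first by lra.
  move=> a; rewrite germD coefD addrAC (le_trans (nrD _ _))// mulrDl lerD//.
move=> f [c c1 fc]; apply: muA => a; rewrite (le_trans (fc a))//.
by rewrite ler_piMl ?ltW.
Qed.

(** The weights fed to [superexp_seq] are those whose polydisc lies in c_j V, where c_j = 1 - 2^-(j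
    + 1). To extend a weight, a series is split at degree k: the low part lies in c_j V, the high
    part in 2^-(j + 2) V once k is large, and the sum in c_(j + 1) V by convexity. *)
Lemma ind_nbhs0_superexp V : ind_nbhs0 V -> exists2 mu, superexp mu &
  forall f, (forall a, nr (germ_ps f a) <= mu (mdeg a)) -> V f.
Proof.
move=> Vn; have [Vc _] := Vn.
pose c j : R := 1 - 2^-1 ^+ j.+1.
have h0 j : 0 < (2^-1 : R) ^+ j by rewrite exprn_gt0// invr_gt0.
have h1 j : (2^-1 : R) ^+ j.+1 < 1 by rewrite exprn_ilt1 ?invr_ge0// invf_lt1 ?ltr1n.
have c0 j : 0 < c j by rewrite subr_gt0.
have c1 j : c j <= 1 by rewrite gerBl ltW.
pose G j m := forall f, (forall a, nr (germ_ps f a) <= m (mdeg a)) ->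
  V ((((c j)^-1)%:C)%C *: f).
have nrc (x : R) : 0 < x -> nr ((x%:C)%C : C) = x by move=> x0; rewrite nr_real gtr0_norm.
have [||mu [muS muP]] := @superexp_seq R G.
- have [e e0 eV] := ind_nbhs0_small Vn (lexx 1).
  exists (e / 2); first by rewrite divr_gt0.
  move=> f fe; apply: eV => a; rewrite expr1n mulr1 germZ coefZ nrM nrc ?invr_gt0//.
  rewrite -ler_pdivlMl ?invr_gt0// invrK /c expr1 mulrC.
  by rewrite (_ : 1 - 2^-1 = 2^-1 :> R) ?fe//; field.
(* Twice the growth rate of the new tail: from degree k on, the tail is at most 2^-k times s^|a|,
   hence small in the sense of [ind_nbhs0_small]. *)
- move=> j m m0 [rho mrho] Gm; pose s : R := 2 * j.+1%:R.
  have s1 : 1 <= s by rewrite /s -natrM ler1n.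
  have [e e0 eV] := ind_nbhs0_small Vn s1.
  have [k0 kP] := half_small (2^-1 ^+ j.+2)^-1 e0.
  exists k0 => k /kP ke f fm.
  pose lo : ps R n := fun a => if (mdeg a < k)%N then germ_ps f a else 0.
  pose hi : ps R n := fun a => if (mdeg a < k)%N then 0 else germ_ps f a.
  have [r [M [r0 fM]]] := germP f.
  have M0 : 0 <= M by rewrite (le_trans _ (fM (mi0 n)))// mulr_ge0// exprn_ge0// ltW.
  have clo : convergent lo.
    by exists r, M; split=> // a; rewrite /lo; case: ifP; rewrite ?normr0 ?mul0r.
  have chi : convergent hi.
    by exists r, M; split=> // a; rewrite /hi; case: ifP; rewrite ?normr0 ?mul0r.
  have Vlo : V ((((c j)^-1)%:C)%C *: mkgerm clo).
    apply: Gm => a; rewrite /= /lo; case: ifP => ak; last by rewrite nr0 ltW.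
    by have := fm a; rewrite ak.
  pose d : R := 2^-1 ^+ j.+2.
  have d0 : 0 < d := h0 _.
  have cd : c j.+1 = c j + d by rewrite /c /d [2^-1 ^+ j.+2]exprS; field.
  have Vhi : V (((d^-1)%:C)%C *: mkgerm chi).
    apply: eV => a; rewrite germZ coefZ nrM nrc ?invr_gt0//= /hi.
    case: ifP => ak.
      by rewrite nr0 mulr0 mulr_ge0 ?exprn_ge0 ?(le_trans _ s1)// ltW.
    apply: le_trans (_ : d^-1 * j.+1%:R ^+ mdeg a <= _).
      by rewrite ler_wpM2l ?invr_ge0 ?(ltW d0)//; have := fm a; rewrite ak.
    apply: le_trans (_ : d^-1 * 2^-1 ^+ k * s ^+ mdeg a <= _); last first.
      by rewrite ler_wpM2r ?exprn_ge0 ?(le_trans _ s1).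
    rewrite -mulrA ler_wpM2l ?invr_ge0 ?(ltW d0)// /s exprMn mulrA ler_peMl ?exprn_ge0//.
    have ak' : (k <= mdeg a)%N by rewrite leqNgt ak.
    rewrite exprVn -ler_pdivrMl ?invr_gt0 ?exprn_gt0// mulr1 invrK.
    by rewrite ler_weXn2l// ler1n.
  have -> : (((c j.+1)^-1)%:C)%C *: f =
      ((c j / c j.+1)%:C)%C *: ((((c j)^-1)%:C)%C *: mkgerm clo) +
      ((d / c j.+1)%:C)%C *: (((d^-1)%:C)%C *: mkgerm chi).
    rewrite !scalerA; apply: germ_eq; apply/funext => a.
    rewrite germD !germZ coefD !coefZ /= /lo /hi.
    have E1 : (c j / c j.+1)%:C%C * ((c j)^-1)%:C%C = ((c j.+1)^-1)%:C%C :> C.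
      have <- := rmorphM (real_complex R) (c j / c j.+1) (c j)^-1.
      by congr (_%:C)%C; rewrite mulrAC divff ?mul1r ?gt_eqF.
    have E2 : (d / c j.+1)%:C%C * (d^-1)%:C%C = ((c j.+1)^-1)%:C%C :> C.
      have <- := rmorphM (real_complex R) (d / c j.+1) d^-1.
      by congr (_%:C)%C; rewrite mulrAC divff ?mul1r ?gt_eqF.
    by rewrite E1 E2; case: ifP; rewrite ?mulr0 ?addr0 ?add0r.
  apply: Vc => //; rewrite !nrE !nrc ?divr_gt0//.
  have -> : (c j / c j.+1)%:C%C + (d / c j.+1)%:C%C = 1 :> C.
    have <- := rmorphD (real_complex R) (c j / c j.+1) (d / c j.+1).
    by rewrite -mulrDl -cd divff ?gt_eqF.
  exact: lexx.
exists mu => // f fm; have [rho rho0 fr] := germ_bound f.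
have [j [m [Gm mP]]] := muP _ rho0.
have Vf : V ((((c j)^-1)%:C)%C *: f) by apply: Gm => a; exact: mP.
have -> : f = ((c j)%:C)%C *: ((((c j)^-1)%:C)%C *: f) + 0 *: ((((c j)^-1)%:C)%C *: f).
  rewrite scale0r addr0 scalerA.
  have <- := rmorphM (real_complex R) (c j) (c j)^-1.
  by rewrite divff ?gt_eqF// (rmorph1 (real_complex R)) scale1r.
apply: Vc => //; rewrite normr0 addr0 nrE nrc//.
by have := @lecR R (c j) 1 => ->.
Qed.

Lemma nbhs_superexpP (f0 : germ R n) (A : set (germ R n)) : nbhs f0 A <->
  exists2 mu, superexp mu & forall f,
    (forall a, nr (germ_ps f a - germ_ps f0 a) <= mu (mdeg a)) -> A f.
Proof.
split=> [|[mu]]; last exact: nbhs_superexp.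
rewrite nbhsE => -[U [oU Uf0] UA]; have [V /ind_nbhs0_superexp[mu muS muV] VU] := oU _ Uf0.
exists mu => // f fm; apply: UA; rewrite -[f](subrK f0) addrC.
by apply/VU/muV => a; exact: fm.
Qed.
End Topology.

(** * Continuity from coefficientwise continuity and boundedness *)

Section Tame.
Context {R : realType}.
Notation C := (Cplx R).
Variables (I : Type) (deg : I -> nat).
Notation P := (I -> C).
Variables (D : set P) (p0 : P).
Implicit Types (p q : P) (phi : P -> C).

Definition agree_upto N p q := forall i, (deg i <= N)%N -> p i = q i.

Definition coefw : set_system P := [set A | exists N (d : R), 0 < d /\
  forall p, D p -> (forall i, (deg i <= N)%N -> nr (p i - p0 i) <= d) -> A p].

Global Instance coefw_filter : Filter coefw.
Proof.
split=> [|A B [N [d [d0 HA]]] [K [e [e0 HB]]]|A B AB [N [d [d0 HA]]]].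
- by exists 0%N, 1.
- exists (maxn N K), (Num.min d e); split; first by rewrite lt_min d0.
  move=> p Dp Hp; split.
    apply: HA => // i iN; have := Hp i (leq_trans iN (leq_maxl _ _)).
    by rewrite le_min => /andP[].
  apply: HB => // i iN; have := Hp i (leq_trans iN (leq_maxr _ _)).
  by rewrite le_min => /andP[].
- by exists N, d; split=> // p Dp Hp; apply/AB/HA.
Qed.

Definition findet N phi := forall p q, D p -> D q -> agree_upto N p q -> phi p = phi q.

Lemma findet_le N K phi : (N <= K)%N -> findet N phi -> findet K phi.
Proof.
by move=> NK H p q Dp Dq pq; apply: H => // i /leq_trans/(_ NK); exact: pq.
Qed.

(** Dependence on finitely many degrees is demanded besides continuity: it allows the tail of the
    argument to be replaced without changing the value. *)
Definition tameS phi := (exists N, findet N phi) /\ phi @ coefw --> phi p0.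

Lemma tameS_cst c : tameS (fun=> c).
Proof. by split; [exists 0%N|exact: (@cvg_cst C c _ coefw coefw_filter)]. Qed.

Lemma tameS_coord i : tameS (fun p => p i).
Proof.
split; first by exists (deg i) => p q _ _; exact.
apply/cvgrPdist_le => e /gt0_realP[d d0 ->].
exists (deg i), d; split=> // p Dp H; rewrite /= lec_nr nrB; exact: H.
Qed.

Lemma tameSD phi psi : tameS phi -> tameS psi -> tameS (fun p => phi p + psi p).
Proof.
move=> [[N HN] cN] [[K HK] cK]; split; last exact: (cvgD cN cK).
exists (maxn N K) => p q Dp Dq pq.
by rewrite (findet_le (leq_maxl N K) HN Dp Dq pq) (findet_le (leq_maxr N K) HK Dp Dq pq).
Qed.

Lemma tameSM phi psi : tameS phi -> tameS psi -> tameS (fun p => phi p * psi p).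
Proof.
move=> [[N HN] cN] [[K HK] cK]; split; last exact: (cvgM cN cK).
exists (maxn N K) => p q Dp Dq pq.
by rewrite (findet_le (leq_maxl N K) HN Dp Dq pq) (findet_le (leq_maxr N K) HK Dp Dq pq).
Qed.

Lemma tameSN phi : tameS phi -> tameS (fun p => - phi p).
Proof.
move=> [[N HN] cN]; split; last exact: (cvgN cN).
by exists N => p q Dp Dq pq; rewrite (HN p q).
Qed.

Lemma tameSV phi : phi p0 != 0 -> tameS phi -> tameS (fun p => (phi p)^-1).
Proof.
move=> p0n [[N HN] cN]; split; last exact: (cvgV p0n cN).
by exists N => p q Dp Dq pq; rewrite (HN p q).
Qed.

Lemma tameSJ phi : tameS phi -> tameS (fun p => (phi p)^*).
Proof.
move=> [[N HN] cN]; split; first by exists N => p q Dp Dq pq; rewrite (HN p q).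
apply/cvgrPdist_le => e e0; move/cvgrPdist_le: cN => /(_ _ e0).
by apply: filterS => p; rewrite -rmorphB norm_conjC.
Qed.

Lemma tameS_sum J (s : seq J) (Q : pred J) (F : J -> P -> C) :
  (forall j, Q j -> tameS (F j)) -> tameS (fun p => \sum_(j <- s | Q j) F j p).
Proof.
move=> FT; elim: s => [|j s IH].
  by under eq_fun do rewrite big_nil; exact: tameS_cst.
under eq_fun do rewrite big_cons.
case: (boolP (Q j)) => Qj; last exact: IH.
exact: (tameSD (FT j Qj) IH).
Qed.

Variable n : nat.
Implicit Types (F G : P -> fps R n).

Definition tameC F := forall b, tameS (fun p => F p b).

Definition bdd (rho : R) p := forall i, nr (p i) <= rho ^+ (deg i).+1.

(** Bounded sets of convergent series are those with a common exponential bound on coefficients, so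
    this is boundedness of F on bounded sets. *)
Definition unif F := forall rho : R, 0 <= rho -> exists r M : R, 0 < r /\
  forall p, D p -> bdd rho p -> nle r M (F p).

Hypothesis D0 : D p0.

Lemma findet_seq F (s : seq ('I_n -> nat)) : tameC F ->
  exists N, forall b, b \in s -> findet N (fun p => F p b).
Proof.
move=> FC; elim: s => [|b s [N HN]]; first by exists 0%N.
have [[K HK] _] := FC b; exists (maxn N K) => c; rewrite inE => /predU1P[->|/HN cN].
  exact: findet_le (leq_maxr N K) HK.
exact: findet_le (leq_maxl N K) cN.
Qed.

Lemma near_seq F (s : seq ('I_n -> nat)) mu : tameC F -> superexp mu ->
  coefw [set p | forall b, b \in s -> nr (F p b - F p0 b) <= mu (mdeg b)].
Proof.
move=> FC [mu0 _]; elim: s => [|b s IH]; first exact: filterE.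
have [_ /cvgrPdist_le/(_ ((mu (mdeg b))%:C)%C)] := FC b.
have -> : 0 < ((mu (mdeg b))%:C)%C :> C by have := @ltcR R 0 (mu (mdeg b)) => ->.
move=> /(_ isT) H; apply: filterS2 H IH => p; rewrite lec_nr nrB => pb ps c.
by rewrite inE => /predU1P[->//|/ps].
Qed.

(* There is no compactness: p is cut at order k and its tail replaced by that of p0,
   which changes only coefficients of F p controlled by the uniform bound. *)
Lemma tame_continuous F (rho0 : R) mu' : tameC F -> unif F -> 0 <= rho0 ->
  bdd rho0 p0 -> (exists N0, forall p q, D p -> agree_upto N0 p q -> D q) ->
  superexp mu' -> exists2 mu, superexp mu & forall p, D p ->
    (exists2 rho, 0 <= rho & bdd rho p) ->
    (forall i, nr (p i - p0 i) <= mu (deg i)) ->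
    forall b, nr (F p b - F p0 b) <= mu' (mdeg b).
Proof.
move=> FC FU rho00 bp0 [N0 HN0] muS.
(* In high degrees the uniform bound decides alone: both values are at most M r^-|b|, and [mu']
   outgrows twice that. *)
have large rho : 0 <= rho -> exists N, forall p, D p -> bdd rho p ->
    forall b, (N <= mdeg b)%N -> nr (F p b - F p0 b) <= mu' (mdeg b).
  move=> rho_ge0; pose s := rho + rho0.
  have s0 : 0 <= s by rewrite addr_ge0.
  have bs (x : R) p : 0 <= x -> x <= s -> bdd x p -> bdd s p.
    by move=> x0 xs H i; rewrite (le_trans (H i))// lerXn2r ?nnegrE.
  have [r [M [r0 HM]]] := FU _ s0.
  have M0 : 0 <= M.
    by apply: nle_ge0 (ltW r0) (HM _ D0 (bs _ _ rho00 _ bp0)); rewrite lerDr.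
  have c0 : 0 < (M + M + 1)^-1 by rewrite invr_gt0 ltr_wpDl ?addr_ge0.
  have ri : 0 <= r^-1 by rewrite invr_ge0 ltW.
  have [N HN] := (superexpZ c0 muS).2 _ ri.
  exists N => p Dp bp b /HN; rewrite mulrC ler_pdivlMr ?ltr_wpDl ?addr_ge0// => Hb.
  have est q : D q -> bdd s q -> nr (F q b) <= M * r^-1 ^+ mdeg b.
    move=> Dq bq; have := nle_coef b (ltW r0) (HM _ Dq bq).
    by rewrite -ler_pdivlMr ?exprn_gt0// exprVn.
  rewrite (le_trans (nrD _ _))// nrN; apply: le_trans Hb.
  rewrite mulrC 2!mulrDl mul1r ler_wpDr ?exprn_ge0//.
  by rewrite lerD// est//; [apply: bs bp; rewrite ?lerDl|apply: bs bp0; rewrite ?lerDr].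
have bdd_add rho p : 0 <= rho -> (forall i, nr (p i - p0 i) <= rho ^+ (deg i).+1) ->
    bdd (rho + rho0) p.
  move=> r0 Hp i; rewrite -[p i](subrK (p0 i)) (le_trans (nrD _ _))//.
  apply: le_trans (lerD (Hp i) (bp0 i)) _; elim: (deg i) => [|k IH].
    by rewrite !expr1.
  rewrite exprS [rho0 ^+ _]exprS [leRHS]exprS.
  apply: le_trans (_ : (rho + rho0) * (rho ^+ k.+1 + rho0 ^+ k.+1) <= _).
    by rewrite mulrDl lerD// ler_wpM2l// ?lerDl ?lerDr ?exprn_ge0.
  by rewrite ler_wpM2l ?addr_ge0.
pose G (j : nat) (m : nat -> R) := forall p, D p ->
  (forall i, nr (p i - p0 i) <= m (deg i)) ->
  forall b, nr (F p b - F p0 b) <= mu' (mdeg b).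
have [||mu [muS' muP]] := @superexp_seq R G; last first.
- exists mu => // p Dp [rho rho_ge0 bp] Hp.
  have [j [m [Gm mP]]] := muP (rho + rho0) (addr_ge0 rho_ge0 rho00).
  apply: Gm => // i; apply: mP => //.
  rewrite (le_trans (nrD _ _))// nrN (le_trans (lerD (bp i) (bp0 i)))//.
  elim: (deg i) => [|k IH]; first by rewrite !expr1.
  rewrite exprS [rho0 ^+ _]exprS [leRHS]exprS.
  apply: le_trans (_ : (rho + rho0) * (rho ^+ k.+1 + rho0 ^+ k.+1) <= _).
    by rewrite mulrDl lerD// ler_wpM2l// ?lerDl ?lerDr ?exprn_ge0.
  by rewrite ler_wpM2l ?addr_ge0.
- move=> j m m0 [rho mrho] Gm.
  have rho_ge0 : 0 <= rho by have := le_trans (ltW (m0 0%N)) (mrho 0%N); rewrite expr1.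
  pose s := rho + j.+1%:R + rho0.
  have [N HN] := large s (addr_ge0 (addr_ge0 rho_ge0 (ler0n _ _)) rho00).
  have [K HK] := findet_seq (box n N) FC.
  (* K controls the coefficients of F below degree N and N0 controls membership in D; a cut beyond
     both leaves them unchanged. *)
  exists (maxn K N0).+1 => k kN p Dp Hp b.
  have bp : bdd s p.
    apply: bdd_add => [|i]; first by rewrite addr_ge0.
    rewrite (le_trans (Hp i))//; case: ifP => _.
      by rewrite (le_trans (mrho _))// lerXn2r ?nnegrE ?addr_ge0// lerDl.
    apply: le_trans (_ : j.+1%:R ^+ (deg i).+1 <= _).
      by rewrite exprS ler_peMl ?exprn_ge0// ler1n.
    by rewrite lerXn2r ?nnegrE ?addr_ge0// lerDr.
  have [Nb|bN] := leqP N (mdeg b); first exact: HN.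
  pose q : P := fun i => if (deg i < k)%N then p i else p0 i.
  have pq i : (deg i <= maxn K N0)%N -> p i = q i.
    by move=> ik; rewrite /q (leq_ltn_trans ik kN).
  have Dq : D q by apply: (HN0 p) => // i iN; apply: pq; rewrite leq_max iN orbT.
  rewrite (HK b (mdeg_box bN) p q)//; last first.
    by move=> i iK; apply: pq; rewrite leq_max iK.
  apply: Gm => // i; rewrite /q; case: ifP => ik; last by rewrite subrr nr0 ltW.
  by have := Hp i; rewrite ik.
(* The initial constant weight: finitely many coefficients are handled by continuity, the others by
   the uniform bound. *)
have [N HN] := large (1 + rho0) (addr_ge0 ler01 rho00).
have [K [d [d0 Hd]]] := near_seq (box n N) FC muS.
exists (Num.min d 1) => [|p Dp Hp b]; first by rewrite lt_min d0 ltr01.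
have [Nb|bN] := leqP N (mdeg b).
  apply: HN => //; apply: bdd_add => // i; rewrite expr1n (le_trans (Hp i))//.
  by rewrite ge_min lexx orbT.
apply: Hd => //; last exact: mdeg_box.
by move=> i _; rewrite (le_trans (Hp i))// ge_min lexx.
Qed.

End Tame.

Section Inverse.
Context {R : realType}.
Notation C := (Cplx R).

(* Inverses are computed as c * geom(1 - c f), so that they inherit the estimates for
   compositions. *)
Definition geom : fps R 1 := fun=> 1.

Lemma geomE : (1 - fX ord0) * geom = 1.
Proof.
apply/funext => a; rewrite mulrBl mul1r coefD coefN coef1.
have [a0|a0] := posnP (a ord0).
  rewrite (coef_monoM0 _ (i := ord0)) ?a0 ?eqxx// subr0 /geom.
  have -> : a = mi0 1 by apply/funext => i; rewrite (ord1 i) a0.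
  by rewrite eqxx.
have -> : a = madd (fun j : 'I_1 => (j == ord0) : nat) (fun=> (a ord0).-1).
  by apply/funext => i; rewrite (ord1 i) /madd eqxx add1n prednK.
rewrite coef_monoM /geom subrr; case: eqP => // /funeqP/(_ ord0).
by rewrite /madd eqxx.
Qed.

Lemma nle_geom : nle (2^-1) 2 geom.
Proof.
move=> N; apply: le_trans (sum_half 1 N).
by apply: ler_sum => a _; rewrite /geom nr1 mul1r.
Qed.

Variable n : nat.
Implicit Types f g : fps R n.

Definition finv f : fps R n := (f (mi0 n))^-1 *:
  comp geom (fun=> 1 - (f (mi0 n))^-1 *: f).

Lemma finv_g0 f : f (mi0 n) != 0 -> g0 (fun _ : 'I_1 => 1 - (f (mi0 n))^-1 *: f).
Proof. by move=> f0 i; rewrite coefD coefN coefZ coef1 eqxx mulVf// subrr. Qed.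

Lemma finvE f : f (mi0 n) != 0 -> f * finv f = 1.
Proof.
move=> f0; have gz := finv_g0 f0.
have := congr1 (fun h : fps R 1 =>
  comp h (fun _ : 'I_1 => 1 - (f (mi0 n))^-1 *: f)) geomE.
rewrite (compM _ _ gz) compD compN comp1// compX// opprB addrC subrK.
by rewrite -scalerAl scalerAr.
Qed.
End Inverse.

(** * Stability of tame maps under the operations on series *)

Section TameOps.
Context {R : realType}.
Notation C := (Cplx R).
Variables (I : Type) (deg : I -> nat).
Notation P := (I -> C).
Variables (D : set P) (p0 : P).
Hypothesis D0 : D p0.

Notation tameS := (tameS deg D p0).

Definition tame n (F : P -> fps R n) := tameC deg D p0 F /\ unif deg D F.

Lemma unif2 m n (F : P -> fps R m) (G : P -> fps R n) : unif deg D F -> unif deg D G ->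
  forall rho : R, 0 <= rho -> exists r M : R, [/\ 0 < r, r <= 1, 0 <= M &
    forall p, D p -> bdd deg rho p -> nle r M (F p) /\ nle r M (G p)].
Proof.
move=> HF HG rho rho0; have [r [M [r0 HM]]] := HF _ rho0.
have [s [K [s0 HK]]] := HG _ rho0.
exists (Num.min (Num.min r s) 1), (`|M| + `|K|); split.
- by rewrite !lt_min r0 s0 ltr01.
- by rewrite ge_min lexx orbT.
- by rewrite addr_ge0.
move=> p Dp bp; have m0 : 0 <= Num.min (Num.min r s) 1 by rewrite !le_min !ltW.
split.
  apply: nle_le (HM _ Dp bp) => //; first by rewrite !ge_min lexx.
  by rewrite (le_trans (ler_norm _))// lerDl.
apply: nle_le (HK _ Dp bp) => //; first by rewrite !ge_min lexx orbT.
by rewrite (le_trans (ler_norm _))// lerDr.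
Qed.

Lemma unif1 n (F : P -> fps R n) : unif deg D F ->
  forall rho : R, 0 <= rho -> exists r M : R, [/\ 0 < r, r <= 1, 0 <= M &
    forall p, D p -> bdd deg rho p -> nle r M (F p)].
Proof.
move=> HF rho rho0; have [r [M [r0 r1 M0 H]]] := unif2 HF HF rho0.
by exists r, M; split=> // p Dp /(H _ Dp)[].
Qed.

Lemma tame_cst n (f : fps R n) : convergent f -> tame (fun=> f).
Proof.
move=> cf; split=> [b|rho _]; first exact: tameS_cst.
by have /convergentP[r [M [r0 HM]]] := cf; exists r, M.
Qed.

Lemma tame_mono n (a : 'I_n -> nat) : tame (fun=> mono a).
Proof.
apply/tame_cst/convergentP; exists 1, (1 ^+ mdeg a); split=> //.
exact: nle_mono.
Qed.

Lemma tameD n (F G : P -> fps R n) : tame F -> tame G -> tame (fun p => F p + G p).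
Proof.
move=> [FC FU] [GC GU]; split=> [b|rho /(unif2 FU GU)[r [M [r0 _ M0 H]]]].
  exact: (tameSD (FC b) (GC b)).
by exists r, (M + M); split=> // p Dp /(H _ Dp)[? ?]; apply: nleD => //; exact: ltW.
Qed.

Lemma tameN n (F : P -> fps R n) : tame F -> tame (fun p => - F p).
Proof.
move=> [FC FU]; split=> [b|rho /(unif1 FU)[r [M [r0 _ M0 H]]]].
  exact: (tameSN (FC b)).
by exists r, M; split=> // p Dp /(H _ Dp)?; exact: nleN.
Qed.

Lemma tameM n (F G : P -> fps R n) : tame F -> tame G -> tame (fun p => F p * G p).
Proof.
move=> [FC FU] [GC GU]; split=> [b|rho /(unif2 FU GU)[r [M [r0 _ M0 H]]]].
  have bN := mdeg_box (ltnSn (mdeg b)); under eq_fun do rewrite (fpsM _ _ bN).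
  apply: tameS_sum => a _; apply: tameS_sum => c _.
  exact: (tameSM (FC a) (GC c)).
by exists r, (M * M); split=> // p Dp /(H _ Dp)[? ?]; apply: nleM => //; exact: ltW.
Qed.

Lemma tameJ n (F : P -> fps R n) : tame F -> tame (fun p => bar (F p)).
Proof.
move=> [FC FU]; split=> [b|rho /(unif1 FU)[r [M [r0 _ M0 H]]]].
  exact: (tameSJ (FC b)).
by exists r, M; split=> // p Dp /(H _ Dp)?; exact: nle_bar.
Qed.

Lemma tame_sum n J (s : seq J) (Q : pred J) (F : J -> P -> fps R n) :
  (forall j, Q j -> tame (F j)) -> tame (fun p => \sum_(j <- s | Q j) F j p).
Proof.
move=> FT; elim: s => [|j s IH].
  under eq_fun do rewrite big_nil; apply: tame_cst.
  by apply/convergentP; exists 1, 0; split=> //; exact: nle0.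
under eq_fun do rewrite big_cons.
case: (boolP (Q j)) => Qj; last exact: IH.
exact: (tameD (FT j Qj) IH).
Qed.

Lemma tame_one n : tame (fun=> (1 : fps R n)).
Proof. exact: tame_mono. Qed.

Lemma tame_prod n J (s : seq J) (Q : pred J) (F : J -> P -> fps R n) :
  (forall j, Q j -> tame (F j)) -> tame (fun p => \prod_(j <- s | Q j) F j p).
Proof.
move=> FT; elim: s => [|j s IH].
  by under eq_fun do rewrite big_nil; exact: tame_one.
under eq_fun do rewrite big_cons.
case: (boolP (Q j)) => Qj; last exact: IH.
exact: (tameM (FT j Qj) IH).
Qed.

Lemma tameX n (F : P -> fps R n) k : tame F -> tame (fun p => F p ^+ k).
Proof.
move=> FT; elim: k => [|k IH].
  by under eq_fun do rewrite expr0; exact: tame_one.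
under eq_fun do rewrite exprS; exact: (tameM FT IH).
Qed.

Lemma tameZ n phi (F : P -> fps R n) : tameS phi ->
  (forall rho : R, 0 <= rho -> exists K : R, forall p, D p -> bdd deg rho p ->
     nr (phi p) <= K) ->
  tame F -> tame (fun p => phi p *: F p).
Proof.
move=> phiS phiU [FC FU]; split=> [b|rho rho0].
  exact: (tameSM phiS (FC b)).
have [r [M [r0 _ M0 H]]] := unif1 FU rho0; have [K HK] := phiU _ rho0.
exists r, (K * M); split=> // p Dp bp.
apply: nle_le (nleZ (phi p) (H _ Dp bp)) => //; first exact: ltW.
by rewrite ler_wpM2r// HK.
Qed.

Lemma unif_fin m n (G : 'I_m -> P -> fps R n) : (forall i, unif deg D (G i)) ->
  forall rho : R, 0 <= rho -> exists r M : R, [/\ 0 < r, r <= 1, 0 <= M &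
    forall i p, D p -> bdd deg rho p -> nle r M (G i p)].
Proof.
move=> GU rho rho0.
have /choice[rM HrM] (i : 'I_m) : exists rM : R * R, [/\ 0 < rM.1, rM.1 <= 1, 0 <= rM.2 &
    forall p, D p -> bdd deg rho p -> nle rM.1 rM.2 (G i p)].
  by have [r [M ?]] := unif1 (GU i) rho0; exists (r, M).
pose S := 1 + \sum_i (rM i).1^-1.
have ri i : 0 < (rM i).1^-1 by rewrite invr_gt0; have [] := HrM i.
have S0 : 0 <= \sum_i (rM i).1^-1 by apply: sumr_ge0 => i _; exact: ltW.
have M0 i : 0 <= (rM i).2 by have [] := HrM i.
exists S^-1, (\sum_i (rM i).2); split.
- by rewrite invr_gt0 ltr_wpDr.
- by rewrite invf_le1 ?lerDl ?ltr_wpDr.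
- exact: sumr_ge0.
move=> i p Dp bp; have [r0 r1 _ H] := HrM i.
apply: nle_le (H _ Dp bp).
- by rewrite invr_ge0 addr_ge0.
- rewrite -[leRHS]invrK lef_pV2 ?posrE// ?ltr_wpDr// /S (bigD1 i)//=.
  by rewrite addrCA lerDl addr_ge0 ?sumr_ge0// => j _; exact: ltW.
- by rewrite (bigD1 i)//= lerDl sumr_ge0.
Qed.

Lemma tame_comp m n (F : P -> fps R m) (G : 'I_m -> P -> fps R n) : tame F ->
  (forall i, tame (G i)) -> (forall p i, D p -> G i p (mi0 n) = 0) ->
  tame (fun p => comp (F p) (fun i => G i p)).
Proof.
move=> [FC FU] GT Gz; split=> [b|rho rho0].
  apply: tameS_sum => a _; apply: (tameSM (FC a)).
  have : tame (fun p => gpow (fun i => G i p) a).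
    by apply: tame_prod => i _; apply: tameX.
  by case=> + _; exact.
have [s [M [s0 _ M0 H]]] := unif1 FU rho0.
have [r [K [r0 _ K0 HK]]] := unif_fin (fun i => (GT i).2) rho0.
(* The inner series have no constant term, so shrinking the radius by t brings their norm from K to
   t K <= s, where F is bounded. *)
pose t := s / (s + K).
have sK : 0 < s + K by rewrite ltr_wpDr.
have t0 : 0 < t by rewrite divr_gt0.
have t1 : t <= 1 by rewrite ler_pdivrMr// mul1r lerDl.
exists (t * r), M; split; first exact: mulr_gt0.
move=> p Dp bp; apply: (@nle_comp R m n (t * r) s).
- by rewrite ltW// mulr_gt0.
- exact: ltW.
- by move=> i; exact: Gz.
- move=> i; apply: (nle_le _ (lexx _) _ (nle_shrink (Gz p i Dp) (ltW r0) _ (HK i p Dp bp))).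
  + by rewrite ltW// mulr_gt0.
  + by rewrite /t mulrAC ler_pdivrMr// ler_wpM2l ?lerDr// ltW.
  + by rewrite ltW.
- exact: H.
Qed.

(** Slicing, division by a monomial and the passage from Psi to K are of this form: the index grows
    at most linearly, which costs a power of the radius. *)
Lemma tame_reindex m n (F : P -> fps R n) (sg : ('I_m -> nat) -> ('I_n -> nat)) (c : nat) :
  (forall b, (mdeg (sg b) <= c * (mdeg b).+1)%N) -> tame F ->
  tame (fun p => (fun b => F p (sg b)) : fps R m).
Proof.
move=> sc [FC FU]; split=> [b|rho rho0]; first exact: FC.
have [r [M [r0 r1 M0 H]]] := unif1 FU rho0.
have rc : 0 < r ^+ c by rewrite exprn_gt0.
exists (r ^+ c / 2), (2 ^+ m * (M / r ^+ c)); split; first by rewrite divr_gt0.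
move=> p Dp bp; apply: nle_of_coef => [||b]; first exact: ltW.
  by rewrite divr_ge0// ltW.
rewrite ler_pdivlMr// -mulrA -exprSr -exprM.
apply: le_trans (nle_coef (sg b) (ltW r0) (H p Dp bp)).
by rewrite ler_wpM2l ?nr_ge0// ler_wiXn2l// ltW.
Qed.

Lemma tame_scalecoef n (F : P -> fps R n) (la : ('I_n -> nat) -> C) :
  (forall b, nr (la b) <= 2 ^+ mdeg b) -> tame F ->
  tame (fun p => (fun b => la b * F p b) : fps R n).
Proof.
move=> lb [FC FU]; split=> [b|rho rho0].
  exact: (tameSM (tameS_cst _ _ _ (la b)) (FC b)).
have [r [M [r0 r1 M0 H]]] := unif1 FU rho0.
exists (r / 2 / 2), (2 ^+ n * M); split; first by rewrite !divr_gt0.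
move=> p Dp bp; apply: nle_of_coef => // [|b]; first by rewrite divr_ge0// ltW.
apply: le_trans (nle_coef b (ltW r0) (H p Dp bp)).
rewrite nrM mulrAC mulrC ler_wpM2l ?nr_ge0// expr_div_n mulrCA ler_piMr ?exprn_ge0//.
  exact: ltW.
by rewrite ler_pdivrMr ?exprn_gt0// mul1r.
Qed.

(** Lagrange's formula takes the coefficient b of a product whose exponent depends on b, which is no
    ring operation. As the exponent is at most |b| + 1, the norm of G only shrinks the radius. *)
Lemma tame_diag n (F G : P -> fps R n) (e : ('I_n -> nat) -> nat) :
  (forall b, (e b <= (mdeg b).+1)%N) -> tame F -> tame G ->
  tame (fun p => (fun b => (F p * G p ^+ e b) b) : fps R n).
Proof.
move=> eb FT GT; split=> [b|rho rho0].
  by have [+ _] := tameM FT (tameX (e b) GT); exact.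
have [r [M [r0 r1 M0 H]]] := unif2 FT.2 GT.2 rho0.
pose V := M + 1; have V1 : 1 <= V by rewrite lerDr.
have V0 : 0 < V by apply: lt_le_trans V1.
exists (r / V / 2), (2 ^+ n * (M * V)); split; first by rewrite !divr_gt0.
move=> p Dp bp; apply: nle_of_coef => [||b].
- by rewrite divr_ge0// ltW.
- by rewrite mulr_ge0// ltW.
have [HF HG] := H p Dp bp.
have HGV : nle r V (G p) by apply: nle_le HG => //; rewrite ?lerDl// ltW.
have := nle_coef b (ltW r0) (nleM (ltW r0) HF (nleX (e b) (ltW r0) HGV)).
move=> Hb; rewrite expr_div_n mulrA ler_pdivrMr ?exprn_gt0// (le_trans Hb)//.
by rewrite -mulrA ler_wpM2l// -exprS ler_weXn2l.
Qed.

(** The common lower bound d keeps the inverses bounded on bounded sets; pointwise nonvanishing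
    would not suffice. *)
Lemma tame_finv n (F : P -> fps R n) (d : R) : 0 < d ->
  (forall p, D p -> d <= nr (F p (mi0 n))) -> tame F -> tame (fun p => finv (F p)).
Proof.
move=> d0 Fd FT.
have F0 p : D p -> F p (mi0 n) != 0.
  by move=> /Fd; rewrite -nr_eq0; apply: contraTneq => ->; rewrite leNgt d0.
have iS : tameS (fun p => (F p (mi0 n))^-1) := tameSV (F0 _ D0) (FT.1 _).
have iU (rho : R) : 0 <= rho -> exists K : R, forall p, D p -> bdd deg rho p ->
    nr (F p (mi0 n))^-1 <= K.
  move=> _; exists d^-1 => p Dp _; rewrite nrV lef_pV2 ?posrE// ?Fd//.
  exact: lt_le_trans (Fd _ Dp).
apply: (tameZ iS iU).
apply: (tame_comp (F := fun=> geom) (G := fun _ p => 1 - (F p (mi0 n))^-1 *: F p)).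
- apply/tame_cst/convergentP; exists 2^-1, 2; split; first by rewrite invr_gt0.
  exact: nle_geom.
- by move=> i; apply: tameD; [exact: tame_one|exact: (tameN (tameZ iS iU FT))].
- by move=> p i Dp; apply: (finv_g0 (F0 _ Dp) i).
Qed.
End TameOps.

(** * The reflection operators *)

Section Substitutions.
Context {R : realType}.
Notation C := (Cplx R).

Definition trunc n N (f : fps R n) : fps R n := \sum_(a <- box n N) f a *: mono a.

Lemma coef_trunc n N (f : fps R n) b :
  trunc N f b = if b \in box n N then f b else 0.
Proof.
rewrite /trunc coef_sum; case: ifPn => bN.
  rewrite (bigD1_seq b) ?box_uniq//= coefZ /mono eqxx mulr1 big1 ?addr0// => a ab.
  by rewrite coefZ /mono eq_sym (negPf ab) mulr0.
rewrite big1_seq// => a /= aN; rewrite coefZ /mono; case: eqP => [ba|]; rewrite ?mulr0//.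
by rewrite ba aN in bN.
Qed.

Lemma ord_trunc n N (f : fps R n) : ordw (fun=> 1%N) N (f - trunc N f).
Proof. by move=> a; rewrite wdeg1 coefD coefN coef_trunc => /mdeg_box ->; rewrite subrr. Qed.

(* An identity between additive operators that respect the order of vanishing
   holds as soon as it holds on scalar multiples of monomials. *)
Lemma fps_ind n m (L1 L2 : fps R n -> fps R m) :
  (forall f g, L1 (f + g) = L1 f + L1 g) -> (forall f g, L2 (f + g) = L2 f + L2 g) ->
  (forall b, exists N, forall f, ordw (fun=> 1%N) N f -> L1 f b = 0 /\ L2 f b = 0) ->
  (forall c a, L1 (c *: mono a) = L2 (c *: mono a)) -> L1 =1 L2.
Proof.
move=> A1 A2 cont E f; apply/funext => b; have [N HN] := cont b.
have [z1 z2] := HN _ (@ord_trunc _ N f).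
have Z (L : fps R n -> fps R m) : (forall f g, L (f + g) = L f + L g) -> L 0 = 0.
  by move=> A; apply: (addrI (L 0)); rewrite -A !addr0.
have -> : f = (f - trunc N f) + trunc N f by rewrite subrK.
rewrite A1 A2 !coefD z1 z2; congr (_ + _).
rewrite /trunc (big_morph L1 A1 (Z _ A1)) (big_morph L2 A2 (Z _ A2)).
by congr (_ b); apply: eq_bigr => a _; exact: E.
Qed.

Lemma comp_ord m n (f : fps R m) (g : 'I_m -> fps R n) N b : g0 g ->
  ordw (fun=> 1%N) N f -> (mdeg b < N)%N -> comp f g b = 0.
Proof.
move=> gz fN bN; apply: (ordw_comp (w := fun=> 1%N) (v := fun=> 1%N)) fN _ _.
  by move=> i c; rewrite wdeg1 ltnS leqn0 => /eqP/mdeg_eq0 ->.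
by rewrite wdeg1.
Qed.

Definition kill n (i : 'I_n) : 'I_n -> fps R n := fun j => if j == i then 0 else fX j.

Lemma kill0 n (i : 'I_n) : g0 (kill i).
Proof.
move=> j; rewrite /kill; case: ifP => // _; rewrite /fX /mono.
case: eqP => // /funeqP/(_ j); by rewrite eqxx.
Qed.

Lemma comp_kill n (i : 'I_n) (f : fps R n) b :
  comp f (kill i) b = if b i == 0%N then f b else 0.
Proof.
have gE a : gpow (kill i) a = if a i == 0%N then mono a else 0.
  case: ifPn => ai.
    rewrite -prod_fX /gpow; apply: eq_bigr => j _; rewrite /kill.
    by case: eqP => // ->; rewrite (eqP ai) !expr0.
  by rewrite /gpow (bigD1 i)//= {1}/kill eqxx expr0n (negPf ai) mul0r.
rewrite /comp; case: ifPn => bi.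
  rewrite (bigD1_seq b) ?box_uniq ?mdeg_box//= gE bi /mono eqxx mulr1 big1 ?addr0//.
  move=> a ab; rewrite gE; case: ifP => _; last by rewrite coef_0 mulr0.
  by rewrite /mono eq_sym (negPf ab) mulr0.
rewrite big1// => a _; rewrite gE; case: ifP => ai; last by rewrite coef_0 mulr0.
rewrite /mono; case: eqP => [ba|]; rewrite ?mulr0//.
by rewrite ba ai in bi.
Qed.

Definition s2 n (a b : fps R n) : 'I_2 -> fps R n := fun i => nth 0 [:: a; b] i.
Definition s3 n (a b c : fps R n) : 'I_3 -> fps R n := fun i => nth 0 [:: a; b; c] i.
Definition s33 n (F G : 'I_3 -> fps R n) : 'I_(3 + 3) -> fps R n := fun i =>
  match fintype.split i with inl j => F j | inr j => G j end.

Definition z0 n (f : fps R n) := f (mi0 n) = 0.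

Lemma s2_0 n (a b : fps R n) : z0 a -> z0 b -> g0 (s2 a b).
Proof. by move=> a0 b0 [[|[|i]] lti]. Qed.
Lemma s3_0 n (a b c : fps R n) : z0 a -> z0 b -> z0 c -> g0 (s3 a b c).
Proof. by move=> a0 b0 c0 [[|[|[|i]]] lti]. Qed.
Lemma s33_0 n (F G : 'I_3 -> fps R n) : (forall k, z0 (F k)) -> (forall k, z0 (G k)) ->
  g0 (s33 F G).
Proof. by move=> F0 G0 i; rewrite /s33; case: splitP => j _; [exact: F0|exact: G0]. Qed.

Lemma comp_s2 m n (f : fps R 2) (a b : fps R m) (g : 'I_m -> fps R n) : z0 a -> z0 b ->
  g0 g -> comp (comp f (s2 a b)) g = comp f (s2 (comp a g) (comp b g)).
Proof.
move=> a0 b0 gz; rewrite compA//; last exact: s2_0.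
by apply: eq_comp => -[[|[|i]] lti].
Qed.
Lemma comp_s3 m n (f : fps R 3) (a b c : fps R m) (g : 'I_m -> fps R n) : z0 a -> z0 b ->
  z0 c -> g0 g -> comp (comp f (s3 a b c)) g = comp f (s3 (comp a g) (comp b g) (comp c g)).
Proof.
move=> a0 b0 c0 gz; rewrite compA//; last exact: s3_0.
by apply: eq_comp => -[[|[|[|i]]] lti].
Qed.
Lemma comp_s33 m n (f : fps R (3 + 3)) (F G : 'I_3 -> fps R m) (g : 'I_m -> fps R n) :
  (forall k, z0 (F k)) -> (forall k, z0 (G k)) -> g0 g ->
  comp (comp f (s33 F G)) g =
  comp f (s33 (fun k => comp (F k) g) (fun k => comp (G k) g)).
Proof.
move=> F0 G0 gz; rewrite compA//; last exact: s33_0.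
by apply: eq_comp => i; rewrite /s33; case: splitP.
Qed.

Definition o20 : 'I_2 := Ordinal (isT : 0 < 2)%N.
Definition o21 : 'I_2 := Ordinal (isT : 1 < 2)%N.
Definition o30 : 'I_3 := Ordinal (isT : 0 < 3)%N.
Definition o31 : 'I_3 := Ordinal (isT : 1 < 3)%N.
Definition o32 : 'I_3 := Ordinal (isT : 2 < 3)%N.
Definition y0 : fps R 2 := fX o20.
Definition y1 : fps R 2 := fX o21.
Definition x0 : fps R 3 := fX o30.
Definition x1 : fps R 3 := fX o31.
Definition x2 : fps R 3 := fX o32.

Lemma fX0 n (i : 'I_n) : z0 (fX i : fps R n).
Proof. by rewrite /z0 /fX /mono; case: eqP => // /funeqP/(_ i); rewrite eqxx. Qed.
Lemma x00 : z0 x0. Proof. exact: fX0. Qed.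
Lemma x10 : z0 x1. Proof. exact: fX0. Qed.
Lemma x20 : z0 x2. Proof. exact: fX0. Qed.
Lemma y00 : z0 y0. Proof. exact: fX0. Qed.
Lemma y10 : z0 y1. Proof. exact: fX0. Qed.
Lemma z00 n : z0 (0 : fps R n). Proof. by []. Qed.
Lemma z0D n (f g : fps R n) : z0 f -> z0 g -> z0 (f + g).
Proof. by rewrite /z0 coefD => -> ->; rewrite addr0. Qed.
Lemma z0_comp m n (f : fps R m) (g : 'I_m -> fps R n) : g0 g -> z0 f -> z0 (comp f g).
Proof. by move=> gz f0; rewrite /z0 comp_coef0. Qed.
Lemma z0_bar n (f : fps R n) : z0 f -> z0 (bar f).
Proof. by rewrite /z0 /bar => ->; rewrite rmorph0. Qed.
Lemma coef0M n (f g : fps R n) : (f * g) (mi0 n) = f (mi0 n) * g (mi0 n).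
Proof.
have c0 : mi0 n \in box n 1 by rewrite mdeg_box ?mdeg0.
have b1 : box n 1 = [:: mi0 n].
  apply: perm_small_eq => //; apply: uniq_perm; rewrite ?box_uniq// => a.
  rewrite inE; apply/boxP/eqP => [a1|->//]; apply/funext => i.
  by have := a1 i; rewrite ltnS leqn0 => /eqP.
rewrite (fpsM _ _ c0) b1 big_seq1 big_cons big_nil madd0 eqxx addr0//.
Qed.

Lemma comp_y0 n (a b : fps R n) : z0 a -> z0 b -> comp y0 (s2 a b) = a.
Proof. by move=> a0 b0; rewrite compX//; exact: s2_0. Qed.
Lemma comp_y1 n (a b : fps R n) : z0 a -> z0 b -> comp y1 (s2 a b) = b.
Proof. by move=> a0 b0; rewrite compX//; exact: s2_0. Qed.
Lemma comp_x0 n (a b c : fps R n) : z0 a -> z0 b -> z0 c -> comp x0 (s3 a b c) = a.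
Proof. by move=> a0 b0 c0; rewrite compX//; exact: s3_0. Qed.
Lemma comp_x1 n (a b c : fps R n) : z0 a -> z0 b -> z0 c -> comp x1 (s3 a b c) = b.
Proof. by move=> a0 b0 c0; rewrite compX//; exact: s3_0. Qed.
Lemma comp_x2 n (a b c : fps R n) : z0 a -> z0 b -> z0 c -> comp x2 (s3 a b c) = c.
Proof. by move=> a0 b0 c0; rewrite compX//; exact: s3_0. Qed.

Lemma s3_id : s3 x0 x1 x2 = fX (n := 3).
Proof. by apply/funext => -[[|[|[|i]]] lti] //=; congr fX; apply/val_inj. Qed.

Definition m2 (i j : nat) : 'I_2 -> nat := fun k => nth 0%N [:: i; j] k.
Definition m3 (i j l : nat) : 'I_3 -> nat := fun k => nth 0%N [:: i; j; l] k.

Lemma m2E (b : 'I_2 -> nat) : b = m2 (b o20) (b o21).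
Proof. by apply/funext => -[[|[|i]] lti] //=; congr b; apply/val_inj. Qed.
Lemma m3E (b : 'I_3 -> nat) : b = m3 (b o30) (b o31) (b o32).
Proof. by apply/funext => -[[|[|[|i]]] lti] //=; congr b; apply/val_inj. Qed.
Lemma mdeg_m2 i j : mdeg (m2 i j) = (i + j)%N.
Proof. by rewrite /mdeg !big_ord_recl big_ord0 /m2 /= addn0. Qed.
Lemma mdeg_m3 i j l : mdeg (m3 i j l) = (i + j + l)%N.
Proof. by rewrite /mdeg !big_ord_recl big_ord0 /m3 /= addn0 addnA. Qed.
Lemma wdeg_m2 a b i j : wdeg (m2 a b) (m2 i j) = (a * i + b * j)%N.
Proof. by rewrite /wdeg !big_ord_recl big_ord0 /m2 /= addn0. Qed.
Lemma wdeg_m3 a b c i j l : wdeg (m3 a b c) (m3 i j l) = (a * i + b * j + c * l)%N.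
Proof. by rewrite /wdeg !big_ord_recl big_ord0 /m3 /= addn0 addnA. Qed.
Lemma madd_m2 i j k l : madd (m2 i j) (m2 k l) = m2 (i + k) (j + l).
Proof. by apply/funext => -[[|[|q]] lti]. Qed.
Lemma madd_m3 i j k a b c : madd (m3 i j k) (m3 a b c) = m3 (i + a) (j + b) (k + c).
Proof. by apply/funext => -[[|[|[|q]]] lti]. Qed.
Lemma m2_inj i j k l : (m2 i j == m2 k l) = (i == k) && (j == l).
Proof.
apply/eqP/andP => [/funeqP H|[/eqP -> /eqP ->]//].
by rewrite (H o20 : i = k) (H o21 : j = l).
Qed.

Lemma y0E : y0 = mono (m2 1 0).
Proof. by congr mono; apply/funext => -[[|[|i]] lti]. Qed.
Lemma y1E : y1 = mono (m2 0 1).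
Proof. by congr mono; apply/funext => -[[|[|i]] lti]. Qed.
Lemma x0E : x0 = mono (m3 1 0 0).
Proof. by congr mono; apply/funext => -[[|[|[|i]]] lti]. Qed.
Lemma x1E : x1 = mono (m3 0 1 0).
Proof. by congr mono; apply/funext => -[[|[|[|i]]] lti]. Qed.
Lemma x2E : x2 = mono (m3 0 0 1).
Proof. by congr mono; apply/funext => -[[|[|[|i]]] lti]. Qed.

Lemma gpow_s2 n (a b : fps R n) i j : gpow (s2 a b) (m2 i j) = a ^+ i * b ^+ j.
Proof. by rewrite /gpow !big_ord_recl big_ord0 /s2 /m2 /= mulr1. Qed.
Lemma gpow_s3 n (a b c : fps R n) i j k :
  gpow (s3 a b c) (m3 i j k) = a ^+ i * b ^+ j * c ^+ k.
Proof. by rewrite /gpow !big_ord_recl big_ord0 /s3 /m3 /= mulr1 mulrA. Qed.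

End Substitutions.

(** * Linear systems along Segre curves *)

Section Reflection.
Context {R : realType}.
Notation C := (Cplx R).

(* The coefficient of s^i, where s is the third variable. *)
Definition slice i (f : fps R 3) : fps R 2 := fun b => f (m3 (b o20) (b o21) i).

Lemma sliceD i f g : slice i (f + g) = slice i f + slice i g. Proof. by []. Qed.
Lemma sliceZ i c f : slice i (c *: f) = c *: slice i f. Proof. by []. Qed.
Lemma slice0 i : slice i 0 = 0. Proof. by []. Qed.
Lemma slice_sum i I (s : seq I) (P : pred I) (F : I -> fps R 3) :
  slice i (\sum_(j <- s | P j) F j) = \sum_(j <- s | P j) slice i (F j).
Proof. exact: (big_morph (slice i) (sliceD i) (slice0 i)). Qed.

Lemma ord_slice i f w0 w1 w2 k : ordw (m3 w0 w1 w2) k f ->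
  ordw (m2 w0 w1) (k - w2 * i) (slice i f).
Proof.
move=> fk b; rewrite {1}(m2E b) wdeg_m2 ltn_subRL => bk.
by apply: fk; rewrite wdeg_m3 addnC.
Qed.

Lemma w1_3 : (fun=> 1%N) = m3 1 1 1.
Proof. by apply/funext => -[[|[|[|i]]] lti]. Qed.
Lemma w1_2 : (fun=> 1%N) = m2 1 1.
Proof. by apply/funext => -[[|[|i]] lti]. Qed.

(** Slicing is linear over series in the first two variables; unknowns that do not involve s can
    therefore be pulled out of the equations. *)
Lemma slice_lift i (g : fps R 2) (f : fps R 3) :
  slice i (comp g (s2 x0 x1) * f) = g * slice i f.
Proof.
have gz : g0 (s2 (@x0 R) x1) by apply: s2_0; [exact: x00|exact: x10].
have gv j : ordw (fun=> 1%N) 1 (s2 (@x0 R) x1 j).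
  by move=> c; rewrite wdeg1 ltnS leqn0 => /eqP/mdeg_eq0 ->.
apply: (fps_ind (L1 := fun g => slice i (comp g (s2 x0 x1) * f)) (L2 := fun g => g * slice i f)).
- by move=> a b; rewrite compD mulrDl sliceD.
- by move=> a b; rewrite mulrDl.
- move=> b; exists (mdeg b + i).+1 => h hN; split.
    have hc := ordwMr f (ordw_comp (v := fun=> 1%N) gv hN).
    rewrite w1_3 in hc; have := ord_slice (i := i) hc; apply.
    by rewrite -w1_2 wdeg1 mul1n; lia.
  have hc := ordwMr (slice i f) hN; apply: hc.
  by rewrite wdeg1 ltnS leq_addr.
move=> c a; apply/funext => b; rewrite compZ comp_mono// (m2E a) gpow_s2.
rewrite -!scalerAl sliceZ !coefZ; congr (_ * _).
rewrite x0E x1E !monoX monoM /slice.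
set e := madd _ _; have -> : e = m3 (a o20) (a o21) 0.
  by rewrite /e; apply/funext => -[[|[|[|j]]] ltj] //=; rewrite /madd /m3 /=; lia.
have [ab0|ab0] := leqP (a o20) (b o20); last first.
  by rewrite (coef_monoM0 _ (i := o30)) ?(coef_monoM0 _ (i := o20)).
have [ab1|ab1] := leqP (a o21) (b o21); last first.
  by rewrite (coef_monoM0 _ (i := o31)) ?(coef_monoM0 _ (i := o21)).
rewrite [in RHS](m2E b) -{1}(subnKC ab0) -{1}(subnKC ab1) -[in LHS](add0n i).
rewrite -[in RHS](subnKC ab0) -[in RHS](subnKC ab1) -madd_m3 -madd_m2.
by rewrite !coef_monoM.
Qed.

Section Solve.
Variables (M N : 'I_3 -> 'I_3 -> fps R 3) (iota : 'I_3 -> nat).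

(** Taylor coefficients in s stand for derivatives: row k differs by the factor iota_k!, which does
    not affect invertibility. *)
Definition Amx : 'M[fps R 2]_3 := \matrix_(k, j) slice (iota k) (M k j).
Definition rhs (ga : 'I_3 -> fps R 3) k : fps R 2 :=
  - slice (iota k) (\sum_j N k j * ga j).
(** Cramer's rule. As an explicit formula it is linear in ga and passes on orders of vanishing and
    estimates. *)
Definition solve (ga : 'I_3 -> fps R 3) l : fps R 2 :=
  finv (\det Amx) * \sum_k \adj Amx l k * rhs ga k.

Lemma solveP (al : 'I_3 -> fps R 2) ga : (\det Amx) (mi0 2) != 0 ->
  (forall k, \sum_j (M k j * comp (al j) (s2 x0 x1) + N k j * ga j) = 0) ->
  al = solve ga.
Proof.
move=> d0 H.
have E k : \sum_j Amx k j * al j = rhs ga k.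
  have := congr1 (slice (iota k)) (H k); rewrite big_split sliceD slice0 /=.
  rewrite /rhs => /eqP; rewrite addr_eq0 => /eqP <-; rewrite slice_sum.
  by apply: eq_bigr => j _; rewrite mxE mulrC -slice_lift mulrC.
have E' : Amx *m (\col_j al j) = \col_k rhs ga k.
  apply/colP => k; rewrite [RHS]mxE -E [LHS]mxE; apply: eq_bigr => j _.
  by rewrite [X in _ * X]mxE.
apply/funext => l; rewrite /solve.
have := congr1 (fun v : 'cV_3 => v l 0) (congr1 (mulmx (\adj Amx)) E').
rewrite mulmxA mul_adj_mx mul_scalar_mx !mxE.
have -> : \sum_j \adj Amx l j * (\col_k rhs ga k) j 0 = \sum_k \adj Amx l k * rhs ga k.
  by apply: eq_bigr => k _; rewrite mxE.
by move=> <-; rewrite mulrA [finv _ * _]mulrC finvE// mul1r.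
Qed.

Lemma solveD a b l : solve (fun j => a j + b j) l = solve a l + solve b l.
Proof.
rewrite /solve -mulrDr -big_split; congr (_ * _); apply: eq_bigr => k _ /=.
rewrite -mulrDr; congr (_ * _); rewrite /rhs -opprD -sliceD -big_split.
by congr (- slice _ _); apply: eq_bigr => j _; rewrite mulrDr.
Qed.

Lemma solveZ c a l : solve (fun j => c *: a j) l = c *: solve a l.
Proof.
rewrite /solve scalerAr scaler_sumr; congr (_ * _); apply: eq_bigr => k _.
rewrite scalerAr; congr (_ * _); rewrite /rhs scalerN -sliceZ scaler_sumr.
by congr (- slice _ _); apply: eq_bigr => j _; rewrite scalerAr.
Qed.

(** Multiplication does not lower the order, and reading off the coefficient of s^i costs w2 * i,
    where i <= 2. *)
Lemma ord_solve w0 w1 w2 k ga : (forall j, iota j <= 2)%N ->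
  (forall j, ordw (m3 w0 w1 w2) k (ga j)) ->
  forall l, ordw (m2 w0 w1) (k - w2 * 2) (solve ga l).
Proof.
move=> i2 gk l; apply/ordwMl/ordw_sum => j _; apply/ordwMl/ordwN.
apply: (@ordw_le _ _ _ _ (k - w2 * iota j)).
  by rewrite leq_sub2l// leq_mul2l i2 orbT.
by apply/ord_slice/ordw_sum => i _; exact: ordwMl.
Qed.
End Solve.

Section Operators.
Variables (r : 'I_3 -> 'I_3 -> fps R (3 + 3)) (iota : 'I_3 -> nat).
Variables (H : 'I_3 -> fps R 2) (Q : fps R 3).

Definition Hof n (Z W : fps R n) k := comp (H k) (s2 Z W).
Definition Hbof n (X T : fps R n) k := comp (bar (H k)) (s2 X T).
Definition cof n (rho : fps R (3 + 3)) (Z W X T : fps R n) :=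
  comp rho (s33 (Hof Z W) (Hbof X T)).
Definition cobar n (rho : fps R (3 + 3)) (Z W X T : fps R n) :=
  comp (bar rho) (s33 (Hbof X T) (Hof Z W)).

(* The left side of (star) along the germ (z, w, chi, tau) = (Z, W, X, T). *)
Definition Eq n (rho : 'I_3 -> fps R (3 + 3)) (al : 'I_3 -> fps R 2) (Z W X T : fps R n) :=
  \sum_j (cof (rho j) Z W X T * comp (al j) (s2 Z W) +
          cobar (rho j) Z W X T * comp (bar (al j)) (s2 X T)).

(* S1 differentiates (star) along s at z = x0, w = Q(z, chi, 0), with
   (chi + s, T0) in place of (chi, tau); S2 does so along z = s = x2,
   w = W0 = Q(s, chi, tau), with (chi, tau) = (x0, x1). A solution alpha satisfies
   alpha(z, Q(z, chi, 0)) = S1 (S2 alpha), and S1 \o S2 kills what vanishes to order 5. *)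
Definition Q0 : fps R 3 := comp Q (s3 x0 x1 0).
Definition T0 : fps R 3 := comp (bar Q) (s3 (x1 + x2) x0 Q0).
Definition W0 : fps R 3 := comp Q (s3 x2 x0 x1).

Definition M1 k j : fps R 3 := cof (r k j) x0 Q0 (x1 + x2) T0.
Definition N1 k j : fps R 3 := cobar (r k j) x0 Q0 (x1 + x2) T0.
Definition M2 k j : fps R 3 := cobar (r k j) x2 W0 x0 x1.
Definition N2 k j : fps R 3 := cof (r k j) x2 W0 x0 x1.
Definition S1 (be : 'I_3 -> fps R 2) :=
  solve M1 N1 iota (fun j => comp (be j) (s2 (x1 + x2) T0)).
Definition S2 (ga : 'I_3 -> fps R 2) :=
  solve M2 N2 iota (fun j => comp (ga j) (s2 x2 W0)).
Definition det1 := \det (Amx M1 iota).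
Definition det2 := \det (Amx M2 iota).

Definition q0 : fps R 2 := comp Q (s3 y0 y1 0).

Hypothesis H0 : forall k, z0 (H k).
Hypothesis Qz : z0 Q.

Lemma Hof0 n (Z W : fps R n) k : z0 Z -> z0 W -> z0 (Hof Z W k).
Proof. by move=> Z0 W0'; apply: z0_comp => //; exact: s2_0. Qed.
Lemma Hbof0 n (X T : fps R n) k : z0 X -> z0 T -> z0 (Hbof X T k).
Proof. by move=> Z0 W0'; apply: z0_comp; [exact: s2_0|exact: z0_bar]. Qed.

Lemma Eq_comp m n rho al (Z W X T : fps R m) (g : 'I_m -> fps R n) :
  z0 Z -> z0 W -> z0 X -> z0 T -> g0 g ->
  comp (Eq rho al Z W X T) g =
  Eq rho al (comp Z g) (comp W g) (comp X g) (comp T g).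
Proof.
move=> Zz Wz Xz Tz gz; rewrite /Eq comp_sum; apply: eq_bigr => j _.
have hz k : z0 (Hof Z W k) := Hof0 k Zz Wz.
have hb k : z0 (Hbof X T k) := Hbof0 k Xz Tz.
rewrite compD !(compM _ _ gz) /cof /cobar (comp_s33 _ hz hb gz) (comp_s33 _ hb hz gz).
rewrite !comp_s2//.
have E1 : (fun k => comp (Hof Z W k) g) = Hof (comp Z g) (comp W g).
  by apply/funext => k; rewrite /Hof comp_s2.
have E2 : (fun k => comp (Hbof X T k) g) = Hbof (comp X g) (comp T g).
  by apply/funext => k; rewrite /Hbof comp_s2.
by rewrite E1 E2.
Qed.

Lemma Q00 : z0 Q0.
Proof. by apply: z0_comp => //; apply: s3_0; [exact: x00|exact: x10|exact: z00]. Qed.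
Lemma x120 : z0 (@x1 R + x2). Proof. by apply: z0D; [exact: x10|exact: x20]. Qed.
Lemma T00 : z0 T0.
Proof.
apply: z0_comp; last exact: z0_bar.
by apply: s3_0; [exact: x120|exact: x00|exact: Q00].
Qed.
Lemma W00 : z0 W0.
Proof. by apply: z0_comp => //; apply: s3_0; [exact: x20|exact: x00|exact: x10]. Qed.

Lemma Phi_ZD (a b : 'I_3 -> fps R 2) (c : C) l :
  S1 (S2 (fun j => c *: a j + b j)) l = c *: S1 (S2 a) l + S1 (S2 b) l.
Proof.
have E : S2 (fun j => c *: a j + b j) = fun l => c *: S2 a l + S2 b l.
  apply/funext => i; rewrite /S2 -solveZ -solveD; congr (solve _ _ _ _ _).
  by apply/funext => j; rewrite compD compZ.
rewrite E /S1 -solveZ -solveD; congr (solve _ _ _ _ _).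
by apply/funext => j; rewrite compD compZ.
Qed.

Hypothesis n2 : forall b c, Q (m3 0 b c) = ((b == 0%N) && (c == 1%N))%:R.
Hypothesis n3 : comp Q (s3 x0 x1 (comp (bar Q) (s3 x1 x0 x2))) = x2.

(** This is the conjugate of [n3] with z and chi exchanged. *)
Lemma n3b : comp (bar Q) (s3 x1 x0 Q) = x2.
Proof.
have b1 : z0 (comp (bar Q) (s3 x1 x0 x2)).
  apply: z0_comp; last exact: z0_bar.
  by apply: s3_0; [exact: x10|exact: x00|exact: x20].
have := congr1 (@bar R 3) n3; rewrite bar_comp.
have -> : (fun i => bar (s3 x0 x1 (comp (bar Q) (s3 x1 x0 x2)) i)) =
    s3 x0 x1 (comp Q (s3 x1 x0 x2)).
  apply/funext => -[[|[|[|i]]] lti] //=; rewrite /s3 /= ?bar_mono//.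
  rewrite bar_comp barK; apply: eq_comp => -[[|[|[|j]]] ltj] //=; exact: bar_mono.
rewrite /x2 [in RHS]bar_mono -/x2 => E.
have g1 : g0 (s3 x1 x0 (@x2 R)) by apply: s3_0; [exact: x10|exact: x00|exact: x20].
have cz : z0 (comp Q (s3 x1 x0 x2)) by apply: z0_comp.
have := congr1 (fun f => comp f (s3 x1 x0 x2)) E.
rewrite (comp_s3 _ x00 x10 cz g1) (comp_s3 _ x10 x00 x20 g1).
have c0 := comp_x0 x10 x00 (@x20 R); have c1 := comp_x1 x10 x00 (@x20 R).
have c2 := comp_x2 x10 x00 (@x20 R).
by rewrite c0 c1 c2 s3_id comp_id.
Qed.

(** For s = 0, [T0] is conj Q(chi, z, Q(z, chi, 0)), which is 0 by [n3b]. *)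
Lemma T0_ord : ordw (m3 0 0 1) 1 T0.
Proof.
have k0 := @kill0 R 3 o32.
have kE : kill o32 = s3 x0 x1 (0 : fps R 3).
  by apply/funext => -[[|[|[|i]]] lti] //=; congr fX; apply/val_inj.
have T0k : comp T0 (kill o32) = 0.
  rewrite /T0 (comp_s3 _ x120 x00 Q00 k0) compD kE.
  have -> : comp Q0 (s3 x0 x1 0) = Q0.
    have gk : g0 (s3 x0 x1 (0 : fps R 3)) by rewrite -kE.
    rewrite /Q0 (comp_s3 _ x00 x10 (z00 _) gk) comp0.
    by rewrite (comp_x0 x00 x10 (z00 _)) (comp_x1 x00 x10 (z00 _)).
  rewrite (comp_x0 x00 x10 (z00 _)) (comp_x1 x00 x10 (z00 _)) (comp_x2 x00 x10 (z00 _)).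
  rewrite addr0; have := congr1 (fun f => comp f (s3 x0 x1 0)) n3b.
  rewrite (comp_s3 _ x10 x00 Qz) -?kE// kE.
  by rewrite (comp_x0 x00 x10 (z00 _)) (comp_x1 x00 x10 (z00 _)) (comp_x2 x00 x10 (z00 _)).
move=> b bw; have b2 : b o32 = 0%N.
  by move: bw; rewrite (m3E b) wdeg_m3 !mul0n mul1n !add0n ltnS leqn0 => /eqP.
by have := congr1 (fun f => f b) T0k; rewrite comp_kill b2 eqxx.
Qed.

(** By [n2], Q has order 1 in its first and third variables, into which s and tau are
    substituted. *)
Lemma W0_ord : ordw (m3 0 1 1) 1 W0.
Proof.
have H1 : ordw (m3 1 0 1) 1 Q.
  move=> b; rewrite (m3E b) wdeg_m3 mul0n !mul1n addn0 ltnS leqn0 addn_eq0.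
  by move=> /andP[/eqP -> /eqP ->]; rewrite n2 andbF.
apply: (ordw_comp (v := m3 1 0 1)) H1 => -[[|[|[|i]]] lti] //=.
- rewrite /s3 /m3 /= x2E => b; rewrite /mono; case: eqP => // ->.
  by rewrite wdeg_m3.
- rewrite /s3 /m3 /= x1E => b; rewrite /mono; case: eqP => // ->.
  by rewrite wdeg_m3.
Qed.

Hypothesis iota2 : forall k, (iota k <= 2)%N.

Lemma Phi_jet (de : 'I_3 -> fps R 2) :
  (forall h, ordw (fun=> 1%N) 5 (de h)) -> S1 (S2 de) = fun=> 0.
Proof.
move=> d5; apply/funext => l.
have s2o j : ordw (m2 0 1) (5 - 1 * 2) (S2 de j).
  apply: ord_solve => // i.
  apply: (ordw_comp (v := fun=> 1%N)) (d5 i) => -[[|[|k]] ltk] //=.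
    rewrite /s2 /= x2E => b; rewrite /mono; case: eqP => // ->.
    by rewrite wdeg_m3.
  exact: W0_ord.
(* The order 5 - 2 - 2 = 1 is positive, while all indices have degree 0 for the weights (0, 0):
   every coefficient vanishes. *)
have s1o : ordw (m2 0 0) (5 - 1 * 2 - 1 * 2) (S1 (S2 de) l).
  apply: ord_solve => // i.
  apply: (ordw_comp (v := m2 0 1)) (s2o i) => -[[|[|k]] ltk] //=.
  exact: T0_ord.
by apply/funext => b; apply: s1o; rewrite (m2E b) wdeg_m2.
Qed.

Lemma Phi_solution (al : 'I_3 -> fps R 2) :
  det1 (mi0 2) != 0 -> det2 (mi0 2) != 0 ->
  (forall k, Eq (r k) al x0 Q x1 x2 = 0) ->
  (fun l => comp (al l) (s2 y0 q0)) = S1 (S2 al).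
Proof.
move=> d1 d2 E.
(* Along z = s, w = Q(s, chi, tau) the point (chi, tau) is fixed, so conj(alpha)(chi, tau) is the
   unknown of the system in s. *)
have -> : S2 al = fun j => bar (al j).
  apply/esym/solveP => // k.
  have g2 : g0 (s3 x2 x0 (@x1 R)) by apply: s3_0; [exact: x20|exact: x00|exact: x10].
  have := congr1 (fun f => comp f (s3 x2 x0 x1)) (E k).
  rewrite (Eq_comp _ _ x00 Qz x10 x20 g2) comp0.
  rewrite (comp_x0 x20 x00 x10) (comp_x1 x20 x00 x10) (comp_x2 x20 x00 x10) -/W0.
  by rewrite /Eq => EE; rewrite -[RHS]EE; apply: eq_bigr => j _; rewrite addrC.
apply/solveP => // k.
have g1 : g0 (s3 x0 (x1 + x2) T0) by apply: s3_0; [exact: x00|exact: x120|exact: T00].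
have := congr1 (fun f => comp f (s3 x0 (x1 + x2) T0)) (E k).
rewrite (Eq_comp _ _ x00 Qz x10 x20 g1) comp0.
rewrite (comp_x0 x00 x120 T00) (comp_x1 x00 x120 T00) (comp_x2 x00 x120 T00).
have bz : z0 (comp (bar Q) (s3 x1 x0 x2)).
  apply: z0_comp; last exact: z0_bar.
  by apply: s3_0; [exact: x10|exact: x00|exact: x20].
have h1 : g0 (s3 x0 (x1 + x2) Q0) by apply: s3_0; [exact: x00|exact: x120|exact: Q00].
(* [T0] is made so that Q(z, chi + s, T0) = Q(z, chi, 0): along this curve (z, w), and with it the
   unknown alpha(z, w), stays fixed. *)
have -> : comp Q (s3 x0 (x1 + x2) T0) = Q0.
  have := congr1 (fun f => comp f (s3 x0 (x1 + x2) Q0)) n3.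
  rewrite (comp_s3 _ x00 x10 bz h1) (comp_s3 _ x10 x00 x20 h1).
  by rewrite (comp_x0 x00 x120 Q00) (comp_x1 x00 x120 Q00) (comp_x2 x00 x120 Q00).
rewrite /Eq => EE; rewrite -[RHS]EE; apply: eq_bigr => j _; congr (_ * _ + _).
have gy : g0 (s2 x0 (@x1 R)) by apply: s2_0; [exact: x00|exact: x10].
have q00 : z0 q0 by apply: z0_comp => //; apply: s3_0; [exact: y00|exact: y10|exact: z00].
rewrite (comp_s2 _ y00 q00 gy) (comp_y0 x00 x10) /q0 (comp_s3 _ y00 y10 (z00 _) gy).
by rewrite (comp_y0 x00 x10) (comp_y1 x00 x10) comp0.
Qed.
End Operators.

(** * Lagrange inversion and the map (z, t) -> (z, z t) *)

Section Blow.

(** The derivation chi d/dchi; unlike d/dchi it does not shift indices. *)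
Definition theta (f : fps R 2) : fps R 2 := fun b => (b o21)%:R * f b.

Lemma thetaM f g : theta (f * g) = theta f * g + f * theta g.
Proof.
apply/funext => b; have bN := mdeg_box (ltnSn (mdeg b)).
rewrite coefD /theta !(fpsM _ _ bN) mulr_sumr -big_split; apply: eq_bigr => a _ /=.
rewrite mulr_sumr -big_split; apply: eq_bigr => c /= /eqP <-.
by rewrite /madd natrD; ring.
Qed.

Lemma thetaX f k : theta (f ^+ k.+1) = k.+1%:R *: (f ^+ k * theta f).
Proof.
elim: k => [|k IH]; first by rewrite expr0 mul1r scale1r expr1.
rewrite exprS thetaM IH -scalerAr mulrA -exprS [theta f * _]mulrC.
by rewrite -{1}[f ^+ k.+1 * _]scale1r -scalerDl nat1r.
Qed.

(* Lagrange inversion: if Ph(z, chi) = f(z, z chi u), then lagr u Ph = f(z, z t). *)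
Definition lagr (u Ph : fps R 2) : fps R 2 := fun b =>
  (Ph * (u + theta u) * finv u ^+ (b o21).+1) b.

Definition blow (f : fps R 2) := comp f (s2 y0 (y0 * y1)).

Lemma y0y1E : y0 * y1 = mono (m2 1 1) :> fps R 2.
Proof. by rewrite y0E y1E monoM madd_m2. Qed.
Lemma y0y10 : z0 (@y0 R * y1).
Proof. by rewrite /z0 coef0M y00 mul0r. Qed.

Lemma blow_mono i j : blow (mono (m2 i j)) = mono (m2 (i + j) j).
Proof.
rewrite /blow comp_mono; last by apply: s2_0; [exact: y00|exact: y0y10].
rewrite gpow_s2 y0y1E y0E !monoX monoM; congr mono.
by apply/funext => -[[|[|q]] lti] //=; rewrite /madd /m2 /=; lia.
Qed.

Lemma lagr_mono (u : fps R 2) i j : u (mi0 2) != 0 ->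
  lagr u (comp (mono (m2 i j)) (s2 y0 (y0 * y1 * u))) = blow (mono (m2 i j)).
Proof.
move=> u0; have vE := finvE u0; set v := finv u in vE *.
have v0 : z0 (y0 * y1 * u) by rewrite /z0 coef0M y0y10 mul0r.
rewrite blow_mono comp_mono; last by apply: s2_0; [exact: y00|].
rewrite gpow_s2 exprMn y0y1E y0E !monoX mulrA monoM.
set e := madd _ _; have -> : e = m2 (i + j) j.
  by rewrite /e; apply/funext => -[[|[|q]] lti] //=; rewrite /madd /m2 /=; lia.
apply/funext => b; rewrite /lagr -/v -!mulrA.
have [jb|bj] := leqP j (b o21); last first.
  rewrite (coef_monoM0 _ (i := o21))// /mono; case: eqP => // bE.
  by move: bj; rewrite bE /m2 /= ltnn.
have [ib|bi] := leqP (i + j) (b o20); last first.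
  rewrite (coef_monoM0 _ (i := o20))// /mono; case: eqP => // bE.
  by move: bi; rewrite bE /m2 /= ltnn.
have bE : b = madd (m2 (i + j) j) (m2 (b o20 - (i + j)) (b o21 - j)).
  by rewrite madd_m2 !subnKC// -m2E.
transitivity ((mono (m2 (i + j) j) * (u ^+ j * ((u + theta u) * v ^+ (b o21).+1)))
  (madd (m2 (i + j) j) (m2 (b o20 - (i + j)) (b o21 - j)))); first by rewrite -bE.
rewrite coef_monoM [in RHS]bE /mono madd_m2 m2_inj.
set c := (b o20 - _)%N; set k := (b o21 - j)%N.
rewrite -[X in (_ == X) && _]addn0 -[X in _ && (_ == X)]addn0 !eqn_add2l.
have -> : u ^+ j * ((u + theta u) * v ^+ (b o21).+1) = (u + theta u) * v ^+ k.+1.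
  have -> : (b o21).+1 = (j + k.+1)%N by rewrite /k addnS subnKC.
  by rewrite exprD mulrCA [u ^+ j * _]mulrA -exprMn vE expr1n mul1r.
have -> : (u + theta u) * v ^+ k.+1 = v ^+ k + theta u * v ^+ k.+1.
  by rewrite mulrDl exprS mulrA vE mul1r.
have tv : theta v = - (v ^+ 2 * theta u).
  have t1 : theta 1 = 0 :> fps R 2.
    apply/funext => d; rewrite /theta coef1 coef_0; case: eqP => [->|]; rewrite ?mulr0//.
    by rewrite mul0r.
  have := congr1 theta vE; rewrite thetaM t1 => /eqP; rewrite addrC addr_eq0 => /eqP E.
  have : v * (u * theta v) = v * - (theta u * v) by rewrite E.
  by rewrite mulrA [v * u]mulrC vE mul1r => ->; rewrite mulrN; congr (- _); ring.
(* For k > 0 the coefficient of degree k in chi of v^k + theta(u) v^(k + 1) must vanish: theta(v^k)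
   = - k theta(u) v^(k + 1), and theta multiplies that coefficient of v^k by k. For k = 0, theta(u)
   v has no term of degree 0 in chi. *)
case: k => [|k].
  rewrite expr0 expr1 coefD coef1 (_ : mi0 2 = m2 0 0); last exact: m2E.
  rewrite m2_inj andbT.
  suff -> : (theta u * v) (m2 c 0) = 0 by rewrite addr0; case: eqP.
  have tu : ordw (m2 0 1) 1 (theta u * v).
    apply: ordwMr => d; rewrite (m2E d) wdeg_m2 mul0n mul1n add0n ltnS leqn0 => /eqP d1.
    by rewrite /theta d1 mul0r.
  by apply: tu; rewrite wdeg_m2 muln0.
rewrite andbF; apply: (mulfI (x := k.+1%:R)); first by rewrite pnatr_eq0.
rewrite mulr0 coefD mulrDr.
have := congr1 (fun f => f (m2 c k.+1)) (thetaX v k).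
rewrite tv mulrN mulrA -exprD addn2 scalerN {1}/theta coefN coefZ => ->.
by rewrite [theta u * _]mulrC addNr.
Qed.

Lemma lagr_comp (u f : fps R 2) : u (mi0 2) != 0 ->
  lagr u (comp f (s2 y0 (y0 * y1 * u))) = blow f.
Proof.
move=> u0.
have v0 : z0 (y0 * y1 * u) by rewrite /z0 coef0M y0y10 mul0r.
have gu : g0 (s2 y0 (y0 * y1 * u)) by apply: s2_0 => //; exact: y00.
have gb : g0 (s2 (@y0 R) (y0 * y1)) by apply: s2_0; [exact: y00|exact: y0y10].
apply: (fps_ind (L1 := fun f => lagr u (comp f (s2 y0 (y0 * y1 * u)))) (L2 := blow)).
- by move=> g h; apply/funext => b; rewrite /lagr compD !mulrDl.
- by move=> g h; rewrite /blow compD.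
- move=> b; exists (mdeg b).+1 => g gN; split; last exact: (comp_ord gb gN).
  have gv j : ordw (fun=> 1%N) 1 (s2 y0 (y0 * y1 * u) j).
    by move=> c; rewrite wdeg1 ltnS leqn0 => /eqP/mdeg_eq0 ->.
  have go := ordw_comp (v := fun=> 1%N) gv gN.
  rewrite /lagr -mulrA; apply: (ordwMr _ go).
  by rewrite wdeg1.
move=> c a; rewrite (m2E a); apply/funext => b.
have -> : blow (c *: mono (m2 (a o20) (a o21))) b = c * blow (mono (m2 (a o20) (a o21))) b.
  by rewrite /blow compZ coefZ.
by rewrite -(lagr_mono (a o20) (a o21) u0) /lagr compZ -!scalerAl coefZ.
Qed.

Lemma coef_blow f i j : blow f (m2 i j) = if (j <= i)%N then f (m2 (i - j) j) else 0.
Proof.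
have gb : g0 (s2 (@y0 R) (y0 * y1)) by apply: s2_0; [exact: y00|exact: y0y10].
pose L2 (f : fps R 2) : fps R 2 := fun b =>
  if (b o21 <= b o20)%N then f (m2 (b o20 - b o21) (b o21)) else 0.
have E : blow =1 L2.
  apply: fps_ind.
  - by move=> g h; rewrite /blow compD.
  - by move=> g h; apply/funext => b; rewrite [RHS]coefD /L2 coefD; case: ifP; rewrite ?addr0.
  - move=> b; exists (mdeg b).+1 => g gN; split; first exact: (comp_ord gb gN).
    rewrite /L2; case: ifP => // bb; apply: gN; rewrite wdeg1 mdeg_m2.
    by have := mdeg_m2 (b o20) (b o21); rewrite -m2E => ->; lia.
  move=> c a; apply/funext => b; rewrite /blow compZ -/(blow _) {1}(m2E a) blow_mono.
  rewrite /L2 coefZ; case: ifPn => bb; rewrite ?coefZ /mono [in LHS](m2E b).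
    rewrite [in RHS](m2E a) !m2_inj; congr (_ * _); congr (_%:R); congr nat_of_bool.
    by apply/andP/andP => -[/eqP h1 /eqP h2]; split; apply/eqP; lia.
  rewrite m2_inj; case: andP => [[/eqP h1 /eqP h2]|]; rewrite ?mulr0//.
  by move: bb; rewrite h1 h2 leq_addl.
by rewrite E /L2.
Qed.

(** Q(z, chi, 0) vanishes on both axes and is therefore divisible by z chi. *)
Lemma q0E (Q : fps R 3) :
  (forall b c, Q (m3 0 b c) = ((b == 0%N) && (c == 1%N))%:R) ->
  (forall a c, Q (m3 a 0 c) = ((a == 0%N) && (c == 1%N))%:R) ->
  q0 Q = y0 * y1 * (fun b => Q (m3 (b o20).+1 (b o21).+1 0)).
Proof.
move=> n2 n1; apply/funext => b.
have -> : q0 Q b = Q (m3 (b o20) (b o21) 0).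
  have gz : g0 (s3 (@y0 R) y1 0) by apply: s3_0; [exact: y00|exact: y10|exact: z00].
  pose L2 (f : fps R 3) : fps R 2 := fun b => f (m3 (b o20) (b o21) 0).
  have E : (fun f => comp f (s3 y0 y1 0)) =1 L2.
    apply: fps_ind => //.
    - by move=> g h; rewrite compD.
    - move=> c; exists (mdeg c).+1 => g gN; split; first exact: (comp_ord gz gN).
      by apply: gN; rewrite wdeg1 mdeg_m3 {3}(m2E c) mdeg_m2 addn0.
    move=> c a; apply/funext => d; rewrite compZ comp_mono// {1}(m3E a) gpow_s3.
    rewrite coefZ /L2 coefZ; congr (_ * _); rewrite y0E y1E !monoX monoM expr0n.
    have aE : mono a (m3 (d o20) (d o21) 0) =
       ((d o20 == a o30) && (d o21 == a o31) && (a o32 == 0%N))%:R :> C.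
      rewrite /mono; congr (_%:R); congr nat_of_bool; apply/eqP/idP => [<- //|].
        by rewrite !eqxx.
      by move=> /andP[/andP[/eqP h0 /eqP h1] /eqP h2]; rewrite [RHS]m3E h0 h1 h2.
    rewrite aE; case: (a o32 == 0%N); rewrite ?andbF ?mulr0//= mulr1 andbT.
    rewrite /mono; congr (_%:R); congr nat_of_bool.
    rewrite [d in LHS]m2E (_ : madd _ _ = m2 (a o30) (a o31)) ?m2_inj//.
    by apply/funext => -[[|[|q]] lti] //=; rewrite /madd /m2 /=; lia.
  exact: (congr1 (fun f => f b) (E Q)).
rewrite y0y1E; case b0 : (b o20) => [|i].
  by rewrite (coef_monoM0 _ (i := o20)) ?b0// n2 andbF.
case b1 : (b o21) => [|j].
  by rewrite (coef_monoM0 _ (i := o21)) ?b1// n1 andbF.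
by rewrite (m2E b) b0 b1 -(madd_m2 1 1 i j) coef_monoM.
Qed.
End Blow.
End Reflection.

(** * From germs to formal power series *)

Section Near.
Context {R : realType}.
Notation C := (Cplx R).

Section Conv.
Let dg (_ : unit) := 0%N.
Let pt0 : unit -> C := fun=> 0.

(** Convergence is tameness of a constant family over a dummy parameter, so its closure properties
    are inherited from those of tame maps. *)
Lemma convT n (f : fps R n) : convergent f -> tame dg setT pt0 (fun=> f).
Proof. by move=> cf; exact: (@tame_cst R unit dg setT pt0 n f cf). Qed.
Lemma Tconv n (f : fps R n) : tame dg setT pt0 (fun=> f) -> convergent f.
Proof.
move=> [_ /(_ 0 (lexx _))[r [M [r0 H]]]]; apply/convergentP; exists r, M; split=> //.
by apply: (H pt0) => // i; rewrite /pt0 nr0 exprn_ge0.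
Qed.

Lemma conv_mono n (a : 'I_n -> nat) : convergent (mono a : fps R n).
Proof. by apply/convergentP; exists 1, (1 ^+ mdeg a); split=> //; exact: nle_mono. Qed.
Lemma conv0 n : convergent (0 : fps R n).
Proof. by apply/convergentP; exists 1, 0; split=> //; exact: nle0. Qed.
Lemma convD n (f g : fps R n) : convergent f -> convergent g -> convergent (f + g : fps R n).
Proof. by move=> /convT cf /convT cg; exact: (Tconv (tameD cf cg)). Qed.
Lemma convN n (f : fps R n) : convergent f -> convergent (- f : fps R n).
Proof. by move=> /convT cf; exact: (Tconv (tameN cf)). Qed.
Lemma convM n (f g : fps R n) : convergent f -> convergent g -> convergent (f * g : fps R n).
Proof. by move=> /convT cf /convT cg; exact: (Tconv (tameM cf cg)). Qed.
Lemma conv_bar n (f : fps R n) : convergent f -> convergent (bar f).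
Proof. by move=> /convT cf; exact: (Tconv (tameJ cf)). Qed.
Lemma convZ n (c : C) (f : fps R n) : convergent f -> convergent (c *: f : fps R n).
Proof.
move=> /convergentP[r [M [r0 H]]]; apply/convergentP; exists r, (nr c * M); split=> //.
exact: nleZ.
Qed.
Lemma conv_sum n J (s : seq J) (Q : pred J) (F : J -> fps R n) :
  (forall j, Q j -> convergent (F j)) -> convergent (\sum_(j <- s | Q j) F j : fps R n).
Proof. by move=> H; elim/big_ind: _ => //; [exact: conv0|move=> a b; exact: convD]. Qed.
Lemma conv_comp m n (f : fps R m) (g : 'I_m -> fps R n) : convergent f ->
  (forall i, convergent (g i)) -> g0 g -> convergent (comp f g).
Proof.
move=> /convT cf cg gz; apply: Tconv.
exact: (tame_comp (G := fun i _ => g i) cf (fun i => convT (cg i)) (fun _ i _ => gz i)).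
Qed.
End Conv.

Section NearZero.
Variable n : nat.
Implicit Types (A B : 'rV[C]_n -> Prop) (f g : fps R n).

Definition nearz A := exists2 e : R, 0 < e & forall x : 'rV[C]_n, (forall i, nr (x 0 i) < e) -> A x.

Lemma nearz2 A B (W : 'rV[C]_n -> Prop) : nearz A -> nearz B ->
  (forall x, A x -> B x -> W x) -> nearz W.
Proof.
move=> [e e0 He] [d d0 Hd] ABW; exists (Num.min e d); first by rewrite lt_min e0.
move=> x xed; apply: ABW; [apply: He|apply: Hd] => i;
  by have := xed i; rewrite lt_min => /andP[].
Qed.

Lemma nearz1 A B : nearz A -> (forall x, A x -> B x) -> nearz B.
Proof. by move=> nA AB; apply: (nearz2 nA nA) => x /AB. Qed.

Lemma nearzI A B : nearz A -> nearz B -> nearz (fun x => A x /\ B x).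
Proof. by move=> nA nB; apply: (nearz2 nA nB). Qed.

Lemma nearzT A : (forall x, A x) -> nearz A.
Proof. by move=> HA; exists 1. Qed.

Lemma nearz_all (I : finType) (F : I -> 'rV[C]_n -> Prop) :
  (forall i, nearz (F i)) -> nearz (fun x => forall i, F i x).
Proof.
move=> HF; suff : nearz (fun x => forall i, i \in enum I -> F i x).
  by move/nearz1; apply => x H i; apply: H; rewrite mem_enum.
elim: (enum I) => [|i s IH]; first exact: nearzT.
apply: (nearz2 (HF i) IH) => x xi xs j; rewrite inE => /predU1P[->//|]; exact: xs.
Qed.

Lemma near_evalD f g : convergent f -> convergent g ->
  nearz (fun x => eval (f + g : fps R n) x = eval f x + eval g x).
Proof.
move=> /convergentP[r [M [r0 H]]] /convergentP[s [K [s0 G]]].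
pose t := Num.min r s; have t0 : 0 < t by rewrite lt_min r0.
exists (t / 2) => [|x xt]; first by rewrite divr_gt0.
apply: (@evalD _ _ t M K); first exact: ltW.
- by apply: nle_le H; rewrite ?(ltW t0)// ge_min lexx.
- by apply: nle_le G; rewrite ?(ltW t0)// ge_min lexx orbT.
- by move=> i; exact: ltW.
Qed.

Lemma near_evalM f g : convergent f -> convergent g ->
  nearz (fun x => eval (f * g : fps R n) x = eval f x * eval g x).
Proof.
move=> /convergentP[r [M [r0 H]]] /convergentP[s [K [s0 G]]].
pose t := Num.min r s; have t0 : 0 < t by rewrite lt_min r0.
exists (t / 2) => [|x xt]; first by rewrite divr_gt0.
apply: (@evalM _ _ t M K); first exact: ltW.
- by apply: nle_le H; rewrite ?(ltW t0)// ge_min lexx.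
- by apply: nle_le G; rewrite ?(ltW t0)// ge_min lexx orbT.
- by move=> i; exact: ltW.
Qed.

Lemma near_evalZ c f : convergent f ->
  nearz (fun x => eval (c *: f : fps R n) x = c * eval f x).
Proof.
move=> /convergentP[r [M [r0 H]]]; exists (r / 2) => [|x xt]; first by rewrite divr_gt0.
by apply: (@evalZ _ _ r M) => //; [exact: ltW|move=> i; exact: ltW].
Qed.

Lemma eval_0 x : eval (0 : fps R n) x = 0.
Proof.
have := @evalZ R n 0 0 (0 : fps R n) 0.
rewrite /eval; have -> : psum (0 : fps R n) x = fun=> 0.
  by apply/funext => N; rewrite psumE big1// => a _; rewrite coef_0 mul0r.
by move=> _; apply: cvg_lim; [exact: norm_hausdorff|exact: cvg_cst].
Qed.

Lemma near_eval_sum J (s : seq J) (F : J -> fps R n) : (forall j, convergent (F j)) ->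
  nearz (fun x => eval (\sum_(j <- s) F j : fps R n) x = \sum_(j <- s) eval (F j) x).
Proof.
move=> cF; elim: s => [|j s IH].
  by apply: nearzT => x; rewrite !big_nil eval_0.
have cs : convergent (\sum_(j <- s) F j : fps R n) by apply: conv_sum.
apply: (nearz2 IH (near_evalD (cF j) cs)) => x E1 E2.
by rewrite !big_cons E2 E1.
Qed.

Lemma near_eq0 f : convergent f -> nearz (fun x => eval f x = 0) -> f = 0.
Proof.
move=> /convergentP[r [M [r0 H]]] [e e0 fe].
exact: (eval_eq0 r0 H e0 fe).
Qed.

Lemma near_eq f g : convergent f -> convergent g ->
  nearz (fun x => eval f x = eval g x) -> f = g.
Proof.
move=> cf cg E; apply/eqP; rewrite -subr_eq0 -scaleN1r; apply/eqP/near_eq0.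
  by apply: convD => //; exact: convZ.
apply: (nearz2 E (nearzI (near_evalD cf (convZ (-1) cg)) (near_evalZ (-1) cg))).
by move=> x Ex [-> ->]; rewrite Ex mulN1r subrr.
Qed.
End NearZero.

Lemma near_comp m n (f : fps R m) (g : 'I_m -> fps R n) : convergent f ->
  (forall i, convergent (g i)) -> g0 g ->
  nearz (fun x => eval (comp f g) x = eval f (\row_i eval (g i) x)).
Proof.
move=> /convergentP[s [M [s0 H]]] cg gz.
have /choice[rK HrK] (i : 'I_m) : exists rK : R * R, 0 < rK.1 /\ nle rK.1 rK.2 (g i).
  by have /convergentP[r [K ?]] := cg i; exists (r, K).
(* S bounds all inverse radii and all norms, so every g_i has norm at most S at radius 1 / S; the
   factor t below then brings it under s / 2. *)
pose S := 1 + \sum_i ((rK i).1^-1 + `|(rK i).2|).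
have ri i : 0 < (rK i).1^-1 by rewrite invr_gt0; have [] := HrK i.
have ge0 i : 0 <= (rK i).1^-1 + `|(rK i).2| by rewrite addr_ge0// ltW.
have S0 : 0 < S by rewrite ltr_wpDr// sumr_ge0.
have S_ge i : (rK i).1^-1 + `|(rK i).2| <= S.
  rewrite /S (bigD1 i)//= addrCA lerDl addr_ge0// sumr_ge0// => j _; exact: ge0.
have gS i : nle S^-1 S (g i).
  have [r0 HK] := HrK i; apply: nle_le HK; first by rewrite invr_ge0 ltW.
    rewrite -[leRHS]invrK lef_pV2 ?posrE//; have := S_ge i; have := normr_ge0 (rK i).2; lra.
  rewrite (le_trans (ler_norm _))//; have := S_ge i; have := ri i; lra.
pose t := s / 2 / (s / 2 + S).
have s2 : 0 < s / 2 by rewrite divr_gt0.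
have sS : 0 < s / 2 + S by rewrite addr_gt0.
have t0 : 0 < t by rewrite divr_gt0.
have t1 : t <= 1 by rewrite ler_pdivrMr// mul1r lerDl ltW.
have r0 : 0 < t * S^-1 by rewrite mulr_gt0// invr_gt0.
exists (t * S^-1 / 2) => [|x xr]; first by rewrite divr_gt0.
have rge := ltW r0; have sge := ltW s0.
apply: (@eval_comp R m n (t * S^-1) s M) => //.
- move=> i; apply: (nle_le _ (lexx _) _ (nle_shrink (gz i) _ _ (gS i))).
  + by [].
  + by rewrite /t mulrAC ler_pdivrMr// ler_wpM2l ?lerDr// ltW.
  + by rewrite invr_ge0 ltW.
  + by rewrite (ltW t0) t1.
- by move=> i; exact: ltW.
Qed.

Lemma rV2E (x : 'rV[C]_2) : x = pt 2 [:: x 0 o20; x 0 o21].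
Proof. by apply/rowP => -[[|[|i]] lti] //; rewrite mxE /=; congr (x 0 _); apply/val_inj. Qed.
Lemma rV3E (x : 'rV[C]_3) : x = pt 3 [:: x 0 o30; x 0 o31; x 0 o32].
Proof. by apply/rowP => -[[|[|[|i]]] lti] //; rewrite mxE /=; congr (x 0 _); apply/val_inj. Qed.

Lemma row_s2 n (a b : fps R n) x :
  \row_i eval (s2 a b i) x = pt 2 [:: eval a x; eval b x].
Proof. by apply/rowP => -[[|[|i]] lti] //; rewrite !mxE. Qed.
Lemma row_s3 n (a b c : fps R n) x :
  \row_i eval (s3 a b c i) x = pt 3 [:: eval a x; eval b x; eval c x].
Proof. by apply/rowP => -[[|[|[|i]]] lti] //; rewrite !mxE. Qed.
Lemma row_s33 n (F G : 'I_3 -> fps R n) x :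
  \row_i eval (s33 F G i) x = row_mx (\row_k eval (F k) x) (\row_k eval (G k) x).
Proof. by apply/rowP => i; rewrite !mxE /s33; case: splitP => j _; rewrite mxE. Qed.

Lemma near_comp2 n (f : fps R 2) (a b : fps R n) : convergent f -> convergent a ->
  convergent b -> z0 a -> z0 b ->
  nearz (fun x => eval (comp f (s2 a b)) x = eval f (pt 2 [:: eval a x; eval b x])).
Proof.
move=> cf ca cb az bz; have := @near_comp _ _ f (s2 a b) cf.
move=> H; apply: (nearz1 (H _ (s2_0 az bz))) => [|x ->]; last by rewrite row_s2.
by move=> -[[|[|i]] lti].
Qed.
Lemma near_comp3 n (f : fps R 3) (a b c : fps R n) : convergent f -> convergent a ->
  convergent b -> convergent c -> z0 a -> z0 b -> z0 c ->
  nearz (fun x => eval (comp f (s3 a b c)) x =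
    eval f (pt 3 [:: eval a x; eval b x; eval c x])).
Proof.
move=> cf ca cb cc az bz cz; have := @near_comp _ _ f (s3 a b c) cf.
move=> H; apply: (nearz1 (H _ (s3_0 az bz cz))) => [|x ->]; last by rewrite row_s3.
by move=> -[[|[|[|i]]] lti].
Qed.
Lemma near_comp33 n (f : fps R (3 + 3)) (F G : 'I_3 -> fps R n) : convergent f ->
  (forall k, convergent (F k)) -> (forall k, convergent (G k)) ->
  (forall k, z0 (F k)) -> (forall k, z0 (G k)) ->
  nearz (fun x => eval (comp f (s33 F G)) x =
    eval f (row_mx (\row_k eval (F k) x) (\row_k eval (G k) x))).
Proof.
move=> cf cF cG Fz Gz; have := @near_comp _ _ f (s33 F G) cf.
move=> H; apply: (nearz1 (H _ (s33_0 Fz Gz))) => [|x ->]; last by rewrite row_s33.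
by move=> i; rewrite /s33; case: splitP.
Qed.

Lemma near3P (A : C * C * C -> Prop) : (\forall p \near (0 : C * C * C), A p) <->
  nearz (fun x : 'rV[C]_3 => A (x 0 o30, x 0 o31, x 0 o32)).
Proof.
split=> [/nbhs_ballP[e /gt0_realP[d d0 ->] He]|[e e0 He]].
  exists d => // x xd; apply: He; split; first split;
    by rewrite /ball /= sub0r normrN ltc_nr.
have e0' : 0 < (e%:C)%C :> C by have := @ltcR R 0 e => ->.
apply/nbhs_ballP; exists (e%:C)%C => //.
move=> [[z c] t] [[/= hz hc] ht].
have := He (pt 3 [:: z; c; t]); rewrite !mxE /=; apply => i.
by rewrite mxE; case: i => -[|[|[|i]]] lti //=; rewrite -ltc_nr -normrN -sub0r.
Qed.
End Near.

Section Translation.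
Context {R : realType}.
Notation C := (Cplx R).

Lemma conv_x n (i : 'I_n) : convergent (fX i : fps R n).
Proof. exact: conv_mono. Qed.

Lemma kill_s3_0 : kill o30 = s3 0 x1 (x2 : fps R 3).
Proof. by apply/funext => -[[|[|[|i]]] lti] //=; congr fX; apply/val_inj. Qed.
Lemma kill_s3_1 : kill o31 = s3 x0 0 (x2 : fps R 3).
Proof. by apply/funext => -[[|[|[|i]]] lti] //=; congr fX; apply/val_inj. Qed.

Lemma x2_coef a b c : (x2 : fps R 3) (m3 a b c) = [&& a == 0, b == 0 & c == 1]%N%:R.
Proof.
rewrite x2E /mono; congr (_%:R); congr nat_of_bool; apply/eqP/and3P => [/funeqP H|].
  by rewrite (H o30 : a = _) (H o31 : b = _) (H o32 : c = _).
by move=> [/eqP -> /eqP -> /eqP ->].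
Qed.

(** The identity theorem [near_eq] makes each condition near 0 a formal identity; setting chi = 0 or
    z = 0 then determines the coefficients. *)
Lemma normal_formal (Q : germ R 3) : normal_coord Q ->
  [/\ z0 (germ_ps Q),
    forall a c, germ_ps Q (m3 a 0 c) = ((a == 0%N) && (c == 1%N))%:R,
    forall b c, germ_ps Q (m3 0 b c) = ((b == 0%N) && (c == 1%N))%:R &
    comp (germ_ps Q) (s3 x0 x1 (comp (bar (germ_ps Q)) (s3 x1 x0 x2))) = x2].
Proof.
move=> /near3P nQ; have cQ := germP Q; set q : fps R 3 := germ_ps Q in cQ *.
have E1 : comp q (s3 x0 0 x2) = x2.
  have cc := conv_comp (g := kill o31) cQ.
  apply: near_eq; [|exact: conv_x|].
    by rewrite -kill_s3_1; apply: cc (kill0 _) => i; rewrite /kill; case: ifP => _;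
      [exact: conv0|exact: conv_x].
  apply: (nearz2 nQ (near_comp3 cQ (conv_x o30) (conv0 _) (conv_x o32) (fX0 o30) (z00 _) (fX0 o32))).
  by move=> x [H _ _] ->; rewrite !evalX eval_0.
have E2 : comp q (s3 0 x1 x2) = x2.
  have cc := conv_comp (g := kill o30) cQ.
  apply: near_eq; [|exact: conv_x|].
    by rewrite -kill_s3_0; apply: cc (kill0 _) => i; rewrite /kill; case: ifP => _;
      [exact: conv0|exact: conv_x].
  apply: (nearz2 nQ (near_comp3 cQ (conv0 _) (conv_x o31) (conv_x o32) (z00 _) (fX0 o31) (fX0 o32))).
  by move=> x [_ H _] ->; rewrite !evalX eval_0.
have n1 a c : q (m3 a 0 c) = ((a == 0%N) && (c == 1%N))%:R.
  have := congr1 (fun f : fps R 3 => f (m3 a 0 c)) E1.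
  by rewrite -kill_s3_1 comp_kill x2_coef.
have n2 b c : q (m3 0 b c) = ((b == 0%N) && (c == 1%N))%:R.
  have := congr1 (fun f : fps R 3 => f (m3 0 b c)) E2.
  by rewrite -kill_s3_0 comp_kill x2_coef.
have qz : z0 q by rewrite /z0 (m3E (mi0 3)) n1.
have gz : g0 (s3 x1 x0 (x2 : fps R 3)) by apply: s3_0; exact: fX0.
have cg i : convergent (s3 x1 x0 (x2 : fps R 3) i).
  by case: i => -[|[|[|i]]] lti //=; exact: conv_x.
have cb : convergent (comp (bar q) (s3 x1 x0 x2)) by apply: conv_comp => //; exact: conv_bar.
have zb : z0 (comp (bar q) (s3 x1 x0 x2)) by apply: z0_comp => //; exact: z0_bar.
split=> //; apply: near_eq; [|exact: conv_x|].
  apply: conv_comp => //; last by apply: s3_0 => //; exact: fX0.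
  by case=> -[|[|[|i]]] lti //=; exact: conv_x.
apply: (nearz2 nQ (nearzI
  (near_comp3 cQ (conv_x o30) (conv_x o31) cb (fX0 o30) (fX0 o31) zb)
  (near_comp3 (conv_bar cQ) (conv_x o31) (conv_x o30) (conv_x o32)
    (fX0 o31) (fX0 o30) (fX0 o32)))).
by move=> x [_ _ H] [-> ->]; rewrite !evalX.
Qed.

Definition gps (H : 'I_3 -> germ R 2) : 'I_3 -> fps R 2 := fun k => germ_ps (H k).
Definition rps (r : 'I_3 -> germ R (3 + 3)) : 'I_3 -> fps R (3 + 3) := fun k => germ_ps (r k).

Section Along.
Variables (H : 'I_3 -> germ R 2) (n : nat) (Z W X T : fps R n).
Hypotheses (cZ : convergent Z) (cW : convergent W) (cX : convergent X) (cT : convergent T).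
Hypotheses (zZ : z0 Z) (zW : z0 W) (zX : z0 X) (zT : z0 T).
Hypothesis H0 : forall k, z0 (gps H k).

Lemma conv_s2 (a b : fps R n) i : convergent a -> convergent b -> convergent (s2 a b i).
Proof. by case: i => -[|[|i]] lti. Qed.

Lemma conv_Hof k : convergent (Hof (gps H) Z W k).
Proof.
apply: conv_comp; [exact: germP|by move=> i; exact: conv_s2|exact: s2_0].
Qed.
Lemma conv_Hbof k : convergent (Hbof (gps H) X T k).
Proof.
apply: conv_comp; [exact/conv_bar/germP|by move=> i; exact: conv_s2|exact: s2_0].
Qed.

Lemma near_Hof : nearz (fun x => \row_k eval (Hof (gps H) Z W k) x =
  evalv H (pt 2 [:: eval Z x; eval W x])).
Proof.
have := nearz_all (fun k => near_comp2 (germP (H k)) cZ cW zZ zW).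
by move/nearz1; apply => x E; apply/rowP => k; rewrite !mxE E.
Qed.
Lemma near_Hbof : nearz (fun x => \row_k eval (Hbof (gps H) X T k) x =
  evalv_bar H (pt 2 [:: eval X x; eval T x])).
Proof.
have := nearz_all (fun k => near_comp2 (conv_bar (germP (H k))) cX cT zX zT).
by move/nearz1; apply => x E; apply/rowP => k; rewrite !mxE E.
Qed.

Lemma near_cof (rho : germ R (3 + 3)) : nearz (fun x =>
  eval (cof (gps H) (germ_ps rho) Z W X T) x =
  along rho H (eval Z x) (eval W x) (eval X x) (eval T x)).
Proof.
have hz k : z0 (Hof (gps H) Z W k) by exact: Hof0.
have hb k : z0 (Hbof (gps H) X T k) by exact: Hbof0.
apply: (nearz2 (near_comp33 (germP rho) conv_Hof conv_Hbof hz hb) (nearzI near_Hof near_Hbof)).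
by move=> x E [E1 E2]; rewrite E1 E2 in E; exact: E.
Qed.
Lemma near_cobar (rho : germ R (3 + 3)) : nearz (fun x =>
  eval (cobar (gps H) (germ_ps rho) Z W X T) x =
  along_bar rho H (eval Z x) (eval W x) (eval X x) (eval T x)).
Proof.
have hz k : z0 (Hof (gps H) Z W k) by exact: Hof0.
have hb k : z0 (Hbof (gps H) X T k) by exact: Hbof0.
apply: (nearz2 (near_comp33 (conv_bar (germP rho)) conv_Hbof conv_Hof hb hz)
  (nearzI near_Hof near_Hbof)).
by move=> x E [E1 E2]; rewrite E1 E2 in E; exact: E.
Qed.
Lemma conv_cof (rho : germ R (3 + 3)) : convergent (cof (gps H) (germ_ps rho) Z W X T).
Proof.
apply: conv_comp; first exact: germP.
  by move=> i; rewrite /s33; case: splitP => j _; [exact: conv_Hof|exact: conv_Hbof].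
by apply: s33_0 => k; [exact: Hof0|exact: Hbof0].
Qed.
Lemma conv_cobar (rho : germ R (3 + 3)) : convergent (cobar (gps H) (germ_ps rho) Z W X T).
Proof.
apply: conv_comp; first exact/conv_bar/germP.
  by move=> i; rewrite /s33; case: splitP => j _; [exact: conv_Hbof|exact: conv_Hof].
by apply: s33_0 => k; [exact: Hbof0|exact: Hof0].
Qed.
End Along.

(** Near 0 evaluation respects sums, products and compositions, so the equation between values is
    the evaluation of [Eq], and the identity theorem applies. *)
Lemma solvesP (S : set ('I_3 -> germ R (3 + 3))) (H : 'I_3 -> germ R 2) (Q : germ R 3)
    (al : 'I_3 -> germ R 2) : (forall k, z0 (gps H k)) -> z0 (germ_ps Q) ->
  solves S H Q al <->
  forall r, S r -> Eq (gps H) (rps r) (gps al) x0 (germ_ps Q) x1 x2 = 0.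
Proof.
move=> H0 Qz; have cQ := germP Q.
have cx i : convergent (fX i : fps R 3) := conv_x i.
have zx i : z0 (fX i : fps R 3) := fX0 i.
pose tm r j : fps R 3 := cof (gps H) (rps r j) x0 (germ_ps Q) x1 x2 *
     comp (gps al j) (s2 x0 (germ_ps Q)) +
   cobar (gps H) (rps r j) x0 (germ_ps Q) x1 x2 * comp (bar (gps al j)) (s2 x1 x2).
have ca j : convergent (comp (gps al j) (s2 x0 (germ_ps Q))).
  by apply: conv_comp; [exact: germP|move=> i; exact: (conv_s2 _ (cx _) cQ)|exact: (s2_0 (zx _) Qz)].
have cb j : convergent (comp (bar (gps al j)) (s2 x1 (x2 : fps R 3))).
  by apply: conv_comp; [exact/conv_bar/germP|move=> i; exact: (conv_s2 _ (cx _) (cx _))|exact: (s2_0 (zx _) (zx _))].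
have c1 r j : convergent (cof (gps H) (rps r j) x0 (germ_ps Q) x1 x2).
  exact: (conv_cof (cx o30) cQ (cx o31) (cx o32) (zx o30) Qz (zx o31) (zx o32) H0 (r j)).
have c2 r j : convergent (cobar (gps H) (rps r j) x0 (germ_ps Q) x1 x2).
  exact: (conv_cobar (cx o30) cQ (cx o31) (cx o32) (zx o30) Qz (zx o31) (zx o32) H0 (r j)).
have ct r j : convergent (tm r j) by apply: convD; exact: convM.
have cE r : convergent (Eq (gps H) (rps r) (gps al) x0 (germ_ps Q) x1 x2).
  by apply: conv_sum => j _; exact: ct.
have nE r : nearz (fun x => eval (Eq (gps H) (rps r) (gps al) x0 (germ_ps Q) x1 x2) x =
   let z := x 0 o30 in let chi := x 0 o31 in let tau := x 0 o32 in
   let w := eval Q (pt 3 [:: z; chi; tau]) in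
    \sum_(j < 3) (along (r j) H z w chi tau * eval (al j) (pt 2 [:: z; w])
      + along_bar (r j) H z w chi tau *
        eval (bar (al j)) (pt 2 [:: chi; tau]))).
  have N1 := near_eval_sum (index_enum 'I_3) (ct r).
  have N2 j : nearz (fun x => eval (tm r j) x =
   let z := x 0 o30 in let chi := x 0 o31 in let tau := x 0 o32 in
   let w := eval Q (pt 3 [:: z; chi; tau]) in
    (along (r j) H z w chi tau * eval (al j) (pt 2 [:: z; w])
      + along_bar (r j) H z w chi tau *
        eval (bar (al j)) (pt 2 [:: chi; tau]))).
    have D1 := near_evalD (convM (c1 r j) (ca j)) (convM (c2 r j) (cb j)).
    have D2 := nearzI (near_evalM (c1 r j) (ca j)) (near_evalM (c2 r j) (cb j)).
    have D3 := nearzI (near_cof (cx o30) cQ (cx o31) (cx o32) (zx o30) Qz (zx o31) (zx o32) H0 (r j))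
      (near_cobar (cx o30) cQ (cx o31) (cx o32) (zx o30) Qz (zx o31) (zx o32) H0 (r j)).
    have D4 := nearzI (near_comp2 (germP (al j)) (cx o30) cQ (zx o30) Qz)
      (near_comp2 (conv_bar (germP (al j))) (cx o31) (cx o32) (zx o31) (zx o32)).
    apply: (nearz2 (nearzI D1 D2) (nearzI D3 D4)) => x [E1 [E2 E3]] [[E4 E5] [E6 E7]].
    rewrite /tm E1 E2 E3 E4 E5 E6 E7 !evalX /=.
    by rewrite -(rV3E x).
  apply: (nearz2 N1 (nearz_all N2)) => x -> E /=; apply: eq_bigr => j _.
  exact: E.
split=> [sol r Sr|E r Sr].
  have /near3P Nr := sol r Sr.
  by apply: near_eq0; [exact: cE|apply: (nearz2 Nr (nE r)) => x E ->].
apply/near3P; apply: (nearz1 (nE r)) => x /= <-; rewrite E// eval_0//.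
Qed.

Lemma agreeP (Phi F : germ R 2) (B : germ R 1) : germ_ps B = (fX ord0 : fps R 1) ->
  agree Phi B F <-> germ_ps Phi = blow (germ_ps F).
Proof.
move=> BE.
have Bz (z : C) : eval B (pt 1 [:: z]) = z by rewrite BE evalX mxE.
have c01 : convergent (y0 * y1 : fps R 2) by rewrite y0y1E; exact: conv_mono.
have z01 : z0 (y0 * y1 : fps R 2) := y0y10.
have e01 x : eval (y0 * y1 : fps R 2) x = x 0 o20 * x 0 o21.
  rewrite y0y1E eval_mono /monom (bigD1 o20)//= (bigD1 o21)//= big1 ?mulr1 ?expr1//.
  by move=> -[[|[|i]] lti].
have nb : nearz (fun x : 'rV[C]_2 => eval (blow (germ_ps F)) x =
    eval F (pt 2 [:: x 0 o20; x 0 o20 * x 0 o21])).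
  apply: (nearz1 (near_comp2 (germP F) (conv_x o20) c01 (fX0 o20) z01)) => x.
  by rewrite evalX e01.
have cb : convergent (blow (germ_ps F)).
  apply: conv_comp; [exact: germP|move=> i; apply: conv_s2 => //; exact: conv_x|].
  by apply: s2_0 => //; exact: fX0.
split=> [/near3P[e e0 He]|PE].
  (* The hypothesis says nothing where z = 0, so the difference is multiplied by z, which can be
     cancelled formally. *)
  suff : y0 * (germ_ps Phi - blow (germ_ps F) : fps R 2) = 0.
    move=> E; apply/eqP; rewrite -subr_eq0; apply/eqP/funext => b.
    have := congr1 (fun f : fps R 2 => f (madd (m2 1 0) b)) E.
    by rewrite y0E coef_monoM.
  have cP := germP Phi.
  have cD : convergent (germ_ps Phi - blow (germ_ps F) : fps R 2).
    by apply: convD => //; exact: convN.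
  apply: near_eq0; first by apply: convM => //; exact: conv_x.
  have n1 : nearz (fun x : 'rV[C]_2 => x 0 o20 != 0 ->
      eval (germ_ps Phi) x = eval (germ_ps F) (pt 2 [:: x 0 o20; x 0 o20 * x 0 o21])).
    (* Agreement is used at (z, z t, t), and |t| < 1 keeps z t in range. *)
    exists (Num.min e 1) => [|x xe x0]; first by rewrite lt_min e0 ltr01.
    have xe' i : nr (x 0 i) < e /\ nr (x 0 i) < 1.
      by have := xe i; rewrite lt_min => /andP.
    have := He (pt 3 [:: x 0 o20; x 0 o20 * x 0 o21; x 0 o21]).
    rewrite !mxE /= !Bz -rV2E; apply => //; last by rewrite mulrAC divff ?mul1r.
    move=> i; rewrite mxE; case: i => -[|[|[|i]]] lti //=; first by have [] := xe' o20.
      rewrite nrM; have [a1 a2] := xe' o20; have [b1 b2] := xe' o21.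
      by rewrite (le_lt_trans _ a1)// ler_piMr ?nr_ge0// ltW.
    by have [] := xe' o21.
  have cZ := convZ (-1) cb.
  have := near_evalM (conv_x o20) cD; rewrite -scaleN1r => n2.
  apply: (nearz2 (nearzI n1 nb) (nearzI n2 (nearzI (near_evalD cP cZ) (near_evalZ (-1) cb)))).
  move=> x [E1 E2] [-> [-> ->]]; rewrite evalX.
  have [->|x0] := eqVneq (x 0 o20) 0; first by rewrite mul0r.
  by rewrite (E1 x0) E2 mulN1r subrr mulr0.
apply/near3P.
have [e e0 He] := nb; exists e; first exact: e0.
move=> x xe; rewrite Bz => x0 tE.
have xe' i : nr ((pt 2 [:: x 0 o30; x 0 o32] : 'rV[C]_2) 0 i) < e.
  by rewrite mxE; case: i => -[|[|i]] lti /=; [exact: xe|exact: xe|].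
have := He _ xe'; rewrite -PE !mxE /= tE mulrCA (divff x0) mulr1.
exact.
Qed.
End Translation.

(** * Complex derivatives of convergent series *)

Section Derivatives.
Context {R : realType}.
Notation C := (Cplx R).

Lemma nr_nat (k : nat) : nr (k%:R : C) = k%:R.
Proof. by apply: nrI; rewrite normr_nat (rmorph_nat (real_complex R)). Qed.

Definition m1 (k : nat) : 'I_1 -> nat := fun=> k.
Lemma m1E (b : 'I_1 -> nat) : b = m1 (b ord0).
Proof. by apply/funext => i; rewrite (ord1 i). Qed.
Lemma mdeg_m1 k : mdeg (m1 k) = k.
Proof. by rewrite /mdeg big_ord_recl big_ord0 addn0. Qed.

Definition df (f : fps R 1) : fps R 1 := fun b => (b ord0).+1%:R * f (m1 (b ord0).+1).

Lemma conv_reindex m n (f : fps R n) (sg : ('I_m -> nat) -> ('I_n -> nat)) (c : nat) :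
  (forall b, (mdeg (sg b) <= c * (mdeg b).+1)%N) -> convergent f ->
  convergent ((fun b => f (sg b)) : fps R m).
Proof. by move=> sc /convT cf; exact: (Tconv (tame_reindex sc cf)). Qed.

Lemma conv_scalecoef n (f : fps R n) (la : ('I_n -> nat) -> C) :
  (forall b, nr (la b) <= 2 ^+ mdeg b) -> convergent f ->
  convergent ((fun b => la b * f b) : fps R n).
Proof. by move=> lb /convT cf; exact: (Tconv (tame_scalecoef lb cf)). Qed.

Lemma conv_df f : convergent f -> convergent (df f).
Proof.
move=> cf; have cg : convergent ((fun b => f (m1 (b ord0).+1)) : fps R 1).
  apply: (conv_reindex (c := 1)) cf => b.
  by rewrite mdeg_m1 mul1n {2}(m1E b) mdeg_m1.
apply: (conv_scalecoef (la := fun b => (b ord0).+1%:R)) cg => b.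
by rewrite nr_nat {2}(m1E b) mdeg_m1 -natrX ler_nat ltn_expl.
Qed.

Lemma y00' : g0 (fun _ : 'I_1 => (y0 : fps R 2)). Proof. by move=> _; exact: fX0. Qed.
Lemma y010 : g0 (fun _ : 'I_1 => (y0 + y1 : fps R 2)).
Proof. by move=> _; apply: z0D; exact: fX0. Qed.

Lemma gpow1 n (g : fps R n) k : gpow (fun _ : 'I_1 => g) (m1 k) = g ^+ k.
Proof. by rewrite /gpow big_ord_recl big_ord0 mulr1. Qed.

(** The first order Taylor expansion, with the increment as second variable; the identity holds
    modulo its square, hence the bound on the index. *)
Lemma taylor2 (f : fps R 1) b : (b o21 < 2)%N ->
  comp f (fun=> y0 + y1) b = (comp f (fun=> y0) + y1 * comp (df f) (fun=> y0)) b.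
Proof.
pose mod2 (g : fps R 2) : fps R 2 := fun b => if (b o21 < 2)%N then g b else 0.
have mod2D g h : mod2 (g + h) = mod2 g + mod2 h.
  by apply/funext => c; rewrite coefD /mod2; case: ifP; rewrite ?addr0// coefD.
have dfD g h : df (g + h) = df g + df h.
  by apply/funext => c; rewrite coefD /df coefD mulrDr.
suff /(_ f) /(congr1 (fun g : fps R 2 => g b)) E :
    (fun f => mod2 (comp f (fun=> y0 + y1))) =1
    (fun f => mod2 (comp f (fun=> y0) + y1 * comp (df f) (fun=> y0))).
  by move=> b2; move: E; rewrite /mod2 b2.
apply: fps_ind => [g h|g h|c|c a].
- by rewrite compD mod2D.
- by rewrite !compD dfD compD mulrDr -mod2D addrACA.
- exists (mdeg c).+1 => g gN; rewrite /mod2; case: ifP => // _.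
  rewrite (comp_ord y010 gN)// coefD (comp_ord y00' gN)// add0r; split=> //.
  have dN : ordw (fun=> 1%N) (mdeg c) (df g).
    move=> d; rewrite wdeg1 {1}(m1E d) mdeg_m1 => dc.
    by rewrite /df gN ?mulr0// wdeg1 mdeg_m1.
  have yN : ordw (fun=> 1%N) 1 (y1 : fps R 2).
    by move=> d; rewrite wdeg1 ltnS leqn0 => /eqP/mdeg_eq0 ->; exact: fX0.
  have := ordwM yN (ordw_comp (w := fun=> 1%N) (g := fun=> y0) _ dN); apply.
    by move=> _ d; rewrite wdeg1 ltnS leqn0 => /eqP/mdeg_eq0 ->; exact: fX0.
  by rewrite wdeg1 add1n.
rewrite (m1E a); set k := a ord0.
have [W ->] : exists W : fps R 2, comp (c *: mono (m1 k)) (fun=> y0 + y1) =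
    comp (c *: mono (m1 k)) (fun=> y0) +
    y1 * comp (df (c *: mono (m1 k))) (fun=> y0) + mono (m2 0 2) * W.
  have [W E] : exists W : fps R 2,
      (y0 + y1) ^+ k = y0 ^+ k + (k%:R * (y0 ^+ k.-1 * y1) + y1 ^+ 2 * W) :> fps R 2.
    elim: k => [|k [W IH]]; first by exists 0; rewrite !expr0 mul0r mulr0 !addr0.
    exists (k%:R * y0 ^+ k.-1 + (y0 + y1) * W).
    rewrite exprS IH /= -natr1 [y0 ^+ k.+1]exprS.
    case: k IH => [|k] _ /=; first by rewrite expr0; ring.
    rewrite [y0 ^+ k.+1]exprS; move: (y0 ^+ k) (k.+1%:R : fps R 2) => A K; ring.
  exists (c *: W); rewrite !compZ !comp_mono; [|exact: y00'|exact: y010].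
  rewrite !gpow1 E.
  have -> : df (c *: mono (m1 k)) = (c * k%:R) *: mono (m1 k.-1).
    apply/funext => d; rewrite /df !coefZ /mono [in RHS](m1E d).
    have m1i i j : (m1 i == m1 j) = (i == j).
      by apply/eqP/eqP => [/funeqP/(_ ord0)|->].
    rewrite !m1i; case: k {E} => [|k /=].
      by rewrite mulr0 mul0r /= !mulr0.
    rewrite eqSS; case: eqP => [->|]; rewrite ?mulr0// !mulr1 mulrC//.
  rewrite compZ comp_mono; last exact: y00'.
  rewrite gpow1.
  have -> : mono (m2 0 2) = y1 ^+ 2 :> fps R 2.
    by rewrite y1E monoX; congr mono; apply/funext => -[[|[|q]] lti].
  rewrite !scalerDr addrA; congr (_ + _ + _); last by rewrite -scalerAr.
  by rewrite -scalerAr -scalerA mulr_natl scaler_nat [_ * y1]mulrC.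
apply/funext => d; rewrite /mod2; case: ifP => // d2; rewrite coefD.
by rewrite (coef_monoM0 _ (i := o21)) ?addr0.
Qed.

Lemma derive1_lim (f : C -> C) (a l : C) (M d : R) : 0 < d ->
  (forall h, h != 0 -> nr h < d -> nr (h^-1 * (f (h + a) - f a) - l) <= M * nr h) ->
  derive1 f a = l.
Proof.
move=> d0 H; apply: cvg_lim; first exact: norm_hausdorff.
apply/cvgrPdist_le => e /gt0_realP[r r0 ->].
pose s := Num.min d (r / (`|M| + 1)).
have s0 : 0 < s by rewrite lt_min d0 divr_gt0// ltr_wpDl.
have s0' : 0 < (s%:C)%C :> C by have := @ltcR R 0 s => ->.
rewrite /dnbhs; apply/nbhs_ballP; exists (s%:C)%C => // h.
rewrite -ball_normE /= sub0r normrN ltc_nr lt_min => /andP[hd hr] h0.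
rewrite lec_nr nrB (le_trans (H _ h0 hd))//.
apply: le_trans (_ : (`|M| + 1) * nr h <= _).
  by rewrite ler_wpM2r ?nr_ge0// (le_trans (ler_norm _))// lerDl.
by rewrite mulrC -ler_pdivlMr ?ltr_wpDl// ltW.
Qed.

Lemma derive1_near (f g : C -> C) (a : C) (d : R) : 0 < d ->
  (forall y, nr (y - a) < d -> f y = g y) -> derive1 f a = derive1 g a.
Proof.
move=> d0 H; rewrite !derive1E; apply: near_eq_derive.
have d0' : 0 < (d%:C)%C :> C by have := @ltcR R 0 d => ->.
apply/nbhs_ballP; exists (d%:C)%C => // y.
by rewrite -ball_normE /= distrC ltc_nr; exact: H.
Qed.

Lemma derive1_eval (f : fps R 1) : convergent f -> exists2 e : R, 0 < e &
  forall x, nr x < e -> derive1 (fun y => eval f (pt 1 [:: y])) x = eval (df f) (pt 1 [:: x]).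
Proof.
move=> cf; have cd := conv_df cf.
pose Rm : fps R 2 := comp f (fun=> y0 + y1) - (comp f (fun=> y0) + y1 * comp (df f) (fun=> y0)).
(* By [taylor2] the remainder is h^2 G; a bound M for G near 0 bounds the error of the difference
   quotient by M |h|. *)
pose G : fps R 2 := fun b => Rm (m2 (b o20) (b o21).+2).
have cy : convergent (y0 : fps R 2) by exact: conv_mono.
have cy1 : convergent (y1 : fps R 2) by exact: conv_mono.
have c1 : convergent (comp f (fun=> (y0 + y1 : fps R 2))).
  by apply: conv_comp => // [i|]; [exact: convD|exact: y010].
have c2 : convergent (comp f (fun=> (y0 : fps R 2))) by apply: conv_comp => //; exact: y00'.
have c3 : convergent (comp (df f) (fun=> (y0 : fps R 2))).
  by apply: conv_comp => //; exact: y00'.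
have cR : convergent Rm.
  by apply: convD => //; apply: convN; apply: convD => //; exact: convM.
have cG : convergent G.
  apply: (conv_reindex (c := 3)) cR => b; rewrite mdeg_m2 {3}(m2E b) mdeg_m2; lia.
have RmE : comp f (fun=> y0 + y1) =
    (comp f (fun=> y0) + y1 * comp (df f) (fun=> y0)) + mono (m2 0 2) * G.
  apply/funext => b; have [b2|b2] := leqP 2 (b o21); last first.
    by rewrite coefD (coef_monoM0 _ (i := o21))// addr0 taylor2.
  have bE : b = madd (m2 0 2) (m2 (b o20) (b o21 - 2)).
    by rewrite madd_m2 add0n subnKC// -m2E.
  rewrite coefD [in X in _ = _ + X]bE coef_monoM /G /Rm /=.
  have -> : m2 (b o20) (b o21 - 2).+2 = b.
    by rewrite [RHS]m2E; congr m2; rewrite -addn2 subnK.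
  set Bq : fps R 2 := comp f (fun=> y0) + _.
  have -> : (comp f (fun=> y0 + y1) - Bq) b = comp f (fun=> y0 + y1) b - Bq b by [].
  by rewrite [RHS]addrC subrK.
have ev1 n (g : fps R n) (x : 'rV[C]_n) : \row_(i < 1) eval g x = pt 1 [:: eval g x].
  by apply/rowP => i; rewrite !mxE (ord1 i).
have N1 := near_comp (f := f) (g := fun=> y0 + y1) cf (fun _ => convD cy cy1) y010.
have N2 := near_comp (f := f) (g := fun=> y0) cf (fun _ => cy) y00'.
have N3 := near_comp (f := df f) (g := fun=> y0) cd (fun _ => cy) y00'.
have N4 := near_evalD (convD c2 (convM cy1 c3)) (convM (conv_mono (m2 0 2)) cG).
have N5 := near_evalD c2 (convM cy1 c3).
have N6 := near_evalM cy1 c3.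
have N7 := near_evalM (conv_mono (m2 0 2)) cG.
have N8 := near_evalD cy cy1.
have [r [M [r0 GM]]] := (convergentP G).1 cG.
have N9 : nearz (fun x : 'rV[C]_2 => nr (eval G x) <= M).
  exists (r / 2) => [|x xr]; first by rewrite divr_gt0.
  by apply: (eval_bound (ltW r0) GM) => i; exact: ltW.
have [e e0 He] := nearzI (nearzI (nearzI N1 N2) (nearzI N3 N4))
  (nearzI (nearzI N5 N6) (nearzI N7 (nearzI N8 N9))).
exists e => // x xe; apply: (derive1_lim (M := M) e0) => h h0 he.
have xh i : nr ((pt 2 [:: x; h] : 'rV[C]_2) 0 i) < e.
  by rewrite mxE; case: i => -[|[|i]] lti.
have [[[E1 E2] [E3 E4]] [[E5 E6] [E7 [E8 E9]]]] := He _ xh.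
move: E1; rewrite RmE E4 E5 E6 E7 E2 E3 !ev1 E8 !evalX !mxE /= => E1.
have mE : eval (mono (m2 0 2) : fps R 2) (pt 2 [:: x; h]) = h ^+ 2.
  rewrite eval_mono /monom (bigD1 o20)//= (bigD1 o21)//= big1 ?mulr1; last first.
    by move=> -[[|[|i]] lti].
  by rewrite !mxE /= expr0 mul1r.
rewrite mE in E1; rewrite [h + x]addrC -E1.
set X := eval G _ in E9 *.
have -> : h^-1 * (eval f (pt 1 [:: x]) + h * eval (df f) (pt 1 [:: x]) + h ^+ 2 * X -
   eval f (pt 1 [:: x])) - eval (df f) (pt 1 [:: x]) = h * X by field.
by rewrite nrM mulrC ler_wpM2r ?nr_ge0.
Qed.

Lemma conv_iter_df f k : convergent f -> convergent (iter k df f).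
Proof. by move=> cf; elim: k => //= k; exact: conv_df. Qed.

Lemma pt1_0 : pt 1 [:: 0] = 0 :> 'rV[C]_1.
Proof. by apply/rowP => i; rewrite !mxE (ord1 i). Qed.

Lemma iter_df f k : iter k df f (m1 0) = (k`!)%:R * f (m1 k).
Proof.
elim: k f => [|k IH] f; first by rewrite mul1r.
by rewrite iterSr IH /df factS natrM mulrA [_.+1%:R * _]mulrC.
Qed.
End Derivatives.

(** * The determinant defining Omega1 *)

Section Levi.
Context {R : realType}.
Notation C := (Cplx R).

Definition X1 : fps R 1 := fX ord0.

Lemma X1_0 : z0 X1. Proof. exact: fX0. Qed.
Lemma s3X0 : g0 (s3 0 0 X1). Proof. by apply: s3_0 => //; exact: X1_0. Qed.

Lemma comp_X00 n (q : fps R 3) (X : fps R n) : (forall a, q (m3 a 0 0) = 0) ->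
  comp q (s3 X 0 0) = 0.
Proof.
move=> q0; apply/funext => b; rewrite /comp big1// => a _.
rewrite (m3E a) gpow_s3; case a1 : (a o31) => [|i].
  case a2 : (a o32) => [|j]; first by rewrite q0 mul0r.
  by rewrite [0 ^+ j.+1]exprS mul0r mulr0 coef_0 mulr0.
by rewrite [0 ^+ i.+1]exprS mul0r mulr0 mul0r coef_0 mulr0.
Qed.

Lemma coef_003 (f : fps R 3) i : comp f (s3 0 0 X1) (m1 i) = f (m3 0 0 i).
Proof.
pose L2 (f : fps R 3) : fps R 1 := fun b => f (m3 0 0 (b ord0)).
suff /(_ f) /(congr1 (fun g : fps R 1 => g (m1 i))) : (fun f => comp f (s3 0 0 X1)) =1 L2.
  by [].
apply: fps_ind => // [g h|c|c a].
- by rewrite compD.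
- exists (mdeg c).+1 => g gN; split; first exact: (comp_ord s3X0 gN).
  by apply: gN; rewrite wdeg1 mdeg_m3 {2}(m1E c) mdeg_m1.
apply/funext => b; rewrite compZ comp_mono; last exact: s3X0.
rewrite {1}(m3E a) gpow_s3 /L2 !coefZ; congr (_ * _).
have aE : mono a (m3 0 0 (b ord0)) =
    ((0 == a o30) && (0 == a o31) && (b ord0 == a o32))%N%:R :> C.
  rewrite /mono; congr (_%:R); congr nat_of_bool; apply/eqP/idP => [<- //|].
    by rewrite !eqxx.
  by move=> /andP[/andP[/eqP h0 /eqP h1] /eqP h2]; rewrite [RHS]m3E -h0 -h1 h2.
rewrite aE; case: (a o30) => [|?]; last by rewrite expr0n mul0r mul0r coef_0.
case: (a o31) => [|?]; last by rewrite expr0n [0 ^+ _]expr0n mulr0 mul0r coef_0.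
rewrite !expr0 !mul1r /= /X1 /fX monoX /mono; congr (_%:R); congr nat_of_bool.
by apply/eqP/eqP => [->|bE]; [rewrite muln1|apply/funext => t; rewrite (ord1 t) muln1].
Qed.

Lemma cof_comp (H : 'I_3 -> fps R 2) m n rho (Z W X T : fps R m) (g : 'I_m -> fps R n) :
  (forall k, z0 (H k)) -> z0 Z -> z0 W -> z0 X -> z0 T -> g0 g ->
  comp (cof H rho Z W X T) g = cof H rho (comp Z g) (comp W g) (comp X g) (comp T g).
Proof.
move=> H0 Zz Wz Xz Tz gz.
have hz k : z0 (Hof H Z W k) := Hof0 H0 k Zz Wz.
have hb k : z0 (Hbof H X T k) := Hbof0 H0 k Xz Tz.
rewrite /cof (comp_s33 _ hz hb gz); apply: eq_comp => i; rewrite /s33.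
by case: splitP => j _; rewrite comp_s2.
Qed.
Lemma cobar_comp (H : 'I_3 -> fps R 2) m n rho (Z W X T : fps R m) (g : 'I_m -> fps R n) :
  (forall k, z0 (H k)) -> z0 Z -> z0 W -> z0 X -> z0 T -> g0 g ->
  comp (cobar H rho Z W X T) g = cobar H rho (comp Z g) (comp W g) (comp X g) (comp T g).
Proof.
move=> H0 Zz Wz Xz Tz gz.
have hz k : z0 (Hof H Z W k) := Hof0 H0 k Zz Wz.
have hb k : z0 (Hbof H X T k) := Hbof0 H0 k Xz Tz.
rewrite /cobar (comp_s33 _ hb hz gz); apply: eq_comp => i; rewrite /s33.
by case: splitP => j _; rewrite comp_s2.
Qed.

(** Given a name so that it can be declared a ring morphism, which commutes with determinants. *)
Definition coef0 n (f : fps R n) : C := f (mi0 n).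
Lemma coef0_zmod n : zmod_morphism (@coef0 n). Proof. by []. Qed.
Lemma coef0_monoid n : monoid_morphism (@coef0 n).
Proof. by split=> [|f g]; [rewrite /coef0 coef1 eqxx|exact: coef0M]. Qed.
HB.instance Definition _ n := GRing.isZmodMorphism.Build (fps R n) C (@coef0 n) (@coef0_zmod n).
HB.instance Definition _ n := GRing.isMonoidMorphism.Build (fps R n) C (@coef0 n) (@coef0_monoid n).

Variables (r : 'I_3 -> 'I_3 -> germ R (3 + 3)) (iota : 'I_3 -> nat).
Variables (H : 'I_3 -> germ R 2) (Q : germ R 3).
Hypothesis H0 : forall k, z0 (gps H k).
Hypothesis nQ : normal_coord Q.

Let rr k j : fps R (3 + 3) := germ_ps (r k j).
Let q : fps R 3 := germ_ps Q.

(** The function to which L is applied in [Lmx], restricted to the chi-axis z = w = tau = 0. *)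
Definition G1 k j : fps R 1 := cof (gps H) (germ_ps (r k j)) 0 0 X1 0.

Lemma qz : z0 q. Proof. by have [] := normal_formal nQ. Qed.
Lemma q_a00 a : q (m3 a 0 0) = 0.
Proof. by have [_ n1 _ _] := normal_formal nQ; rewrite /q n1 andbF. Qed.
Lemma bq_a00 a : bar q (m3 a 0 0) = 0.
Proof. by rewrite /bar q_a00 rmorph0. Qed.

Lemma conv_G1 k j : convergent (G1 k j).
Proof.
exact: (conv_cof (conv0 1) (conv0 1) (conv_x ord0) (conv0 1) (z00 _) (z00 _) X1_0 (z00 _) H0).
Qed.

Lemma nr_pt1 (y : C) e : nr y < e -> forall i, nr ((pt 1 [:: y] : 'rV[C]_1) 0 i) < e.
Proof. by move=> ye i; rewrite mxE (ord1 i). Qed.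

(** On the chi-axis the coefficient of d/dtau is the derivative of conj Q(chi, 0, 0) = 0, so L acts
    there as d/dchi. *)
Lemma iter_Lfield k j p : exists2 e : R, 0 < e & forall y, nr y < e ->
  iter p (Lfield Q) (along (r k j) H) 0 0 y 0 = eval (iter p df (G1 k j)) (pt 1 [:: y]).
Proof.
have [e1 e10 He1] := near_cof (conv0 1) (conv0 1) (conv_x ord0) (conv0 1)
  (z00 _) (z00 _) X1_0 (z00 _) H0 (r k j).
have [e2 e20 He2] := near_comp3 (conv_bar (germP Q)) (conv_x (n := 1) ord0) (conv0 1) (conv0 1)
  X1_0 (z00 _) (z00 _).
elim: p => [|p [e e0 IH]].
  exists e1 => // y ye /=; have := He1 _ (nr_pt1 ye).
  by rewrite !eval_0 evalX mxE /= => <-.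
have [d d0 Hd] := derive1_eval (conv_iter_df p (conv_G1 k j)).
pose s := Num.min d (Num.min e e2).
have s0 : 0 < s by rewrite !lt_min d0 e0.
exists (s / 2) => [|y ys]; first by rewrite divr_gt0.
have near y' : nr (y' - y) < s / 2 -> nr y' < s.
  move=> yy; rewrite -[y'](subrK y) (le_lt_trans (nrD _ _))//.
  by rewrite [ltRHS]splitr ltrD.
have ys' : nr y < s by apply: near; rewrite subrr nr0 divr_gt0.
have s20 : 0 < s / 2 by rewrite divr_gt0.
rewrite iterS /Lfield.
have -> : derive1 (fun x : C => eval (bar Q) (pt 3 [:: x; 0; 0])) y = 0.
  rewrite (@derive1_near _ _ (fun=> 0) y _ s20) => [|y' /near].
    apply: (derive1_lim (M := 0) s20) => h _ _.
    by rewrite subrr mulr0 subrr nr0 mul0r.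
  rewrite !lt_min => /and3P[_ _ y'e2]; have := He2 _ (nr_pt1 y'e2).
  by rewrite comp_X00 ?eval_0 ?evalX ?mxE// => a; exact: bq_a00.
rewrite mul0r addr0 (@derive1_near _ _ (fun y => eval (iter p df (G1 k j)) (pt 1 [:: y])) y _ s20).
  by rewrite Hd//; move: ys'; rewrite !lt_min => /and3P[].
by move=> y' /near; rewrite !lt_min => /and3P[_ y'e _]; exact: IH.
Qed.

Lemma LmxE k j : Lmx r iota H Q k j = (iota k)`!%:R * G1 k j (m1 (iota k)).
Proof.
rewrite /Lmx mxE; have [e e0 He] := iter_Lfield k j (iota k).
by rewrite He ?nr0// pt1_0 eval0 -iter_df; congr (iter _ _ _ _).
Qed.

(** For z = chi = 0 both [Q0] and [T0] vanish identically in s, which leaves the restriction to the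
    axis of [G1]. *)
Lemma Amx1_coef0 k j : coef0 (Amx (M1 rr (gps H) q) iota k j) = G1 k j (m1 (iota k)).
Proof.
have x12z : z0 (x1 + x2 : fps R 3) := x120.
have gz := s3X0.
rewrite mxE /coef0 /slice -coef_003 /M1 (cof_comp _ H0 (fX0 _) (Q00 qz) x12z (T00 qz) gz).
congr (cof _ _ _ _ _ _ _).
- exact: (comp_x0 (z00 _) (z00 _) X1_0).
- rewrite /Q0 (comp_s3 _ (fX0 _) (fX0 _) (z00 _) gz) comp0.
  rewrite (comp_x0 (z00 _) (z00 _) X1_0) (comp_x1 (z00 _) (z00 _) X1_0).
  by rewrite comp_X00//; exact: q_a00.
- rewrite compD (comp_x1 (z00 _) (z00 _) X1_0) (comp_x2 (z00 _) (z00 _) X1_0).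
  by rewrite add0r.
- rewrite /T0 (comp_s3 _ x12z (fX0 _) (Q00 qz) gz).
  have -> : comp (Q0 q) (s3 0 0 X1) = 0.
    rewrite /Q0 (comp_s3 _ (fX0 _) (fX0 _) (z00 _) gz) comp0.
    rewrite (comp_x0 (z00 _) (z00 _) X1_0) (comp_x1 (z00 _) (z00 _) X1_0) comp_X00//.
    exact: q_a00.
  by rewrite (comp_x0 (z00 _) (z00 _) X1_0) comp_X00//; exact: bq_a00.
Qed.

(** Here s runs in the variable z, and [W0] vanishes for chi = tau = 0; exchanging H with its
    conjugate conjugates the coefficients of [G1]. *)
Lemma Amx2_coef0 k j : coef0 (Amx (M2 rr (gps H) q) iota k j) = (G1 k j (m1 (iota k)))^*.
Proof.
have gz := s3X0.
rewrite mxE /coef0 /slice -coef_003 /M2.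
rewrite (cobar_comp _ H0 (fX0 _) (W00 qz) (fX0 _) (fX0 _) gz).
rewrite (comp_x2 (z00 _) (z00 _) X1_0) (comp_x0 (z00 _) (z00 _) X1_0).
rewrite (comp_x1 (z00 _) (z00 _) X1_0).
have -> : comp (W0 q) (s3 0 0 X1) = 0.
  rewrite /W0 (comp_s3 _ (fX0 _) (fX0 _) (fX0 _) gz).
  rewrite (comp_x2 (z00 _) (z00 _) X1_0) (comp_x0 (z00 _) (z00 _) X1_0).
  by rewrite (comp_x1 (z00 _) (z00 _) X1_0) comp_X00//; exact: q_a00.
rewrite -[RHS]/(bar (G1 k j) _) /G1 /cof bar_comp; congr (comp _ _ _).
have bX : bar X1 = X1 by exact: bar_mono.
apply/funext => i; rewrite /s33; case: splitP => l _.
  rewrite /Hof /Hbof bar_comp; apply: eq_comp => -[[|[|t]] lt] //=; exact/esym/bar0.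
rewrite /Hof /Hbof bar_comp barK; apply: eq_comp => -[[|[|t]] lt] //=.
exact/esym/bar0.
Qed.

Lemma det_neq0 : \det (Lmx r iota H Q) != 0 ->
  det1 rr iota (gps H) q (mi0 2) != 0 /\ det2 rr iota (gps H) q (mi0 2) != 0.
Proof.
pose g : 'M[C]_3 := \matrix_(k, j) G1 k j (m1 (iota k)).
have -> : Lmx r iota H Q = diag_mx (\row_k (iota k)`!%:R) *m g.
  by apply/matrixP => k j; rewrite mul_diag_mx !mxE -LmxE mxE.
rewrite det_mulmx mulf_eq0 negb_or => /andP[_ g0].
have -> : det1 rr iota (gps H) q (mi0 2) = \det g.
  rewrite -[LHS]/(coef0 _) /det1 -det_map_mx; congr (\det _).
  by apply/matrixP => k j; rewrite [RHS]mxE -Amx1_coef0; exact: mxE.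
have -> : det2 rr iota (gps H) q (mi0 2) = (\det g)^*.
  rewrite -[LHS]/(coef0 _) /det2 -det_map_mx -[RHS]det_map_mx; congr (\det _).
  apply/matrixP => k j; transitivity ((G1 k j (m1 (iota k)))^*); last by rewrite !mxE.
  by rewrite -Amx2_coef0; exact: mxE.
by rewrite conjC_eq0.
Qed.
End Levi.

(** * Dependence on the parameters *)

Section JetCoefficients.
Context {R : realType}.
Notation C := (Cplx R).

(* Indices of the joint Taylor coefficients of H and Q. *)
Definition pidx : Type := ('I_3 * ('I_2 -> nat)) + ('I_3 -> nat).
Definition pdeg (i : pidx) : nat :=
  match i with inl ka => mdeg ka.2 | inr a => mdeg a end.
Notation P := (pidx -> C).
Definition Hp (p : P) : 'I_3 -> fps R 2 := fun k a => p (inl (k, a)).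
Definition Qp (p : P) : fps R 3 := fun a => p (inr a).

(* In normal coordinates Q(z, chi, 0) = z chi normal_quotient(z, chi). *)
Definition normal_quotient (Q : fps R 3) : fps R 2 := fun b => Q (m3 (b o20).+1 (b o21).+1 0).

(** The basis dual to the jet coordinates; these are derivatives, so the factorials are divided
    out. *)
Definition jet_poly (j : jidx) : 'I_3 -> fps R 2 := fun h =>
  if h == (val j).1.1 then
    ((((val j).1.2)`! * ((val j).2)`!)%N%:R)^-1 *: mono (m2 (val j).1.2 (val j).2)
  else 0.

Variables (r : 'I_3 -> 'I_3 -> fps R (3 + 3)) (iota : 'I_3 -> nat).
Hypothesis cr : forall k j, convergent (r k j).

Definition PhiF H Q j := S1 r iota H Q (S2 r iota H Q (jet_poly j)).
Definition PsiF H Q j l : fps R 2 := lagr (normal_quotient Q) (PhiF H Q j l).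
(** The only possible F with F(z, z t) = Psi(z, t), written down whether or not it is one, so that K
    is defined for every jet. *)
Definition KF H Q j l : fps R 2 := fun b => PsiF H Q j l (m2 (b o20 + b o21) (b o21)).

Section Domain.
Variables (D : set P) (p0 : P).
Hypothesis D0 : D p0.
Hypothesis DH : forall p, D p -> forall k, z0 (Hp p k).
Hypothesis DQ : forall p, D p -> z0 (Qp p).
Notation tame := (tame pdeg D p0).

Lemma tame_coords n (F : P -> fps R n) (i : ('I_n -> nat) -> pidx) :
  (forall p a, F p a = p (i a)) -> (forall a, pdeg (i a) = mdeg a) -> tame F.
Proof.
move=> FE iE; split=> [b|rho rho0].
  by under eq_fun do rewrite FE; exact: tameS_coord.
have r1 : 0 < rho + 1 by rewrite ltr_wpDl.
exists ((rho + 1)^-1 / 2), (2 ^+ n * rho); split; first by rewrite divr_gt0// invr_gt0.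
move=> p Dp bp; apply: nle_of_coef => // [|a]; first by rewrite invr_ge0 ltW.
rewrite FE exprVn ler_pdivrMr ?exprn_gt0// (le_trans (bp _))// iE exprS.
by rewrite ler_wpM2l// lerXn2r ?nnegrE ?(ltW r1)// lerDl.
Qed.

Lemma tame_H k : tame (fun p => Hp p k).
Proof. exact: (@tame_coords _ _ (fun a => inl (k, a))). Qed.
Lemma tame_Q : tame Qp.
Proof. exact: (@tame_coords _ _ inr). Qed.

Lemma tame_x n (i : 'I_n) : tame (fun=> fX i). Proof. exact: tame_mono. Qed.
Lemma tame_0 n : tame (fun=> (0 : fps R n)).
Proof. by apply: tame_cst; exact: conv0. Qed.

Section Along.
Variable n : nat.
Variables (Z W X T : P -> fps R n).
Hypotheses (tZ : tame Z) (tW : tame W) (tX : tame X) (tT : tame T).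
Hypotheses (zZ : forall p, D p -> z0 (Z p)) (zW : forall p, D p -> z0 (W p))
  (zX : forall p, D p -> z0 (X p)) (zT : forall p, D p -> z0 (T p)).

Lemma tame_comp2 (F : P -> fps R 2) : tame F -> tame (fun p => comp (F p) (s2 (Z p) (W p))).
Proof.
move=> tF; apply: (tame_comp (G := fun i p => s2 (Z p) (W p) i) tF).
  by move=> -[[|[|i]] lti].
by move=> p i Dp; apply: s2_0; [exact: zZ|exact: zW].
Qed.
Lemma tame_comp3 (F : P -> fps R 3) : tame F ->
  tame (fun p => comp (F p) (s3 (Z p) (W p) (X p))).
Proof.
move=> tF; apply: (tame_comp (G := fun i p => s3 (Z p) (W p) (X p) i) tF).
  by move=> -[[|[|[|i]]] lti].
by move=> p i Dp; apply: s3_0; [exact: zZ|exact: zW|exact: zX].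
Qed.
End Along.

Section Along2.
Variable n : nat.
Variables (Z W X T : P -> fps R n).
Hypotheses (tZ : tame Z) (tW : tame W) (tX : tame X) (tT : tame T).
Hypotheses (zZ : forall p, D p -> z0 (Z p)) (zW : forall p, D p -> z0 (W p))
  (zX : forall p, D p -> z0 (X p)) (zT : forall p, D p -> z0 (T p)).

Lemma tame_Hof k : tame (fun p => Hof (Hp p) (Z p) (W p) k).
Proof. exact: (tame_comp2 tZ tW zZ zW (tame_H k)). Qed.
Lemma tame_Hbof k : tame (fun p => Hbof (Hp p) (X p) (T p) k).
Proof. exact: (tame_comp2 tX tT zX zT (tameJ (tame_H k))). Qed.

Lemma tame_cof rho : convergent rho ->
  tame (fun p => cof (Hp p) rho (Z p) (W p) (X p) (T p)).
Proof.
move=> crho; apply: (tame_comp (F := fun=> rho) (G := fun i p =>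
  s33 (Hof (Hp p) (Z p) (W p)) (Hbof (Hp p) (X p) (T p)) i)).
- exact: tame_cst.
- by move=> i; rewrite /s33; case: splitP => j _; [exact: tame_Hof|exact: tame_Hbof].
- move=> p i Dp; apply: s33_0 => k.
    by apply: Hof0; [exact: DH|exact: zZ|exact: zW].
  by apply: Hbof0; [exact: DH|exact: zX|exact: zT].
Qed.
Lemma tame_cobar rho : convergent rho ->
  tame (fun p => cobar (Hp p) rho (Z p) (W p) (X p) (T p)).
Proof.
move=> crho; apply: (tame_comp (F := fun=> bar rho) (G := fun i p =>
  s33 (Hbof (Hp p) (X p) (T p)) (Hof (Hp p) (Z p) (W p)) i)).
- exact/tame_cst/conv_bar.
- by move=> i; rewrite /s33; case: splitP => j _; [exact: tame_Hbof|exact: tame_Hof].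
- move=> p i Dp; apply: s33_0 => k.
    by apply: Hbof0; [exact: DH|exact: zX|exact: zT].
  by apply: Hof0; [exact: DH|exact: zZ|exact: zW].
Qed.
End Along2.

Let zx n (i : 'I_n) (p : P) : D p -> z0 (fX i : fps R n). Proof. by move=> _; exact: fX0. Qed.
Let zx12 (p : P) : D p -> z0 (x1 + x2 : fps R 3). Proof. by move=> _; exact: x120. Qed.

Lemma tame_x12 : tame (fun=> (x1 + x2 : fps R 3)).
Proof. exact: (tameD (tame_x o31) (tame_x o32)). Qed.
Lemma tame_Q0 : tame (fun p => Q0 (Qp p)).
Proof.
by apply: (tame_comp3 (tame_x o30) (tame_x o31) (tame_0 3) (zx o30) (zx o31) _ tame_Q).
Qed.
Lemma zQ0 p : D p -> z0 (Q0 (Qp p)). Proof. by move=> Dp; apply/Q00/DQ. Qed.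
Lemma tame_T0 : tame (fun p => T0 (Qp p)).
Proof.
exact: (tame_comp3 tame_x12 (tame_x o30) tame_Q0 zx12 (zx o30) zQ0 (tameJ tame_Q)).
Qed.
Lemma zT0 p : D p -> z0 (T0 (Qp p)). Proof. by move=> Dp; apply/T00/DQ. Qed.
Lemma tame_W0 : tame (fun p => W0 (Qp p)).
Proof.
exact: (tame_comp3 (tame_x o32) (tame_x o30) (tame_x o31) (zx o32) (zx o30) (zx o31) tame_Q).
Qed.
Lemma zW0 p : D p -> z0 (W0 (Qp p)). Proof. by move=> Dp; apply/W00/DQ. Qed.

Lemma tame_M1 k j : tame (fun p => M1 r (Hp p) (Qp p) k j).
Proof.
exact: (tame_cof (tame_x o30) tame_Q0 tame_x12 tame_T0 (zx o30) zQ0 zx12 zT0 (cr k j)).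
Qed.
Lemma tame_N1 k j : tame (fun p => N1 r (Hp p) (Qp p) k j).
Proof.
exact: (tame_cobar (tame_x o30) tame_Q0 tame_x12 tame_T0 (zx o30) zQ0 zx12 zT0 (cr k j)).
Qed.
Lemma tame_M2 k j : tame (fun p => M2 r (Hp p) (Qp p) k j).
Proof.
exact: (tame_cobar (tame_x o32) tame_W0 (tame_x o30) (tame_x o31) (zx o32) zW0 (zx o30)
  (zx o31) (cr k j)).
Qed.
Lemma tame_N2 k j : tame (fun p => N2 r (Hp p) (Qp p) k j).
Proof.
exact: (tame_cof (tame_x o32) tame_W0 (tame_x o30) (tame_x o31) (zx o32) zW0 (zx o30)
  (zx o31) (cr k j)).
Qed.

Lemma tame_slice (F : P -> fps R 3) i : tame F -> tame (fun p => slice i (F p)).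
Proof.
apply: (tame_reindex (c := i.+1)) => b.
by rewrite mdeg_m3 {3}(m2E b) mdeg_m2; nia.
Qed.

Lemma tame_det n (M : P -> 'M[fps R 2]_n) : (forall k j, tame (fun p => M p k j)) ->
  tame (fun p => \det (M p)).
Proof.
move=> tM; rewrite /determinant; apply: tame_sum => s _.
by apply: tameM; [apply/tameX/tameN/tame_one|apply: tame_prod => i _].
Qed.

Lemma tame_adj (M : P -> 'M[fps R 2]_3) : (forall k j, tame (fun p => M p k j)) ->
  forall k j, tame (fun p => \adj (M p) k j).
Proof.
move=> tM k j; under eq_fun do rewrite mxE /cofactor.
apply: tameM; first exact/tameX/tameN/tame_one.
by apply: tame_det => k' j'; under eq_fun do rewrite !mxE.
Qed.

Lemma tame_Amx (M : P -> 'I_3 -> 'I_3 -> fps R 3) : (forall k j, tame (fun p => M p k j)) ->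
  forall k j, tame (fun p => Amx (M p) iota k j).
Proof. by move=> tM k j; under eq_fun do rewrite mxE; exact: tame_slice. Qed.

Lemma tame_det1F : tame (fun p => det1 r iota (Hp p) (Qp p)).
Proof. by apply: tame_det; apply: tame_Amx; exact: tame_M1. Qed.
Lemma tame_det2F : tame (fun p => det2 r iota (Hp p) (Qp p)).
Proof. by apply: tame_det; apply: tame_Amx; exact: tame_M2. Qed.

Lemma tame_u : tame (fun p => normal_quotient (Qp p)).
Proof.
apply: (tame_reindex (c := 2)) tame_Q => b.
by rewrite mdeg_m3 {3}(m2E b) mdeg_m2; lia.
Qed.

Lemma tame_solve (M N : P -> 'I_3 -> 'I_3 -> fps R 3) (ga : P -> 'I_3 -> fps R 3) (d : R) l :
  (forall k j, tame (fun p => M p k j)) -> (forall k j, tame (fun p => N p k j)) ->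
  (forall j, tame (fun p => ga p j)) -> 0 < d ->
  (forall p, D p -> d <= nr (\det (Amx (M p) iota) (mi0 2))) ->
  tame (fun p => solve (M p) (N p) iota (ga p) l).
Proof.
move=> tM tN tg d0 Md; have tA := tame_Amx tM.
apply: tameM; first exact: (tame_finv D0 d0 Md (tame_det tA)).
apply: tame_sum => k _; apply: tameM; first exact: tame_adj.
apply/tameN/tame_slice/tame_sum => j _; apply: tameM; [exact: tN|exact: tg].
Qed.

Section Bounds.
Variable d : R.
Hypothesis d0 : 0 < d.
Hypothesis Dd1 : forall p, D p -> d <= nr (det1 r iota (Hp p) (Qp p) (mi0 2)).
Hypothesis Dd2 : forall p, D p -> d <= nr (det2 r iota (Hp p) (Qp p) (mi0 2)).
Hypothesis Du : forall p, D p -> d <= nr (normal_quotient (Qp p) (mi0 2)).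

Lemma tame_jet_poly j h : tame (fun=> jet_poly j h).
Proof.
apply: tame_cst; rewrite /jet_poly; case: ifP => _; last exact: conv0.
exact/convZ/conv_mono.
Qed.

Lemma tame_PhiF j l : tame (fun p => PhiF (Hp p) (Qp p) j l).
Proof.
apply: (tame_solve l tame_M1 tame_N1 _ d0 Dd1) => i.
apply: (tame_comp2 tame_x12 tame_T0 zx12 zT0).
apply: (tame_solve i tame_M2 tame_N2 _ d0 Dd2) => h.
exact: (tame_comp2 (tame_x o32) tame_W0 (zx o32) zW0 (tame_jet_poly j h)).
Qed.

Lemma tame_theta (F : P -> fps R 2) : tame F -> tame (fun p => theta (F p)).
Proof.
apply: (tame_scalecoef (la := fun b => (b o21)%:R)) => b.
rewrite nr_nat -natrX ler_nat (leq_trans _ (ltnW (ltn_expl (mdeg b) _)))//.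
exact: leq_mdeg.
Qed.

Lemma tame_PsiF j l : tame (fun p => PsiF (Hp p) (Qp p) j l).
Proof.
apply: (tame_diag (e := fun b => (b o21).+1)).
- by move=> b; rewrite ltnS leq_mdeg.
- apply: (tameM (tame_PhiF j l)).
  exact: (tameD tame_u (tame_theta tame_u)).
- exact: (tame_finv D0 d0 Du tame_u).
Qed.

Lemma tame_KF j l : tame (fun p => KF (Hp p) (Qp p) j l).
Proof.
apply: (tame_reindex (c := 2)) (tame_PsiF j l) => b.
by rewrite mdeg_m2 {4}(m2E b) mdeg_m2; lia.
Qed.

(* The summands of Eq that are linear, respectively antilinear, in the jet. *)
Definition EqL rho H Q j : fps R 3 := \sum_i (cof H (rho i) x0 Q x1 x2 *
  comp (KF H Q j i) (s2 x0 Q)).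
Definition EqA rho H Q j : fps R 3 := \sum_i (cobar H (rho i) x0 Q x1 x2 *
  comp (bar (KF H Q j i)) (s2 x1 x2)).

Lemma tame_EqL (rho : 'I_3 -> fps R (3 + 3)) j : (forall i, convergent (rho i)) ->
  tame (fun p => EqL rho (Hp p) (Qp p) j).
Proof.
move=> crho; apply: tame_sum => i _; apply: tameM.
  exact: (tame_cof (tame_x o30) tame_Q (tame_x o31) (tame_x o32) (zx o30) DQ (zx o31) (zx o32)).
exact: (tame_comp2 (tame_x o30) tame_Q (zx o30) DQ (tame_KF j i)).
Qed.
Lemma tame_EqA (rho : 'I_3 -> fps R (3 + 3)) j : (forall i, convergent (rho i)) ->
  tame (fun p => EqA rho (Hp p) (Qp p) j).
Proof.
move=> crho; apply: tame_sum => i _; apply: tameM.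
  exact: (tame_cobar (tame_x o30) tame_Q (tame_x o31) (tame_x o32) (zx o30) DQ (zx o31) (zx o32)).
exact: (tame_comp2 (tame_x o31) (tame_x o32) (zx o31) (zx o32) (tameJ (tame_KF j i))).
Qed.
End Bounds.
End Domain.
End JetCoefficients.

(** * Continuity on Omega1 x Omega2 *)

Section ParameterContinuity.
Context {R : realType}.
Notation C := (Cplx R).
Notation P := (pidx -> C).
Variables (r : 'I_3 -> 'I_3 -> germ R (3 + 3)) (iota : 'I_3 -> nat).
Let rr k j : fps R (3 + 3) := germ_ps (r k j).
Let cr k j : convergent (rr k j). Proof. exact: germP. Qed.

Definition toP (p : germ3 R * germ R 3) : P := fun i =>
  match i with inl ka => germ_ps (p.1 ka.1) ka.2 | inr a => germ_ps p.2 a end.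

Definition admissible0 : set P := [set p | (forall k, z0 (Hp p k)) /\ z0 (Qp p)].
(** The fixed d bounds the three inverses uniformly. The constant terms involved depend on finitely
    many degrees of p, so that tails of p can be replaced inside this set ([admissible_agree]). *)
Definition admissible (d : R) : set P := [set p | [/\ admissible0 p,
  d <= nr (det1 rr iota (Hp p) (Qp p) (mi0 2)),
  d <= nr (det2 rr iota (Hp p) (Qp p) (mi0 2)) & d <= nr (normal_quotient (Qp p) (mi0 2))]].

Let DbH p : admissible0 p -> forall k, z0 (Hp p k). Proof. by case. Qed.
Let DbQ p : admissible0 p -> z0 (Qp p). Proof. by case. Qed.

Lemma half_le (d x : R) : 0 < d -> d <= x / 2 -> d <= x.
Proof. by move=> d0 dx; lra. Qed.

Lemma third_min (a b c : R) : 0 < a -> 0 < b -> 0 < c ->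
  exists d, [/\ 0 < d, d <= a / 2, d <= b / 2 & d <= c / 2].
Proof.
move=> a0 b0 c0; exists (Num.min a (Num.min b c) / 2).
by rewrite divr_gt0 ?lt_min ?a0 ?b0//; split=> //; rewrite ler_pM2r ?invr_gt0// !ge_min lexx ?orbT.
Qed.

(** The determinants involve no inverse, so they are tame already on [admissible0]; by continuity
    they keep at least half of their size near p0. *)
Lemma admissible_near (p0 : P) : admissible0 p0 -> det1 rr iota (Hp p0) (Qp p0) (mi0 2) != 0 ->
  det2 rr iota (Hp p0) (Qp p0) (mi0 2) != 0 -> normal_quotient (Qp p0) (mi0 2) != 0 ->
  exists d : R, [/\ 0 < d, admissible d p0 & exists N (e : R), 0 < e /\ forall p, admissible0 p ->
    (forall i, (pdeg i <= N)%N -> nr (p i - p0 i) <= e) -> admissible d p].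
Proof.
move=> D0 d1 d2 d3.
have [_ c1] := (tame_det1F iota cr p0 DbH DbQ).1 (mi0 2).
have [_ c2] := (tame_det2F iota cr p0 DbH DbQ).1 (mi0 2).
have [_ c3] := (tame_u admissible0 p0).1 (mi0 2).
have low (phi : P -> C) (d : R) : phi p0 != 0 -> d <= nr (phi p0) / 2 ->
    phi @ coefw pdeg admissible0 p0 --> phi p0 ->
    coefw pdeg admissible0 p0 [set p | d <= nr (phi p)].
  move=> phi0 dphi /cvgrPdist_le/(_ ((nr (phi p0) / 2)%:C)%C).
  have n0 : 0 < nr (phi p0) / 2 by rewrite divr_gt0// lt0r nr_eq0 phi0 nr_ge0.
  have -> : 0 < ((nr (phi p0) / 2)%:C)%C :> C.
    by have := @ltcR R 0 (nr (phi p0) / 2) => ->.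
  move=> /(_ isT); apply: filterS => p; rewrite lec_nr => H.
  apply: le_trans dphi _; have := nrD (phi p0 - phi p) (phi p); rewrite subrK.
  move: H; set a := nr (phi p0 - phi p); set b := nr (phi p0); set c := nr (phi p).
  by move=> h1 h2; lra.
have pos (x : C) : x != 0 -> 0 < nr x by move=> x0; rewrite lt0r nr_eq0 x0 nr_ge0.
have [d [dpos h1 h2 h3]] := third_min (pos _ d1) (pos _ d2) (pos _ d3).
have hh x : d <= x / 2 -> d <= x := half_le dpos.
exists d; split; [exact: dpos| |].
  exact: (And4 D0 (hh _ h1) (hh _ h2) (hh _ h3)).
have [N [e [e0 He]]] := filterI (low _ _ d1 h1 c1) (filterI (low _ _ d2 h2 c2) (low _ _ d3 h3 c3)).
exists N, e; split; first exact: e0.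
by move=> p Dp Hp'; have [a1 [a2 a3]] := He p Dp Hp'; exact: (And4 Dp a1 a2 a3).
Qed.

Lemma admissible_agree d p0 : admissible d p0 ->
  exists N0, forall p q, admissible d p -> agree_upto pdeg N0 p q -> admissible d q.
Proof.
move=> [D0 _ _ _].
have [[N1 H1] _] := (tame_det1F iota cr p0 DbH DbQ).1 (mi0 2).
have [[N2 H2] _] := (tame_det2F iota cr p0 DbH DbQ).1 (mi0 2).
have [[N3 H3] _] := (tame_u admissible0 p0).1 (mi0 2).
exists (maxn N1 (maxn N2 N3)) => p q [Dp p1 p2 p3] pq.
have pd i : pdeg i = 0%N -> p i = q i by move=> H; apply: pq; rewrite H.
have Dq : admissible0 q.
  have [pH pQ] := Dp; split=> [k|].
    by rewrite /z0 /Hp -(pd (inl (k, mi0 2)) (mdeg0 _)); exact: pH.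
  by rewrite /z0 /Qp -(pd (inr (mi0 3)) (mdeg0 _)); exact: pQ.
have le N : (N <= maxn N1 (maxn N2 N3))%N -> agree_upto pdeg N p q.
  by move=> NM i /leq_trans/(_ NM); exact: pq.
have l2 : (N2 <= maxn N1 (maxn N2 N3))%N by rewrite leq_max leq_maxl orbT.
have l3 : (N3 <= maxn N1 (maxn N2 N3))%N by rewrite leq_max leq_maxr orbT.
split; first exact: Dq.
- by rewrite -(H1 p q Dp Dq (le _ (leq_maxl _ _))); exact: p1.
- by rewrite -(H2 p q Dp Dq (le _ l2)); exact: p2.
- by rewrite -(H3 p q Dp Dq (le _ l3)); exact: p3.
Qed.

Lemma toP_bdd p : exists2 rho : R, 0 <= rho & bdd pdeg rho (toP p).
Proof.
have /choice[f Hf] (k : 'I_3) : exists rho : R, 0 <= rho /\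
    forall a, nr (germ_ps (p.1 k) a) <= rho ^+ (mdeg a).+1.
  by have [rho ? ?] := germ_bound (p.1 k); exists rho.
have [s s0 Hs] := germ_bound p.2.
have S0 : 0 <= \sum_k f k by apply: sumr_ge0 => k _; have [] := Hf k.
exists (\sum_k f k + s) => [|[[k a]|a]]; first by rewrite addr_ge0.
  have [f0 fk] := Hf k; rewrite /= (le_trans (fk a))//.
  rewrite lerXn2r ?nnegrE ?addr_ge0// (bigD1 k)//= -addrA lerDl addr_ge0//.
  by apply: sumr_ge0 => i _; have [] := Hf i.
by rewrite /= (le_trans (Hs a))// lerXn2r ?nnegrE ?addr_ge0// lerDr.
Qed.

Lemma nbhs_toP p0 mu : superexp mu ->
  nbhs p0 [set p | forall i, nr (toP p i - toP p0 i) <= mu (pdeg i)].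
Proof.
move=> muS.
have HQ : nbhs p0.2 [set Q : germ R 3 |
    forall a, nr (germ_ps Q a - germ_ps p0.2 a) <= mu (mdeg a)].
  exact: (nbhs_superexp muS).
have HH : nbhs p0.1 [set H : germ3 R | forall k a,
    nr (germ_ps (H k) a - germ_ps (p0.1 k) a) <= mu (mdeg a)].
  have FF : Filter (nbhs (p0.1 : germ3 R)) := nbhs_filter _.
  apply: (filter_forall FF) => k.
  have pc := @proj_continuous 'I_3 (fun=> germ R 2) k p0.1.
  exact: (pc _ (nbhs_superexp muS (fun _ h => h))).
exists ([set H : germ3 R | forall k a,
    nr (germ_ps (H k) a - germ_ps (p0.1 k) a) <= mu (mdeg a)],
  [set Q : germ R 3 | forall a, nr (germ_ps Q a - germ_ps p0.2 a) <= mu (mdeg a)]).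
  by split.
by move=> p [/= h1 h2] [[k a]|a] /=; [exact: h1|exact: h2].
Qed.

(** Lowering finitely many values keeps a weight superexponential; one weight can thus also enforce
    closeness in low degrees. *)
Lemma superexp_cut mu N (e : R) : superexp mu -> 0 < e -> exists2 mu', superexp mu' &
  (forall l, mu' l <= mu l) /\ forall l, (l <= N)%N -> mu' l <= e.
Proof.
move=> [mu0 muP] e0; exists (fun l => if (l <= N)%N then Num.min (mu l) e else mu l).
  split=> [l|rho /muP[K HK]]; first by case: ifP => _ //; rewrite lt_min mu0.
  exists (maxn K N.+1) => l; rewrite geq_max => /andP[Kl Nl].
  by rewrite leqNgt Nl /= HK.
split=> l; first by case: ifP => // _; rewrite ge_min lexx.
by move=> ->; rewrite ge_min lexx orbT.
Qed.

Lemma superexp_exists : exists mu : nat -> R, superexp mu.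
Proof.
exists (fun l => l.+1%:R ^+ l); split=> [l|rho rho0]; first by rewrite exprn_gt0.
exists (Num.bound rho) => l rl; rewrite lerXn2r ?nnegrE//.
by rewrite (le_trans (ltW (archi_boundP rho0)))// ler_nat (leq_trans rl).
Qed.

Let Om := Omega1 r iota `*` @Omega2 R.

Lemma Om_good p : Om p -> [/\ admissible0 (toP p),
  det1 rr iota (Hp (toP p)) (Qp (toP p)) (mi0 2) != 0,
  det2 rr iota (Hp (toP p)) (Qp (toP p)) (mi0 2) != 0 &
  normal_quotient (Qp (toP p)) (mi0 2) != 0].
Proof.
move=> [[H0 Hd] [nQ Q11]].
have Hz k : z0 (gps p.1 k).
  have := congr1 (fun v : 'rV[C]_3 => v 0 k) H0; rewrite !mxE eval0; exact.
have [Qz _ _ _] := normal_formal nQ.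
have [d1 d2] := det_neq0 Hz nQ (Hd _ nQ).
split=> //.
apply: contra_neq Q11 => u0; rewrite /partial0 -[X in _ * X]/(germ_ps p.2 (m3 1 1 0)).
by rewrite [germ_ps _ _]u0 mulr0.
Qed.

Lemma Om_domain p0 : Om p0 -> exists d : R, [/\ 0 < d, admissible d (toP p0) &
  exists N (e : R), 0 < e /\ forall p, Om p ->
    (forall i, (pdeg i <= N)%N -> nr (toP p i - toP p0 i) <= e) -> admissible d (toP p)].
Proof.
move=> /Om_good[D0 d1 d2 d3]; have [d [dpos Dp [N [e [e0 He]]]]] := admissible_near D0 d1 d2 d3.
exists d; split=> //; exists N, e; split=> // p /Om_good[Db _ _ _].
exact: He.
Qed.

(** Near p0 the points of [Om] stay in one set [admissible d], where [tame_continuous] supplies a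
    weight; both requirements are merged by [superexp_cut]. *)
Lemma cont_germ n (G : germ3 R * germ R 3 -> germ R n) (F : P -> fps R n) :
  (forall p, Om p -> germ_ps (G p) = F (toP p)) ->
  (forall d p0, 0 < d -> admissible d p0 -> tame pdeg (admissible d) p0 F) ->
  {within Om, continuous G}.
Proof.
move=> GF FT; apply/subspace_continuousP => p0 Op0 A /nbhs_superexpP[mu' muS HA].
have [d [d0 Dp0 [N [e [e0 He]]]]] := Om_domain Op0.
have [FC FU] := FT _ _ d0 Dp0.
have [rho0 rho00 bp0] := toP_bdd p0.
have [mu mS Hmu] := tame_continuous Dp0 FC FU rho00 bp0 (admissible_agree Dp0) muS.
have [nu nS [nu1 nu2]] := superexp_cut N mS e0.
apply: filterS (nbhs_toP p0 nS) => p Hp Op.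
apply: HA => a; rewrite !GF//; apply: Hmu.
- by apply: He => // i iN; rewrite (le_trans (Hp i))// nu2.
- exact: toP_bdd.
- by move=> i; rewrite (le_trans (Hp i)).
Qed.

Lemma cont_scalar (phi : P -> C) :
  (forall d p0, 0 < d -> admissible d p0 -> tameS pdeg (admissible d) p0 phi) ->
  {within Om, continuous (fun p => phi (toP p))}.
Proof.
move=> FT; apply/subspace_continuousP => p0 Op0.
have [d [d0 Dp0 [N [e [e0 He]]]]] := Om_domain Op0.
have [_ ph] := FT _ _ d0 Dp0.
apply/cvgrPdist_le => eps eps0; have /cvgrPdist_le/(_ _ eps0)[K [s [s0 Hs]]] := ph.
have [mu mS] := superexp_exists.
have me : 0 < Num.min e s by rewrite lt_min e0.
have [nu nS [nu1 nu2]] := superexp_cut (maxn N K) mS me.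
apply: filterS (nbhs_toP p0 nS) => p Hp Op.
have small i : (pdeg i <= maxn N K)%N -> nr (toP p i - toP p0 i) <= Num.min e s.
  by move=> iN; rewrite (le_trans (Hp i))// nu2.
apply: Hs => [|i iK].
  apply: He => // i iN; have := small i (leq_trans iN (leq_maxl _ _)).
  by rewrite le_min => /andP[].
have := small i (leq_trans iK (leq_maxr _ _)).
by rewrite le_min => /andP[].
Qed.
End ParameterContinuity.

(** * The conditions on the jet *)

Section Echelon.
Context {R : realType}.
Notation C := (Cplx R).
Notation rho3 := ('I_3 -> germ R (3 + 3)).
Variable S : set rho3.
Hypothesis S_real : real_subspace S.

(* Real and imaginary parts of the coefficients of s, enumerated. *)
Definition position (n : nat) (s : rho3) : R :=
  if unpickle n is Some (j, a, b) then
    let c : R[i] := germ_ps (s j) (a : {ffun 'I_(3 + 3) -> nat}) in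
    if b then complex.Re c else complex.Im c
  else 0.

Lemma positionB n s t (c : R) :
  position n (fun j => s j + (c%:C)%C *: t j) = position n s + c * position n t.
Proof.
rewrite /position; case: unpickle => [[[j a] b]|]; last by rewrite mulr0 addr0.
rewrite germD germZ coefD coefZ.
by case: (germ_ps (s j) a) => x y; case: (germ_ps (t j) a) => x' y'; case: b; rewrite /=; ring.
Qed.

Lemma positionZ n t (c : R) : position n (fun j => (c%:C)%C *: t j) = c * position n t.
Proof.
rewrite /position; case: unpickle => [[[j a] b]|]; last by rewrite mulr0.
rewrite germZ coefZ.
by case: (germ_ps (t j) a) => x' y'; case: b; rewrite /=; ring.
Qed.

(* S need not be finite dimensional. An echelon family of S suffices to test (star):
   modulo it every element of S vanishes to any prescribed order. *)
Definition leads n s := [/\ S s, forall i, (i < n)%N -> position i s = 0 & position n s = 1].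

(** Where no element of S has leading position n the entry is 0, which lies in S and yields a
    trivial equation. *)
Definition echelon n : rho3 :=
  if pselect (exists s, leads n s) is left e then projT1 (cid e) else fun=> 0.

Lemma echelonS n : S (echelon n).
Proof.
rewrite /echelon; case: pselect => [e|_]; last by case: S_real.
by case: (cid e) => s /= [].
Qed.

Lemma echelon_leads n s : leads n s -> leads n (echelon n).
Proof. by move=> sn; rewrite /echelon; case: pselect => [e|[]]; [case: cid|exists s]. Qed.

(** Gaussian elimination: positions are cleared one at a time by real multiples of echelon elements,
    on which Z is 0. *)
Lemma echelon_reduce (Z : rho3 -> C) :
  (forall s t (c : R), Z (fun j => s j + (c%:C)%C *: t j) = Z s + (c%:C)%C * Z t) ->
  (forall n, Z (echelon n) = 0) -> forall N s, S s ->
  exists t, [/\ S t, forall i, (i < N)%N -> position i t = 0 & Z s = Z t].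
Proof.
move=> ZD Z0 N s Ss; elim: N => [|N [t [St t0 Zt]]]; first by exists s.
have [S0 SD SZ] := S_real.
have realC (c : R) : ((c%:C)%C : C) \is Num.real by rewrite complex_real.
have [tN|tN] := eqVneq (position N t) 0.
  by exists t; split=> // i; rewrite ltnS leq_eqVlt => /orP[/eqP ->|/t0].
have /echelon_leads[Se e0 eN] : leads N (fun j => ((position N t)^-1%:C)%C *: t j).
  split=> [|i iN|]; [exact: SZ|by rewrite positionZ (t0 _ iN) mulr0|].
  by rewrite positionZ mulVf.
exists (fun j => t j + ((- position N t)%:C)%C *: echelon N j); split.
- by apply: SD => //; exact: SZ.
- move=> i; rewrite positionB ltnS leq_eqVlt => /orP[/eqP ->|iN].
    by rewrite eN mulr1 subrr.
  by rewrite t0// e0// mulr0 addr0.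
- by rewrite ZD Z0 mulr0 addr0.
Qed.

Lemma position_low M : exists N, forall s, (forall i, (i < N)%N -> position i s = 0) ->
  forall j, ordw (fun=> 1%N) M (germ_ps (s j)).
Proof.
pose code (x : 'I_3 * {ffun 'I_(3 + 3) -> 'I_M} * bool) : nat :=
  pickle (x.1.1, [ffun i => val (x.1.2 i)] : {ffun 'I_(3 + 3) -> nat}, x.2).
(* Only finitely many positions concern coefficients of degree below M, so their codes have a
   maximum. *)
exists (\max_x code x).+1 => s s0 j a; rewrite wdeg1 => aM.
have /boxP aI := mdeg_box aM.
pose a' : {ffun 'I_(3 + 3) -> 'I_M} := [ffun i => Ordinal (aI i)].
have p0 b : position (code (j, a', b)) s = 0 by apply: s0; rewrite ltnS leq_bigmax.
have aE : (([ffun i => val (a' i)] : {ffun 'I_(3 + 3) -> nat}) : _ -> _) = a.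
  by apply/funext => i; rewrite !ffunE.
have := p0 true; have := p0 false; rewrite /position /code !pickleK /= aE.
by case: (germ_ps (s j) a) => x y /= -> ->.
Qed.
End Echelon.

Section EqLinear.
Context {R : realType}.
Notation C := (Cplx R).
Variables (H : 'I_3 -> fps R 2) (Q : fps R 3).
Hypothesis H0 : forall k, z0 (H k).
Hypothesis Qz : z0 Q.
Notation E rho al := (Eq H rho al x0 Q x1 x2).

(** Scalars are real because the equation contains both r and its conjugate; this matches S being a
    real subspace. *)
Lemma Eq_rhoD (al : 'I_3 -> fps R 2) (s t : 'I_3 -> fps R (3 + 3)) (c : R) :
  E (fun j => s j + (c%:C)%C *: t j) al = E s al + (c%:C)%C *: E t al.
Proof.
rewrite /Eq scaler_sumr -big_split; apply: eq_bigr => j _ /=.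
rewrite /cof /cobar compD compZ.
have -> : bar (s j + (c%:C)%C *: t j : fps R (3 + 3)) =
    (bar (s j) : fps R (3 + 3)) + (c%:C)%C *: (bar (t j) : fps R (3 + 3)).
  apply/funext => a; rewrite /bar !coefD !coefZ rmorphD rmorphM /=; congr (_ + _ * _).
  by apply: conj_Creal; rewrite complex_real.
rewrite compD compZ.
move: (comp (s j) _) (comp (t j) _) (comp (bar (s j)) _) (comp (bar (t j)) _)
  (comp (al j) _) (comp (bar (al j)) _) => a b a' b' u v.
by rewrite !mulrDl scalerDr -!scalerAl addrACA.
Qed.

Lemma Eq_low al rho N : (forall j, ordw (fun=> 1%N) N (rho j)) ->
  ordw (fun=> 1%N) N (E rho al).
Proof.
move=> rN; have xz i : z0 (fX i : fps R 3) := fX0 i.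
have hz k : z0 (Hof H x0 Q k) := Hof0 H0 k (xz o30) Qz.
have hb k : z0 (Hbof H x1 x2 k) := Hbof0 H0 k (xz o31) (xz o32).
have g1 (g : 'I_(3 + 3) -> fps R 3) : g0 g -> forall i, ordw (fun=> 1%N) 1 (g i).
  by move=> gz i c; rewrite wdeg1 ltnS leqn0 => /eqP/mdeg_eq0 ->.
apply: ordw_sum => j _; apply: ordwD; apply: ordwMr.
  exact: (ordw_comp (v := fun=> 1%N) (g1 _ (s33_0 hz hb)) (rN j)).
apply: (ordw_comp (v := fun=> 1%N) (g1 _ (s33_0 hb hz))) => a aN.
by rewrite /bar (rN j) ?rmorph0.
Qed.

(** The equation is only real linear in alpha; separating Lam from its conjugate produces the f_n
    and the g_n. *)
Lemma Eq_alphaE (J : finType) (Lam : J -> C) (K : J -> 'I_3 -> fps R 2) rho :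
  E rho (fun i => \sum_j Lam j *: K j i) = \sum_j
    (Lam j *: (\sum_i cof H (rho i) x0 Q x1 x2 * comp (K j i) (s2 x0 Q)) +
     (Lam j)^* *: (\sum_i cobar H (rho i) x0 Q x1 x2 * comp (bar (K j i)) (s2 x1 x2))).
Proof.
rewrite big_split /=; under eq_bigr do rewrite scaler_sumr.
under [X in _ + X]eq_bigr do rewrite scaler_sumr.
rewrite exchange_big [X in _ + X]exchange_big -big_split; apply: eq_bigr => i _ /=.
congr (_ + _).
  by rewrite comp_sum mulr_sumr; apply: eq_bigr => j _; rewrite compZ scalerAr.
have -> : bar (\sum_j Lam j *: K j i) = \sum_j (Lam j)^* *: (bar (K j i) : fps R 2).
  rewrite bar_sum; apply: eq_bigr => j _; apply/funext => a.
  by rewrite /bar !coefZ rmorphM.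
by rewrite comp_sum mulr_sumr; apply: eq_bigr => j _; rewrite compZ scalerAr.
Qed.
End EqLinear.

Section Jets.
Context {R : realType}.
Notation C := (Cplx R).

Lemma lagrZD (u f g : fps R 2) (c : C) : lagr u (c *: f + g) = c *: lagr u f + lagr u g.
Proof.
apply/funext => b; rewrite coefD coefZ /lagr.
by rewrite !mulrDl -!scalerAl coefD coefZ.
Qed.

Lemma lagr0 (u : fps R 2) : lagr u 0 = 0.
Proof. by apply/funext => b; rewrite /lagr !mul0r. Qed.

Lemma jet_remainder (al : 'I_3 -> germ R 2) (Lam : jidx -> C) : jet4 al = Lam ->
  forall h, ordw (fun=> 1%N) 5 (gps al h - \sum_j Lam j *: (jet_poly j h : fps R 2)).
Proof.
move=> <- h b; rewrite wdeg1 (m2E b) mdeg_m2 => b5.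
have b0 : (b o20 < 5)%N by apply: leq_ltn_trans b5; exact: leq_addr.
have b1 : (b o21 < 5)%N by apply: leq_ltn_trans b5; exact: leq_addl.
pose j0 : jidx := exist _ (h, Ordinal b0, Ordinal b1) b5.
rewrite coefD coefN coef_sum (bigD1 j0)//= big1 => [|j jj0]; last first.
  rewrite coefZ /jet_poly; case: ifPn => [/eqP hj|]; last by rewrite mulr0.
  rewrite coefZ /mono m2_inj; case: andP => [[/eqP e0 /eqP e1]|]; last by rewrite !mulr0.
  case/eqP: jj0; apply/val_inj; move: hj e0 e1; case: (val j) => [[h' a0] a1] /= <- e0 e1.
  by congr (_, _, _); apply/val_inj.
rewrite addr0 coefZ /jet_poly /= eqxx coefZ /mono eqxx mulr1 /jet4 /partial0 /=.
have -> : (\prod_(i < 2) (midx [:: b o20; b o21] i)`! = (b o20)`! * (b o21)`!)%N.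
  rewrite (bigD1 o20)//= (bigD1 o21)//= big1 ?muln1//.
  by move=> -[[|[|i]] lti].
rewrite mulrAC divff ?mul1r ?subrr// pnatr_eq0 muln_eq0 negb_or -!lt0n !fact_gt0//.
Qed.
End Jets.

Section Blowdown.
Context {R : realType}.

Definition blowdown (f : fps R 2) : fps R 2 := fun b => f (m2 (b o20 + b o21) (b o21)).

Lemma blowdownK (f : fps R 2) :
  (forall m k, (m < k)%N -> f (m2 m k) = 0) -> f = blow (blowdown f).
Proof.
move=> f0; apply/funext => b; rewrite (m2E b) coef_blow.
case: leqP => [kb|/f0 //]; rewrite /blowdown /m2 /=.
by rewrite subnK.
Qed.

Lemma blowK (f : fps R 2) : blowdown (blow f) = f.
Proof.
apply/funext => b; rewrite /blowdown coef_blow leq_addl addnK.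
by rewrite -m2E.
Qed.

Lemma blow_low (f : fps R 2) m k : (m < k)%N -> blow f (m2 m k) = 0.
Proof. by move=> mk; rewrite coef_blow leqNgt mk. Qed.
End Blowdown.

Section Jet.
Context {R : realType}.
Notation C := (Cplx R).
Variables (r : 'I_3 -> 'I_3 -> germ R (3 + 3)) (iota : 'I_3 -> nat).
Hypothesis iota_le2 : forall k, (iota k <= 2)%N.
Notation P := (pidx -> C).
Let rr k j : fps R (3 + 3) := germ_ps (r k j).
Let cr k j : convergent (rr k j). Proof. exact: germP. Qed.
Let Om := Omega1 r iota `*` @Omega2 R.

(** The value 0 is a default where the series diverges; for tame F this does not happen on [Om]
    ([germ_ofE]). *)
Definition germ_of n (F : P -> fps R n) (p : germ3 R * germ R 3) : germ R n :=
  if pselect (convergent (F (toP p))) is left c then mkgerm c else 0.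

Lemma germ_ofE n (F : P -> fps R n) p :
  (forall d p0, 0 < d -> admissible r iota d p0 -> tame pdeg (admissible r iota d) p0 F) ->
  Om p -> germ_ps (germ_of F p) = F (toP p).
Proof.
move=> FT /Om_domain[d [d0 Dp _]]; rewrite /germ_of; case: pselect => // -[].
have [rho rho0 bp] := toP_bdd p.
have [e [M [e0 FM]]] := (FT _ _ d0 Dp).2 rho rho0.
by apply/convergentP; exists e, M; split; [exact: e0|exact: FM].
Qed.

Lemma germ_of_cont n (F : P -> fps R n) :
  (forall d p0, 0 < d -> admissible r iota d p0 -> tame pdeg (admissible r iota d) p0 F) ->
  {within Om, continuous (germ_of F)}.
Proof. by move=> FT; apply: (cont_germ (F := F)) => // p; exact: germ_ofE. Qed.

Definition PsiP j l (p : P) := PsiF rr iota (Hp p) (Qp p) j l.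
Definition KP j l (p : P) := KF rr iota (Hp p) (Qp p) j l.
Definition EqLP rho j (p : P) := EqL rr iota rho (Hp p) (Qp p) j.
Definition EqAP rho j (p : P) := EqA rr iota rho (Hp p) (Qp p) j.

Section Tame.
Variables (d : R) (p0 : P).
Hypotheses (d0 : 0 < d) (Dp0 : admissible r iota d p0).
Let DH p : admissible r iota d p -> forall k, z0 (Hp p k). Proof. by case=> -[]. Qed.
Let DQ p : admissible r iota d p -> z0 (Qp p). Proof. by case=> -[]. Qed.
Let Dd1 p : admissible r iota d p -> d <= nr (det1 rr iota (Hp p) (Qp p) (mi0 2)).
Proof. by case. Qed.
Let Dd2 p : admissible r iota d p -> d <= nr (det2 rr iota (Hp p) (Qp p) (mi0 2)).
Proof. by case. Qed.
Let Du p : admissible r iota d p -> d <= nr (normal_quotient (Qp p) (mi0 2)). Proof. by case. Qed.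
Let crho (rho : 'I_3 -> germ R (3 + 3)) i : convergent (rps rho i).
Proof. exact: germP. Qed.

Lemma tame_PsiP j l : tame pdeg (admissible r iota d) p0 (PsiP j l).
Proof. exact: (tame_PsiF cr Dp0 DH DQ d0 Dd1 Dd2 Du). Qed.
Lemma tame_KP j l : tame pdeg (admissible r iota d) p0 (KP j l).
Proof. exact: (tame_KF cr Dp0 DH DQ d0 Dd1 Dd2 Du). Qed.
Lemma tame_EqLP rho j : tame pdeg (admissible r iota d) p0 (EqLP (rps rho) j).
Proof. exact: (tame_EqL cr Dp0 DH DQ d0 Dd1 Dd2 Du j (crho rho)). Qed.
Lemma tame_EqAP rho j : tame pdeg (admissible r iota d) p0 (EqAP (rps rho) j).
Proof. exact: (tame_EqA cr Dp0 DH DQ d0 Dd1 Dd2 Du j (crho rho)). Qed.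
End Tame.

Section Point.
Variables (H : germ3 R) (Q : germ R 3).
Hypotheses (OH : Omega1 r iota H) (OQ : Omega2 Q).
Let p : germ3 R * germ R 3 := (H, Q).
Variable Lam : jidx -> C.
Let Op : Om p. Proof. by split. Qed.

Lemma PsiLam_coef l :
  germ_ps (\sum_j Lam j *: germ_of (PsiP j l) p) =
  \sum_j Lam j *: PsiF rr iota (gps H) (germ_ps Q) j l.
Proof.
rewrite germ_sum; apply: eq_bigr => j _; rewrite germZ; congr (_ *: _).
exact: (germ_ofE (fun d p0 d0 D => tame_PsiP d0 D j l) Op).
Qed.

Lemma KLam_coef l :
  germ_ps (\sum_j Lam j *: germ_of (KP j l) p) =
  \sum_j Lam j *: KF rr iota (gps H) (germ_ps Q) j l.
Proof.
rewrite germ_sum; apply: eq_bigr => j _; rewrite germZ; congr (_ *: _).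
exact: (germ_ofE (fun d p0 d0 D => tame_KP d0 D j l) Op).
Qed.

Lemma KLam_blowdown l :
  germ_ps (\sum_j Lam j *: germ_of (KP j l) p) =
  blowdown (germ_ps (\sum_j Lam j *: germ_of (PsiP j l) p)).
Proof.
rewrite KLam_coef PsiLam_coef; apply/funext => b; rewrite /blowdown !coef_sum.
by apply: eq_bigr => j _; rewrite !coefZ.
Qed.

Lemma H_z0 k : z0 (gps H k).
Proof. by have [[h _] _ _ _] := Om_good Op; exact: h. Qed.

Lemma Q_z0 : z0 (germ_ps Q).
Proof. by have [[_ h] _ _ _] := Om_good Op; exact: h. Qed.

(** A solution is the polynomial with its jet plus a remainder of order 5, which [Phi_jet] kills. So
    alpha(z, Q(z, chi, 0)) is the combination of the [PhiF] with coefficients Lam, and [lagr_comp]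
    straightens the curve. *)
Lemma PsiLam_solution (al : 'I_3 -> germ R 2) :
  (forall k, Eq (gps H) (rr k) (gps al) x0 (germ_ps Q) x1 x2 = 0) -> jet4 al = Lam ->
  forall l, germ_ps (\sum_j Lam j *: germ_of (PsiP j l) p) = blow (gps al l).
Proof.
move=> sol jet l; rewrite PsiLam_coef.
have [Qz n1 n2 n3] := normal_formal OQ.1.
have [_ d1 d2 u0] := Om_good Op.
have S12 := Phi_solution H_z0 Qz n3 d1 d2 sol.
have de5 := jet_remainder jet.
set de : 'I_3 -> fps R 2 := fun h => gps al h - \sum_j Lam j *: (jet_poly j h : fps R 2) in de5.
have de0 := Phi_jet rr (gps H) Qz n2 n3 iota_le2 de5.
(* Stated for an arbitrary list with the remainder added, because [Phi_ZD] peels off one scalar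
   multiple at a time. *)
have split_al s : S1 rr iota (gps H) (germ_ps Q) (S2 rr iota (gps H) (germ_ps Q)
     (fun h => \sum_(j <- s) Lam j *: (jet_poly j h : fps R 2) + de h)) l =
   \sum_(j <- s) Lam j *: PhiF rr iota (gps H) (germ_ps Q) j l.
  elim: s => [|j s IH].
    rewrite big_nil (_ : (fun h => _) = de) ?de0//.
    by apply/funext => h; rewrite big_nil add0r.
  rewrite big_cons -IH -Phi_ZD; congr (S1 _ _ _ _ (S2 _ _ _ _ _) l).
  apply/funext => h; rewrite big_cons. exact: (esym (addrA _ _ _)).
have alE : (fun h => \sum_(j <- index_enum jidx) Lam j *: (jet_poly j h : fps R 2) + de h) = gps al.
  by apply/funext => h; rewrite /de addrC subrK.
have := split_al (index_enum jidx); rewrite alE.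
have := congr1 (fun f => f l) S12; rewrite (q0E n2 n1) => <- E.
have <- := lagr_comp (gps al l) u0.
transitivity (lagr (normal_quotient (germ_ps Q)) (\sum_j Lam j *: PhiF rr iota (gps H) (germ_ps Q) j l)).
  elim: (index_enum jidx) => [|j s IH]; first by rewrite !big_nil lagr0.
  by rewrite !big_cons IH lagrZD.
by rewrite -E.
Qed.
End Point.
End Jet.

Section Conditions.
Context {R : realType}.
Notation C := (Cplx R).

(* B(z) = z, for every Q. *)
Definition germX : germ R 1 := mkgerm (conv_x ord0).

Lemma germX_neq0 : germX != 0.
Proof.
apply/eqP => /(congr1 (fun f : germ R 1 => germ_ps f (fun j => j == ord0))).
by rewrite germ0 /= /fX /mono eqxx => /eqP; rewrite oner_eq0.
Qed.

(** The implications form a circle: extension, vanishing of the coefficients with m < k, agreement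
    with K, extension. *)
Lemma extends_germX (Phi K : germ R 2) : germ_ps K = blowdown (germ_ps Phi) ->
  (extends Phi germX <-> forall m k, (m < k)%N -> germ_ps Phi (m2 m k) = 0) /\
  (extends Phi germX <-> agree Phi germX K).
Proof.
move=> KE; have aP F := @agreeP R Phi F germX erefl.
have low : extends Phi germX -> forall m k, (m < k)%N -> germ_ps Phi (m2 m k) = 0.
  by move=> [F /aP ->] m k; exact: blow_low.
have ag : (forall m k, (m < k)%N -> germ_ps Phi (m2 m k) = 0) -> agree Phi germX K.
  by move=> /blowdownK PE; apply/aP; rewrite KE.
split; split=> [|h]; [exact: low|by exists K; exact: ag|by move/low/ag|by exists K].
Qed.

Lemma solves_countable (S : set ('I_3 -> germ R (3 + 3))) (H : 'I_3 -> germ R 2)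
    (Q : germ R 3) (al : 'I_3 -> germ R 2) : real_subspace S ->
  (forall k, z0 (gps H k)) -> z0 (germ_ps Q) ->
  solves S H Q al <-> forall m (a : {ffun 'I_3 -> nat}),
    Eq (gps H) (rps (echelon S m)) (gps al) x0 (germ_ps Q) x1 x2 a = 0.
Proof.
move=> S_real H0 Qz; rewrite solvesP//; split=> [sol m a|sol s Ss].
  by rewrite sol//; exact: echelonS.
(* One coefficient at a time: modulo the echelon, s is replaced by an element of order |b| + 1,
   whose equation has coefficient 0 at b. *)
apply/funext => b; have [N HN] := @position_low R (mdeg b).+1.
pose Z t := Eq (gps H) (rps t) (gps al) x0 (germ_ps Q) x1 x2 b.
have ZD s' t (c : R) : Z (fun j => s' j + (c%:C)%C *: t j) = Z s' + (c%:C)%C * Z t.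
  rewrite /Z -coefZ -coefD -Eq_rhoD.
  have -> : rps (fun j => s' j + (c%:C)%C *: t j) = fun j => rps s' j + (c%:C)%C *: rps t j.
    by apply/funext => j; rewrite /rps germD germZ.
  by [].
have Ze n : Z (echelon S n) = 0.
  have bE : b = [ffun i => b i] by apply/funext => i; rewrite ffunE.
  by rewrite /Z bE sol.
have [t [_ /HN t0 Zt]] := echelon_reduce S_real ZD Ze N Ss.
rewrite -[LHS]/(Z s) Zt; apply: (Eq_low H0 Qz (gps al) t0).
by rewrite wdeg1.
Qed.
End Conditions.

Theorem proposition31 (R : realType) (S : set ('I_3 -> germ R (3 + 3)))
    (r : 'I_3 -> 'I_3 -> germ R (3 + 3)) (iota : 'I_3 -> nat)
    (S_real : real_subspace S) (r_in_S : forall k, S (r k))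
    (iota_le2 : forall k, (iota k <= 2)%N) :
  exists (Psi K : germ3 R * germ R 3 -> jidx -> 'I_3 -> germ R 2)
    (B : germ R 3 -> germ R 1)
    (d e f g : nat -> germ3 R * germ R 3 -> jidx -> 'I_3 -> Cplx R),
  let Om := Omega1 r iota `*` Omega2 in
  [/\ forall j l, {within Om, continuous (fun p => Psi p j l)},
      forall j l, {within Om, continuous (fun p => K p j l)},
      {within Omega2, continuous B} /\ (forall Q, Omega2 Q -> B Q != 0),
      forall n j l, [/\ {within Om, continuous (fun p => d n p j l)},
        {within Om, continuous (fun p => e n p j l)},
        {within Om, continuous (fun p => f n p j l)} &
        {within Om, continuous (fun p => g n p j l)}] &
      forall (H : germ3 R) (Q : germ R 3),
        Omega1 r iota H -> Omega2 Q ->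
      forall Lam : jidx -> Cplx R, J04 Lam ->
      let p := (H, Q) in
      let PsiLam l := \sum_(j : jidx) Lam j *: Psi p j l in
      let KLam l := \sum_(j : jidx) Lam j *: K p j l in
      let i := forall l, extends (PsiLam l) (B Q) in
      let ii := jet4 KLam = Lam in
      let iii := solves S H Q KLam in
      [/\ (exists alpha : 'I_3 -> germ R 2,
              [/\ evalv alpha 0 = 0, solves S H Q alpha & jet4 alpha = Lam])
            <-> [/\ i, ii & iii],
          i <-> (forall n l, \sum_(j : jidx) d n p j l * Lam j = 0),
          i <-> (forall l, agree (PsiLam l) (B Q) (KLam l)),
          i -> (ii <-> forall n l, \sum_(j : jidx) e n p j l * Lam j = 0) &
          i -> (iii <-> forall n l, \sum_(j : jidx)
                  (f n p j l * Lam j + g n p j l * (Lam j)^*) = 0)]].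
Proof.
pose psi := PsiP r iota; pose kk := KP r iota.
have psiT j l d p0 (d0 : 0 < d) (D : admissible r iota d p0) := tame_PsiP d0 D j l.
have kT j l d p0 (d0 : 0 < d) (D : admissible r iota d p0) := tame_KP d0 D j l.
(* The countable index sets of the conditions are coded by natural numbers; numbers that code
   nothing give 0 = 0. *)
pose dd n (q : pidx -> Cplx R) j l : Cplx R := if unpickle n is Some (m, k)
  then if (m < k)%N then psi j l q (m2 m k) else 0 else 0.
(* Here n codes a jet coordinate, which belongs to one component; for the other l the equation is
   trivial. *)
pose ee n (q : pidx -> Cplx R) (j : jidx) (l : 'I_3) : Cplx R :=
  if unpickle n is Some j' then
    if l == (val (j' : jidx)).1.1 then
      partial0 (kk j l q) (midx [:: val (val j').1.2; val (val j').2]) - (j == j')%:R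
    else 0
  else 0.
(* Here n codes an echelon element and a coefficient of its scalar equation, which is repeated for
   the three values of l. *)
pose ff n (q : pidx -> Cplx R) (j : jidx) (l : 'I_3) : Cplx R :=
  if unpickle n is Some (m, a) then
    EqLP r iota (rps (echelon S m)) j q (a : {ffun 'I_3 -> nat}) else 0.
pose gg n (q : pidx -> Cplx R) (j : jidx) (l : 'I_3) : Cplx R :=
  if unpickle n is Some (m, a) then
    EqAP r iota (rps (echelon S m)) j q (a : {ffun 'I_3 -> nat}) else 0.
exists (fun p j l => germ_of (psi j l) p), (fun p j l => germ_of (kk j l) p), (fun=> germX),
  (fun n p j l => dd n (toP p) j l), (fun n p j l => ee n (toP p) j l),
  (fun n p j l => ff n (toP p) j l), (fun n p j l => gg n (toP p) j l).
split.
- by move=> j l; exact: (germ_of_cont (@psiT j l)).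
- by move=> j l; exact: (germ_of_cont (@kT j l)).
- by split=> [|Q _]; [exact: cst_continuous|exact: germX_neq0].
- move=> n j l; split.
  + apply: (cont_scalar (phi := fun q => dd n q j l)) => d p0 d0 D; rewrite /dd.
    case: unpickle => [[m k]|]; last exact: tameS_cst.
    case: (m < k)%N; last exact: tameS_cst.
    exact: (psiT _ _ _ _ d0 D).1.
  + apply: (cont_scalar (phi := fun q => ee n q j l)) => d p0 d0 D; rewrite /ee.
    case: unpickle => [j'|]; last exact: tameS_cst.
    case: (l == (val (j' : jidx)).1.1); last exact: tameS_cst.
    apply: tameSD; last exact: tameS_cst.
    apply: tameSM; [exact: tameS_cst|exact: (kT _ _ _ _ d0 D).1].
  + apply: (cont_scalar (phi := fun q => ff n q j l)) => d p0 d0 D; rewrite /ff.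
    case: unpickle => [[m a]|]; last exact: tameS_cst.
    exact: (tame_EqLP d0 D _ _).1.
  + apply: (cont_scalar (phi := fun q => gg n q j l)) => d p0 d0 D; rewrite /gg.
    case: unpickle => [[m a]|]; last exact: tameS_cst.
    exact: (tame_EqAP d0 D _ _).1.
move=> H Q OH OQ Lam LamJ p PsiLam KLam i ii iii.
have Kb l : germ_ps (KLam l) = blowdown (germ_ps (PsiLam l)).
  exact: (KLam_blowdown OH OQ Lam l).
have H0 := H_z0 OH OQ; have Qz := Q_z0 OH OQ.
have ilow : i <-> forall l m k, (m < k)%N -> germ_ps (PsiLam l) (m2 m k) = 0.
  by split=> h l; have [e _] := extends_germX (Kb l); [apply/e|apply/e; exact: h].
have iag : i <-> forall l, agree (PsiLam l) germX (KLam l).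
  by split=> h l; have [_ e] := extends_germX (Kb l); apply/e.
split.
- split=> [[al [_ sol jet]]|[_ jet sol]]; last first.
    (* The value at 0 is the constant term of the jet, which is 0 as Lam lies in [J04]. *)
    exists KLam; split=> //; apply/rowP => k; rewrite !mxE eval0.
    pose j0 : jidx := exist _ (k, ord0, ord0) isT.
    have := congr1 (fun L => L j0) jet; rewrite (LamJ j0 erefl) /jet4 /partial0 /=.
    rewrite (_ : midx [:: 0; 0]%N = mi0 2); last by apply/funext => -[[|[|a]] lta].
    by rewrite /mi0 big1// mul1r.
  have solr k : Eq (gps H) (rps (r k)) (gps al) x0 (germ_ps Q) x1 x2 = 0.
    exact: ((solvesP S al H0 Qz).1 sol).
  have PE l : germ_ps (PsiLam l) = blow (gps al l).
    exact: (PsiLam_solution iota_le2 OH OQ solr jet).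
  (* Psi(z, t) = alpha(z, z t) determines alpha, so the candidate is the given solution and has its
     properties. *)
  have KE : KLam = al.
    by apply/funext => l; apply: germ_eq; rewrite Kb PE blowK.
  rewrite /ii /iii KE; split=> //; apply/ilow => l m k mk.
  by rewrite PE blow_low.
- have PE l b : germ_ps (PsiLam l) b = \sum_j psi j l (toP p) b * Lam j.
    rewrite (PsiLam_coef OH OQ) coef_sum; apply: eq_bigr => j _.
    by rewrite coefZ mulrC.
  rewrite ilow; split=> [h n l|h l m k mk].
    rewrite /dd; case: unpickle => [[m k]|]; last by rewrite big1// => j _; rewrite mul0r.
    case: (boolP (m < k)%N) => mk; last by rewrite big1// => j _; rewrite mul0r.
    by rewrite -PE h.
  by have := h (pickle (m, k)) l; rewrite /dd pickleK mk PE.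
- exact: iag.
- move=> _.
  have KE (j' : jidx) : jet4 KLam j' - Lam j' = \sum_j ee (pickle j') (toP p) j (val j').1.1 * Lam j.
    rewrite /jet4 /partial0 (KLam_coef OH OQ) coef_sum mulr_sumr.
    under [in RHS]eq_bigr do rewrite /ee pickleK eqxx mulrBl.
    rewrite sumrB; congr (_ - _).
      by apply: eq_bigr => j _; rewrite coefZ /partial0 mulrCA mulrC.
    rewrite (bigD1 j')//= eqxx mul1r big1 ?addr0// => j /negPf ->.
    by rewrite mul0r.
  split=> [jet n l|h].
    have := pickleK (T := jidx); rewrite /ee; case En : (unpickle n) => [j'|] _.
      case: eqP => [->|_]; last by rewrite big1// => j _; rewrite mul0r.
      have := KE j'; rewrite {1}jet subrr => E; rewrite [RHS]E; apply: eq_bigr => j _.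
      by rewrite /ee pickleK eqxx.
    by rewrite big1// => j _; rewrite mul0r.
  by apply/funext => j'; apply/eqP; rewrite -subr_eq0 KE h.
move=> _.
have KE m : Eq (gps H) (rps (echelon S m)) (gps KLam) x0 (germ_ps Q) x1 x2 =
  \sum_j (Lam j *: EqLP r iota (rps (echelon S m)) j (toP p) +
     (Lam j)^* *: EqAP r iota (rps (echelon S m)) j (toP p)).
  rewrite -Eq_alphaE; congr (Eq _ _ _ _ _ _ _).
  by apply/funext => l; rewrite /gps (KLam_coef OH OQ).
rewrite /iii solves_countable//; split=> [h n l|h m a].
  rewrite /ff /gg; case: unpickle => [[m a]|]; last first.
    by rewrite big1// => j _; rewrite !mul0r addr0.
  rewrite -[RHS](h m a) KE coef_sum; apply: eq_bigr => j _.
  by rewrite coefD !coefZ mulrC [_ * (Lam j)^*]mulrC.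
rewrite KE coef_sum -[RHS](h (pickle (m, a)) ord0); apply: eq_bigr => j _.
by rewrite coefD !coefZ /ff /gg pickleK mulrC [_ * (Lam j)^*]mulrC.
Qed.
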